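(* Let $\rho_1$ be the representation of $Spin(m)$ on $\mathbb{R}^m$ given by the double covering $Spin(m)\to SO(m)$ followed by the standard representation $SO(m)\to GL(\mathbb{R}^m)$, and let $\rho_2$ be the representation of $Spin(m)$ on $\mathcal{M}_k$, $k\ge 1$. Then, as a representation of $Spin(m)$, we have the decomposition $$\mathcal{M}_k\otimes\mathbb{R}^m\;\cong\;\mathcal{M}_k[\times]\mathbb{R}^m\;\oplus\;\mathcal{M}_k\;\oplus\;\mathcal{M}_{k-1}\;\oplus\;\mathcal{M}_{k,1},$$ where $\mathcal{M}_{k,1}$ is a simplicial monogenic polynomial space as a $Spin(m)$ representation. The Rarita-Schwinger operator $R_k$ is the differential operator given by projecting the gradient onto the $\mathcal{M}_k$ component: for $f\in C^\infty(\mathbb{R}^m,\mathcal{M}_k)$ one has $\nabla f=(\partial_{x_1}f,\dots,\partial_{x_m}f)\in\mathcal{M}_k\otimes\mathbb{R}^m$ pointwise, and the projection of $\nabla f$ onto the component of $\mathcal{M}_k\otimes\mathbb{R}^m$ isomorphic to $\mathcal{M}_k$ (this component being identified with $\mathcal{M}_k$ by a suitable $Spin(m)$-equivariant isomorphism) is $R_kf$.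
   Context: $\mathcal{C}l_m$ is the real Clifford algebra generated by $\mathbb{R}^m$ with orthonormal basis $e_1,\dots,e_m$ and relations $e_ie_j+e_je_i=-2\delta_{ij}$, and $\mathcal{C}l_m(\mathbb{C})=\mathcal{C}l_m\otimes\mathbb{C}$. Reversion $a\mapsto\tilde a$ is the linear anti-involution with $\widetilde{e_{j_1}\cdots e_{j_r}}=e_{j_r}\cdots e_{j_1}$. $Spin(m)$ is the group of products $y_1\cdots y_{2p}$ of an even number of unit vectors of $\mathbb{R}^m$ inside $\mathcal{C}l_m$; the double covering of $SO(m)$ sends $s$ to the map $x\mapsto sx\tilde s$. $\mathcal{S}$ is the spinor space, on which $Spin(m)$ acts by left multiplication: for $m=2n$ it is the left ideal $\mathcal{S}=\mathcal{C}l_m(\mathbb{C})I$ with $I=f_1f_1^\dagger\cdots f_nf_n^\dagger$, $f_j=\frac{e_j-ie_{j+n}}{2}$, $f_j^\dagger=-\frac{e_j+ie_{j+n}}{2}$ (Dirac spinors); for $m=2n+1$ it is the space of the spin representation. The Dirac operator is $D_x=\sum_{i=1}^m e_i\partial_{x_i}$. $\mathcal{M}_k=\mathcal{M}_k(\mathbb{R}^m,\mathcal{S})$ is the space of $\mathcal{S}$-valued polynomials $p(u)$, $u\in\mathbb{R}^m$, homogeneous of degree $k$, with $D_up=0$; $Spin(m)$ acts on it by $(s\cdot p)(u)=s\,p(\tilde sus)$, and it is regarded as an irreducible representation of $Spin(m)$. $\mathcal{M}_{k,1}$ is the space of simplicial monogenic polynomials of degree $(k,1)$: $\mathcal{S}$-valued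 polynomials $p(u,v)$, $u,v\in\mathbb{R}^m$, homogeneous of degree $k$ in $u$ and of degree $1$ in $v$, with $D_up=0$, $D_vp=0$ and $\sum_{i=1}^m u_i\partial_{v_i}p=0$, with $Spin(m)$ action $(s\cdot p)(u,v)=s\,p(\tilde sus,\tilde svs)$. For irreducible representations $V,W$ of a compact Lie group on inner product spaces, $V[\times]W$ denotes the irreducible representation of $V\otimes W$ whose representation space has largest dimension; it is known as the Cartan product of the two representations. ''Projecting onto a component'' means orthogonal projection with respect to the inner product. With $\mathcal{H}_k$ the space of $\mathcal{S}$-valued harmonic polynomials in $u$ homogeneous of degree $k$, one has $\mathcal{H}_k=\mathcal{M}_k\oplus u\mathcal{M}_{k-1}$; $P_k:\mathcal{H}_k\to\mathcal{M}_k$ is the corresponding projection, $P_k=\frac{uD_u}{m+2k-2}+1$. The Rarita-Schwinger operator is $R_kf(x,u)=P_kD_xf(x,u)$ for $f\in C^\infty(\mathbb{R}^m,\mathcal{M}_k)$.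
   Formalization: Assumes m ≥ 3 (false for m = 2 by dimension, and for m = k = 1); the Cartan product is the component whose highest weight is the sum of the highest weights, not the one of largest dimension (false for m = 11, k = 2), extended additively for even m, where M_k is reducible. *)

(* Defs.v *)
(* MathComp / MathComp-Analysis *)
From HB Require Import structures.
From mathcomp Require Import all_boot all_order all_algebra.

Set Implicit Arguments.
Unset Strict Implicit.
Unset Printing Implicit Defensive.

Import Order.TTheory GRing.Theory Num.Theory.

Local Open Scope ring_scope.

(* An element of Cl_m over K is the family of its coordinates on the basis
   e_A = e_{j_1} ... e_{j_r}, A = {j_1 < ... < j_r}.  Moving the factors of e_B
   through those of e_A gives e_A e_B = (-1)^N e_{A Δ B}, where N counts the
   pairs (i, j) in A x B with j <= i: a transposition for each j < i, and
   e_i ^ 2 = -1 for each j = i. *)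
Section Clifford.
Variables (K : comNzRingType) (m : nat).

Definition clifford := {ffun {set 'I_m} -> K^o}.

HB.instance Definition _ := GRing.Lmodule.on clifford.

Definition symdiff (A B : {set 'I_m}) : {set 'I_m} :=
  [set i | (i \in A) (+) (i \in B)].

Definition cl_sign (A B : {set 'I_m}) : bool :=
  \big[addb/false]_(i in A) \big[addb/false]_(j in B) (j <= i)%N.

Definition cl_one : clifford := [ffun A => (A == set0)%:R].

Definition cl_mul (a b : clifford) : clifford :=
  [ffun C => \sum_A (-1) ^+ cl_sign A (symdiff A C) * a A * b (symdiff A C)].

Let symdiffA A B C : symdiff A (symdiff B C) = symdiff (symdiff A B) C.
Proof. by apply/setP => i; rewrite !inE addbA. Qed.

Let symdiffK A : involutive (symdiff A).
Proof. by move=> B; apply/setP => i; rewrite !inE addKb. Qed.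

Let symdiff0s A : symdiff set0 A = A.
Proof. by apply/setP => i; rewrite !inE. Qed.

Let symdiffss A : symdiff A A = set0.
Proof. by apply/setP => i; rewrite !inE addbb. Qed.

Let symdiffC A B : symdiff A B = symdiff B A.
Proof. by apply/setP => i; rewrite !inE addbC. Qed.

Let cl_sign0s A : cl_sign set0 A = false.
Proof. by rewrite /cl_sign big_set0. Qed.

Let cl_signs0 A : cl_sign A set0 = false.
Proof. by rewrite /cl_sign big1 // => i _; rewrite big_set0. Qed.

Let big_symdiff A B (F : 'I_m -> bool) :
  \big[addb/false]_(i in symdiff A B) F i =
  (\big[addb/false]_(i in A) F i) (+) (\big[addb/false]_(i in B) F i).
Proof.
rewrite big_mkcond [in RHS]big_mkcond [X in _ (+) X]big_mkcond -big_split /=.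
by apply: eq_bigr => i _; rewrite inE; case: (_ \in A); case: (_ \in B); case: F.
Qed.

Let cl_signDl A B C : cl_sign (symdiff A B) C = cl_sign A C (+) cl_sign B C.
Proof. exact: big_symdiff. Qed.

Let cl_signDr A B C : cl_sign A (symdiff B C) = cl_sign A B (+) cl_sign A C.
Proof.
by rewrite /cl_sign -big_split; apply: eq_bigr => i _; exact: big_symdiff.
Qed.

Fact cl_mulA : associative cl_mul.
Proof.
move=> a b c; apply/ffunP => D; rewrite !ffunE.
under eq_bigr do rewrite ffunE mulr_sumr.
under [RHS]eq_bigr do rewrite ffunE mulr_sumr mulr_suml.
rewrite [RHS]exchange_big /=; apply: eq_bigr => A _.
rewrite [RHS](reindex_inj (inv_inj (symdiffK A))) /=; apply: eq_bigr => B _.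
rewrite symdiffK (symdiffA B A D) (symdiffC B A).
have -> : (-1) ^+ cl_sign (symdiff A B) (symdiff (symdiff A B) D) *
    ((-1) ^+ cl_sign A B * a A * b B) * c (symdiff (symdiff A B) D) =
    (-1) ^+ cl_sign (symdiff A B) (symdiff (symdiff A B) D) *
    (-1) ^+ cl_sign A B * (a A * b B * c (symdiff (symdiff A B) D)).
  by rewrite !mulrA.
rewrite -signr_addb [in RHS]cl_signDl.
rewrite (_ : symdiff A D = symdiff B (symdiff (symdiff A B) D)); last first.
  by rewrite (symdiffC A B) -symdiffA symdiffK.
rewrite [cl_sign A (symdiff B _)]cl_signDr !mulrA.
rewrite -[_ * a A * (-1) ^+ _]mulrA [a A * _]mulrC !mulrA -signr_addb.
by congr (_ ^+ _ * _ * _ * _); case: (cl_sign A B); case: (cl_sign A _);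
  case: (cl_sign B _).
Qed.

Fact cl_mul1r : left_id cl_one cl_mul.
Proof.
move=> a; apply/ffunP => C; rewrite ffunE (bigD1 set0) //= ffunE eqxx symdiff0s.
rewrite cl_sign0s !mul1r big1 ?addr0 // => A /negPf nA.
by rewrite ffunE nA mulr0 mul0r.
Qed.

Fact cl_mulr1 : right_id cl_one cl_mul.
Proof.
move=> a; apply/ffunP => C; rewrite ffunE (bigD1 C) //= ffunE symdiffss eqxx.
rewrite cl_signs0 mul1r mulr1 big1 ?addr0 // => A nA; rewrite ffunE.
case: eqP => [AC0|]; last by rewrite mulr0.
by move: nA; rewrite -(symdiffK A C) AC0 symdiffC symdiff0s eqxx.
Qed.

Fact cl_mulDl : left_distributive cl_mul +%R.
Proof.
move=> a b c; apply/ffunP => C; rewrite !ffunE -big_split /=.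
by apply: eq_bigr => A _; rewrite ffunE mulrDr mulrDl.
Qed.

Fact cl_mulDr : right_distributive cl_mul +%R.
Proof.
move=> a b c; apply/ffunP => C; rewrite !ffunE -big_split /=.
by apply: eq_bigr => A _; rewrite ffunE mulrDr.
Qed.

Fact cl_oner_neq0 : cl_one != 0.
Proof. by apply/eqP => /ffunP/(_ set0)/eqP; rewrite !ffunE eqxx oner_eq0. Qed.

HB.instance Definition _ := GRing.Zmodule_isNzRing.Build clifford
  cl_mulA cl_mul1r cl_mulr1 cl_mulDl cl_mulDr cl_oner_neq0.

Fact cl_scalerAl (c : K) (a b : clifford) : c *: (a * b) = (c *: a) * b.
Proof.
apply/ffunP => C; rewrite !ffunE /GRing.scale /= mulr_sumr.
apply: eq_bigr => A _; rewrite ffunE /GRing.scale /= !mulrA.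
by rewrite [c * _]mulrC.
Qed.

HB.instance Definition _ := GRing.Lmodule_isLalgebra.Build K clifford cl_scalerAl.

Fact cl_scalerAr (c : K) (a b : clifford) : c *: (a * b) = a * (c *: b).
Proof.
apply/ffunP => C; rewrite !ffunE /GRing.scale /= mulr_sumr.
apply: eq_bigr => A _; rewrite ffunE /GRing.scale /=.
by rewrite mulrA [c * _]mulrC !mulrA.
Qed.

HB.instance Definition _ := GRing.Lalgebra_isAlgebra.Build K clifford cl_scalerAr.

Definition gen (i : 'I_m) : clifford := [ffun A => (A == [set i])%:R].

Lemma gen_anticomm (i j : 'I_m) :
  gen i * gen j + gen j * gen i = - (2 * (i == j)%:R)%:A.
Proof.
have gM (p q : 'I_m) : gen p * gen q =
    [ffun C => (-1) ^+ (q <= p)%N * (C == symdiff [set p] [set q])%:R].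
  apply/ffunP => C; rewrite !ffunE (bigD1 [set p]) //= big1 => [|A /negPf nA].
    rewrite !ffunE eqxx mulr1 addr0.
    rewrite -[C == _](inj_eq (inv_inj (symdiffK [set p]))) symdiffK.
    have [->|_] := eqVneq (symdiff _ C); last by rewrite !mulr0.
    by rewrite /cl_sign !big_set1.
  by rewrite ffunE nA mulr0 mul0r.
rewrite !gM; apply/ffunP => C; rewrite !ffunE (symdiffC [set j]) -mulrDl.
rewrite /GRing.scale /=; have [->|nij] := eqVneq i j.
  by rewrite leqnn symdiffss !expr1 mulr1 -opprD mulNr.
rewrite mulr0 mul0r oppr0; case: (ltngtP j i) => [_|_|/val_inj ji] /=.
- by rewrite addNr mul0r.
- by rewrite addrN mul0r.
- by rewrite ji eqxx in nij.
Qed.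

Definition reversion (a : clifford) : clifford :=
  \sum_A a A *: \prod_(j <- rev (enum A)) gen j.

Definition vec (u : 'rV[K]_m) : clifford := \sum_i u 0 i *: gen i.

Definition vec_part (a : clifford) : 'rV[K]_m := \row_i a [set i].

End Clifford.
Arguments gen {K m}.

From mathcomp Require Import complex.
From mathcomp Require Import all_classical all_reals all_analysis.
Import numFieldNormedType.Exports.
Local Open Scope classical_set_scope.
Local Open Scope complex_scope.

Section Spin.
Variables (R : realType) (m : nat).

Definition unit_vector (y : 'rV[R]_m) : bool := \sum_i y 0 i ^+ 2 == 1.

Definition spin : set (clifford R m) :=
  [set s | exists ys : seq 'rV[R]_m,
     [/\ ~~ odd (size ys), all unit_vector ys & s = \prod_(y <- ys) vec y]].

(* Column j holds the coordinates of s e_j s~. *)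
Definition rho1 (s : clifford R m) : 'M[R]_m :=
  \matrix_(i, j) vec_part (s * gen j * reversion s) 0 i.

Definition complexify (a : clifford R m) : clifford R[i] m :=
  [ffun A => (a A)%:C].

Fact half_fst_subproof (j : 'I_m./2) : (j < m)%N.
Proof. by rewrite (leq_trans (ltn_ord j)) // -divn2 leq_div. Qed.

Fact half_snd_subproof (j : 'I_m./2) : (j + m./2 < m)%N.
Proof.
apply: (@leq_trans (m./2 + m./2)); first by rewrite ltn_add2r.
by rewrite addnn -[leqRHS]odd_double_half leq_addl.
Qed.

(* With n = m./2, the coordinates j and j + n span the j-th of the n planes that
   enter the definition of f_j; these planes also give the maximal torus. *)
Definition fst_idx (j : 'I_m./2) : 'I_m := Ordinal (half_fst_subproof j).
Definition snd_idx (j : 'I_m./2) : 'I_m := Ordinal (half_snd_subproof j).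

(* exp (t/2 e_j e_{j+n}); these one-parameter groups generate a maximal torus of
   Spin(m). *)
Definition torus (j : 'I_m./2) (t : R) : clifford R m :=
  (cos (t / 2))%:A + sin (t / 2) *: (gen (fst_idx j) * gen (snd_idx j)).

End Spin.

Section Spinors.
Variables (R : realType) (m : nat).
Local Notation Cl := (clifford R[i] m).

Definition witt (j : 'I_m./2) : Cl :=
  2^-1 *: (gen (fst_idx j) - 'i%C *: gen (snd_idx j)).

Definition witt_dag (j : 'I_m./2) : Cl :=
  - (2^-1 *: (gen (fst_idx j) + 'i%C *: gen (snd_idx j))).

Definition primitive_idempotent : Cl := \prod_j (witt j * witt_dag j).

Definition dirac_spinors : set Cl := [set a * primitive_idempotent | a in setT].

Definition left_ideal (J : set Cl) : Prop :=
  [/\ J 0, forall a b, J a -> J b -> J (a + b) & forall a b, J b -> J (a * b)].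

Definition minimal_left_ideal (J : set Cl) : Prop :=
  [/\ left_ideal J, J <> [set 0] &
      forall L, left_ideal L -> L `<=` J -> L = [set 0] \/ L = J].

(* For odd m there are two simple Cl_m(C)-modules up to isomorphism; both restrict
   to the spin representation of Spin(m), and every minimal left ideal is a model of
   one of them. *)
Definition spinor_space (S : set Cl) : Prop :=
  if odd m then minimal_left_ideal S else S = dirac_spinors.

End Spinors.

Section DiracOperator.
Variables (R : realType) (m : nat).
Local Notation Cl := (clifford R[i] m).

Definition partial (i : 'I_m) (F : 'rV[R]_m -> Cl) : 'rV[R]_m -> Cl :=
  fun x => [ffun A => 'D_'e_i (fun y => complex.Re (F y A)) x +i*
                      'D_'e_i (fun y => complex.Im (F y A)) x].

Definition dirac (F : 'rV[R]_m -> Cl) : 'rV[R]_m -> Cl :=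
  fun x => \sum_i gen i * partial i F x.

Fixpoint iter_partial (r : seq 'I_m) (g : 'rV[R]_m -> R) : 'rV[R]_m -> R :=
  if r is i :: r' then fun x => 'D_'e_i (iter_partial r' g) x else g.

Definition smooth (g : 'rV[R]_m -> R) : Prop :=
  forall r, continuous (iter_partial r g) /\
            forall i x, derivable (iter_partial r g) x 'e_i.

Definition monomial (k : nat) (al : {ffun 'I_m -> 'I_k.+1}) (u : 'rV[R]_m) : R :=
  \prod_i u 0 i ^+ al i.

Definition multideg (k : nat) (al : {ffun 'I_m -> 'I_k.+1}) : nat :=
  (\sum_i al i)%N.

Definition homog_poly (k : nat) (p : 'rV[R]_m -> Cl) : Prop :=
  exists c : {ffun 'I_m -> 'I_k.+1} -> Cl, forall u,
    p u = \sum_(al | multideg al == k) (monomial al u)%:C *: c al.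

Definition bihomog_poly (k l : nat) (p : 'rV[R]_m -> 'rV[R]_m -> Cl) : Prop :=
  exists c : {ffun 'I_m -> 'I_k.+1} -> {ffun 'I_m -> 'I_l.+1} -> Cl, forall u v,
    p u v = \sum_(al | multideg al == k) \sum_(be | multideg be == l)
              (monomial al u * monomial be v)%:C *: c al be.

Definition monogenic (S : set Cl) (k : nat) : set ('rV[R]_m -> Cl) :=
  [set p | [/\ homog_poly k p, forall u, S (p u) & forall u, dirac p u = 0]].

Definition simplicial_monogenic (S : set Cl) (k : nat) :
    set ('rV[R]_m -> 'rV[R]_m -> Cl) :=
  [set p | [/\ bihomog_poly k 1 p, forall u v, S (p u v),
               forall u v, dirac (p^~ v) u = 0, forall u v, dirac (p u) v = 0 &
               forall u v : 'rV_m, \sum_i (u 0 i)%:C *: partial i (p u) v = 0]].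

Definition sandwich (s : clifford R m) (u : 'rV[R]_m) : 'rV[R]_m :=
  vec_part (reversion s * vec u * s).

Definition act_mono (s : clifford R m) (p : 'rV[R]_m -> Cl) : 'rV[R]_m -> Cl :=
  fun u => complexify s * p (sandwich s u).

Definition act_simp (s : clifford R m) (p : 'rV[R]_m -> 'rV[R]_m -> Cl) :
    'rV[R]_m -> 'rV[R]_m -> Cl :=
  fun u v => complexify s * p (sandwich s u) (sandwich s v).

Definition mono_proj (k : nat) (p : 'rV[R]_m -> Cl) : 'rV[R]_m -> Cl :=
  fun u => ((m + 2 * k - 2)%:R)^-1 *: (complexify (vec u) * dirac p u) + p u.

Definition smooth_family (V : set ('rV[R]_m -> Cl))
    (f : 'rV[R]_m -> 'rV[R]_m -> Cl) : Prop :=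
  (forall x, V (f x)) /\
  forall u A, smooth (fun x => complex.Re (f x u A)) /\
              smooth (fun x => complex.Im (f x u A)).

(* V (x) R^m is the space of m-tuples in V, the tuple F standing for
   \sum_i F_i (x) e_i. *)
Definition gradient (f : 'rV[R]_m -> 'rV[R]_m -> Cl) (x : 'rV[R]_m) :
    'I_m -> 'rV[R]_m -> Cl :=
  fun i u => partial i (f^~ u) x.

Definition rarita_schwinger (k : nat) (f : 'rV[R]_m -> 'rV[R]_m -> Cl) :
    'rV[R]_m -> 'rV[R]_m -> Cl :=
  fun x => mono_proj k (fun u => dirac (f^~ u) x).

End DiracOperator.

(* A representation of Spin(m) is a subspace V of a complex vector space E, stable
   under a map act : Cl_m -> E -> E. *)
Section Representations.
Variables (R : realType) (m : nat).
Local Notation spin := (@spin R m).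

Definition subspace (E : lmodType R[i]) (V : set E) : Prop :=
  V 0 /\ forall a x y, V x -> V y -> V (a *: x + y).

Definition subrep (E : lmodType R[i]) (act : clifford R m -> E -> E)
    (V U : set E) : Prop :=
  [/\ subspace U, U `<=` V & forall s x, spin s -> U x -> U (act s x)].

Definition irreducible (E : lmodType R[i]) (act : clifford R m -> E -> E)
    (V : set E) : Prop :=
  [/\ subrep act V V, V <> [set 0] &
      forall U, subrep act V U -> U = [set 0] \/ U = V].

Definition rep_iso (E E' : lmodType R[i])
    (act : clifford R m -> E -> E) (V : set E)
    (act' : clifford R m -> E' -> E') (V' : set E') (phi : E -> E') : Prop :=
  [/\ set_bij V V' phi,
      forall a x y, V x -> V y -> phi (a *: x + y) = a *: phi x + phi y &
      forall s x, spin s -> V x -> phi (act s x) = act' s (phi x)].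

Definition act_sum (E E' : lmodType R[i])
    (act : clifford R m -> E -> E) (act' : clifford R m -> E' -> E')
    (s : clifford R m) (x : E * E') : E * E' := (act s x.1, act' s x.2).

Definition tensor_space (E : lmodType R[i]) (V : set E) (n : nat) :
    set ('I_n -> E) := [set F | forall i, V (F i)].

Definition act_tensor (E : lmodType R[i]) (act : clifford R m -> E -> E)
    (n : nat) (rho : clifford R m -> 'M[R]_n) (s : clifford R m)
    (F : 'I_n -> E) : 'I_n -> E :=
  fun i => \sum_j (rho s i j)%:C *: act s (F j).

Definition weight (E : lmodType R[i]) (act : clifford R m -> E -> E)
    (V : set E) (lam : 'rV[R]_(m./2)) : Prop :=
  exists x, [/\ V x, x <> 0 & forall j t,
    act (torus j t) x = (cos (lam 0 j * t) +i* sin (lam 0 j * t)) *: x].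

Definition lex_le (n : nat) (lam mu : 'rV[R]_n) : Prop :=
  lam = mu \/
  exists j : 'I_n,
    (forall i : 'I_n, (i < j)%N -> lam 0 i = mu 0 i) /\ lam 0 j < mu 0 j.

(* The positive roots of so(m) (e_i +- e_j for i < j, and e_i for odd m) are
   lexicographically positive, so this is the usual highest weight. *)
Definition highest_weight (E : lmodType R[i]) (act : clifford R m -> E -> E)
    (V : set E) (lam : 'rV[R]_(m./2)) : Prop :=
  weight act V lam /\ forall mu, weight act V mu -> lex_le mu lam.

(* The complexification of R^n is C (x) R^n, with the trivial action on C. *)
Definition highest_weight_real (n : nat) (rho : clifford R m -> 'M[R]_n) :=
  highest_weight (act_tensor (fun _ (z : R[i]) => z) rho)
                 (@tensor_space R[i] setT n).

(* For irreducible V' and W with highest weights lam and mu, the Cartan product is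
   the irreducible component of V' (x) W with highest weight lam + mu.  It is
   extended additively to a reducible V: for even m, M_k is the sum of the two
   irreducible pieces given by the half-spinors. *)
Definition cartan_product (E : lmodType R[i]) (act : clifford R m -> E -> E)
    (V : set E) (n : nat) (rho : clifford R m -> 'M[R]_n) : set ('I_n -> E) :=
  smallest (@subspace ('I_n -> E))
    (\bigcup_(X in [set X | exists V' lam mu,
        [/\ subrep act V V' /\ irreducible act V',
            subrep (act_tensor act rho) (@tensor_space E V' n) X,
            irreducible (act_tensor act rho) X,
            highest_weight act V' lam /\ highest_weight_real rho mu &
            highest_weight (act_tensor act rho) X (lam + mu)]]) X).

Definition invariant_inner_product (E : lmodType R[i])
    (act : clifford R m -> E -> E) (V : set E) (h : E -> E -> R[i]) : Prop :=
  [/\ forall a x y z, V x -> V y -> V z ->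
        h (a *: x + y) z = a * h x z + h y z,
      forall x y, V x -> V y -> h y x = (h x y)^*%C,
      forall x, V x -> x <> 0 -> 0 < h x x &
      forall s x y, spin s -> V x -> V y -> h (act s x) (act s y) = h x y].

(* The inner product of V (x) R^n, with the standard inner product on R^n. *)
Definition tensor_inner (E : lmodType R[i]) (h : E -> E -> R[i]) (n : nat)
    (F G : 'I_n -> E) : R[i] := \sum_i h (F i) (G i).

Definition orth_proj (E : lmodType R[i]) (h : E -> E -> R[i]) (U : set E)
    (x q : E) : Prop := U q /\ forall y, U y -> h (x - q) y = 0.

End Representations.

(* Main.v *)
Require Import Defs.
From HB Require Import structures.
From mathcomp Require Import all_boot all_order all_algebra.
From mathcomp Require Import complex.
From mathcomp Require Import all_classical all_reals all_analysis.
From mathcomp Require Import ring lra.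

Set Implicit Arguments.
Unset Strict Implicit.
Unset Printing Implicit Defensive.

Import Order.TTheory GRing.Theory Num.Theory numFieldNormedType.Exports.

Local Open Scope ring_scope.
Local Open Scope classical_set_scope.
Local Open Scope complex_scope.

(** Elements of M_k (x) R^m are tuples F = (F_1, ..., F_m) of monogenic
polynomials. Three contractions of a tuple commute with Spin(m):
cone F = sum e_i F_i, conx F = sum u_i F_i and cond F = sum d_i F_i. In the other
direction there are three equivariant maps into the tuples: iota1 from M_k and
iota2 from M_(k-1), whose components are the monogenic parts of e_i p and of
u_i q, and the gradient from M_(k+1). Subtracting from F the images of suitable
multiples of its contractions leaves a tuple killed by all three contractions,
and such a tuple is the same thing as a simplicial monogenic, linear in v with
coefficients F_i. This is the four-term decomposition (decompE,
decomposition_iso), with the gradients of M_(k+1) in the place of the Cartan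
product.

Let X_ab be the generators of the Lie algebra of Spin(m) and
Omega F_a = sum_b X_ab F_b, which up to scalars is the difference between the
Casimir operators of M_k (x) R^m and of M_k. The Clifford-Weyl relations
express Omega by the contractions (OmegaE), so it acts on the four summands by
four distinct real scalars (Omega_decomp). Two consequences concern the summand
isomorphic to M_k. First, for an invariant inner product the X_ab are skew,
hence Omega is self-adjoint and the four summands are orthogonal; the
orthogonal projection on the summand iota1 M_k therefore corresponds to a
multiple of the monogenic part of cone F, and for F the gradient of f this part
is P_k (D_x f) (rarita_schwingerE, orth_proj_mid). Second, an isomorphism
preserves the Casimir operator, so any subrepresentation isomorphic to M_k lies
in the eigenspace iota1 M_k of Omega, and is equal to it by finite dimension
(mid_comp_unique).

It remains to see that the Cartan product consists of the gradients. Each X_ab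
is, on polynomials of bounded degree, a linear combination of elements of
Spin(m) (spin_generators), so subrepresentations are stable under X_ab. A
subspace of the monogenics of degree k stable under all X_ab consists of all
the monogenics with values in some space L stable under the even subalgebra
(lie_stable_mono): by induction this holds for the span of the derivatives of
its elements, and a polynomial in Omega recovers the elements from their
derivatives. Hence the monogenics with values in an irreducible L form an
irreducible representation, and S is a sum of at most two such L
(dirac_minimal, minimal_split). Differentiating along the two isotropic
directions of a plane shifts the weight of that plane by one, so that the
highest weight of the L-valued monogenics of degree k is k eps_1 + sigma, where
sigma is the highest weight of L and has first coordinate 1/2. The gradients of
the L-valued monogenics of degree k + 1 thus have the highest weight required of
the Cartan product; conversely a tuple with that weight is forced by its first
coordinate to be a gradient (highest_tuple_grad, cartan_gradients). *)

(** * Linear identities in modules *)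
Section LinearCombinations.
Variables (K : comNzRingType) (V : lmodType K).

(** An equation between linear combinations follows from the equations between
the coefficients of each atom; both sides are reified to read these off. *)
Inductive lin_exp :=
| LinAtom of nat | LinZero | LinAdd of lin_exp & lin_exp | LinOpp of lin_exp
| LinScale of K & lin_exp | LinMuln of lin_exp & nat.

Fixpoint lin_eval (env : seq V) (t : lin_exp) : V :=
  match t with
  | LinAtom n => nth 0 env n
  | LinZero => 0
  | LinAdd t1 t2 => lin_eval env t1 + lin_eval env t2
  | LinOpp t1 => - lin_eval env t1
  | LinScale c t1 => c *: lin_eval env t1
  | LinMuln t1 n => lin_eval env t1 *+ n
  end.

Fixpoint lin_coef (t : lin_exp) (i : nat) : K :=
  match t with
  | LinAtom n => if eqn n i then 1 else 0
  | LinZero => 0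
  | LinAdd t1 t2 => lin_coef t1 i + lin_coef t2 i
  | LinOpp t1 => - lin_coef t1 i
  | LinScale c t1 => c * lin_coef t1 i
  | LinMuln t1 n => n%:R * lin_coef t1 i
  end.

Fixpoint lin_check (n : nat) (t1 t2 : lin_exp) : Prop :=
  if n is n'.+1 then lin_coef t1 n' = lin_coef t2 n' /\ lin_check n' t1 t2
  else True.

Lemma lin_evalE env t :
  lin_eval env t = \sum_(i < size env) lin_coef t i *: nth 0 env i.
Proof.
elim: t => [n||t1 IH1 t2 IH2|t IH|c t IH|t IH n] /=.
- have [nN|nN] := ltnP n (size env).
    rewrite (bigD1 (Ordinal nN)) //= big1 => [|i ni].
      by rewrite addr0 (introT eqnP (erefl n)) scale1r.
    have -> : eqn n i = false by apply/negbTE; rewrite eq_sym in ni.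
    by rewrite scale0r.
  rewrite nth_default // big1 // => i _.
  have -> : eqn n i = false; last by rewrite scale0r.
  by apply/eqP => ni; move: nN; rewrite ni leqNgt ltn_ord.
- by rewrite big1 // => i _; rewrite scale0r.
- by rewrite IH1 IH2 -big_split; apply: eq_bigr => i _; rewrite scalerDl.
- by rewrite IH -sumrN; apply: eq_bigr => i _; rewrite scaleNr.
- by rewrite IH scaler_sumr; apply: eq_bigr => i _; rewrite scalerA.
- rewrite IH -sumrMnl; apply: eq_bigr => i _.
  by rewrite -scaler_nat scalerA.
Qed.

Lemma lin_reflect env t1 t2 : lin_check (size env) t1 t2 ->
  lin_eval env t1 = lin_eval env t2.
Proof.
move=> h; rewrite !lin_evalE; apply: eq_bigr => -[i /= il] _; congr (_ *: _).
elim: (size env) il h => // n IH; rewrite ltnS leq_eqVlt => /orP[/eqP->|il].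
  by case.
by case=> _; exact: IH.
Qed.

End LinearCombinations.

(* Atoms are compared up to conversion when they have the same head constant:
big sums produced by different lemmas may carry different instances. *)
Ltac lin_head x := lazymatch x with ?f _ => lin_head f | _ => x end.

Ltac lin_same x y :=
  first [ constr_eq x y
        | let f := lin_head x in let g := lin_head y in
          constr_eq f g; unify x y ].

Ltac lin_add_atom x env :=
  let rec mem l := lazymatch l with
    | nil => constr:(x :: env)
    | ?y :: ?l' => match goal with
                   | _ => let _ := match goal with _ => lin_same x y end in env
                   | _ => mem l'
                   end
    end in
  mem env.

Ltac lin_env t env :=
  lazymatch t with
  | (?a + ?b)%R => let env := lin_env a env in lin_env b env
  | (- ?a)%R => lin_env a env
  | (_ *: ?a)%R => lin_env a env
  | (?a *+ _)%R => lin_env a env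
  | 0%R => env
  | _ => lin_add_atom t env
  end.

Ltac lin_index x env :=
  match env with
  | ?y :: _ => let _ := match goal with _ => lin_same x y end in constr:(0%N)
  | _ :: ?l => let n := lin_index x l in constr:(S n)
  end.

Ltac lin_reify K t env :=
  lazymatch t with
  | (?a + ?b)%R =>
      let a := lin_reify K a env in let b := lin_reify K b env in
      constr:(LinAdd a b)
  | (- ?a)%R => let a := lin_reify K a env in constr:(LinOpp a)
  | (?c *: ?a)%R => let a := lin_reify K a env in constr:(LinScale c a)
  | (?a *+ ?n)%R => let a := lin_reify K a env in constr:(LinMuln a n)
  | 0%R => constr:(LinZero K)
  | _ => let n := lin_index t env in constr:(LinAtom K n)
  end.

(** The tactic [tac] receives the equations between the coefficients, which are
scalars. *)
Ltac lin_solve K tac :=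
  lazymatch goal with
  | |- ?l = ?r =>
      let T := type of l in
      let env := lin_env l (@nil T) in
      let env := lin_env r env in
      let tl := lin_reify K l env in let tr := lin_reify K r env in
      refine (@lin_reflect K _ env tl tr _);
      cbn [lin_check lin_coef size eqn];
      repeat (apply: conj); try exact I; tac
  end.

(** * The basis of the Clifford algebra *)
Section CliffordBasis.
Variables (K : comNzRingType) (m : nat).
Local Notation Cl := (clifford K m).
Implicit Types (A B C : {set 'I_m}) (a b : Cl) (i j : 'I_m).

Lemma symdiffK A : involutive (symdiff A).
Proof. by move=> B; apply/setP => i; rewrite !inE addKb. Qed.

Lemma symdiffC A B : symdiff A B = symdiff B A.
Proof. by apply/setP => i; rewrite !inE addbC. Qed.

Lemma symdiff_eq A B C : (C == symdiff A B) = (symdiff A C == B).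
Proof. by rewrite -(inj_eq (inv_inj (symdiffK A))) symdiffK. Qed.

Lemma big_addb_symdiff A B (F : 'I_m -> bool) :
  \big[addb/false]_(i in symdiff A B) F i =
  (\big[addb/false]_(i in A) F i) (+) (\big[addb/false]_(i in B) F i).
Proof.
rewrite big_mkcond [in RHS]big_mkcond [X in _ (+) X]big_mkcond -big_split /=.
by apply: eq_bigr => i _; rewrite inE; case: (_ \in A); case: (_ \in B); case: F.
Qed.

(** The sign of a product is a bilinear form on the subsets over the field with
two elements, symmetric difference being the addition. *)
Lemma cl_signDl A B C :
  cl_sign (symdiff A B) C = cl_sign A C (+) cl_sign B C.
Proof. exact: big_addb_symdiff. Qed.

Lemma cl_signDr A B C :
  cl_sign A (symdiff B C) = cl_sign A B (+) cl_sign A C.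
Proof.
rewrite /cl_sign -big_split; apply: eq_bigr => i _.
exact: big_addb_symdiff.
Qed.

Lemma odd_card_symdiff A B : odd #|symdiff A B| = odd #|A| (+) odd #|B|.
Proof.
have odd_card (D : {set 'I_m}) : odd #|D| = \big[addb/false]_(i in D) true.
  rewrite -sum1_card; elim/big_rec2: _ => // i y x _ <-.
  by rewrite oddD.
by rewrite !odd_card big_addb_symdiff.
Qed.

Definition cl_basis A : Cl := [ffun B => (B == A)%:R].

Lemma cl_scaleE (c : K) a A : (c *: a) A = c * a A.
Proof. by rewrite ffunE. Qed.

Lemma cl_sumE (I : Type) (r : seq I) (P : pred I) (F : I -> Cl) A :
  (\sum_(i <- r | P i) F i) A = \sum_(i <- r | P i) F i A.
Proof. by elim/big_rec2: _ => [|i y x _ <-]; rewrite !ffunE. Qed.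

Lemma cl_basis_sum a : a = \sum_A a A *: cl_basis A.
Proof.
apply/ffunP => A; rewrite cl_sumE (bigD1 A) //= cl_scaleE ffunE eqxx mulr1.
rewrite big1 ?addr0 // => B /negPf nB; rewrite cl_scaleE ffunE.
by rewrite eq_sym nB mulr0.
Qed.

Lemma cl_basisM A B :
  cl_basis A * cl_basis B = (-1) ^+ cl_sign A B *: cl_basis (symdiff A B).
Proof.
apply/ffunP => C; rewrite cl_scaleE !ffunE (bigD1 A) //= big1 => [|D /negPf nD].
  rewrite !ffunE eqxx mulr1 addr0 symdiff_eq.
  by have [->|_] := eqVneq (symdiff A C) B; rewrite ?mulr1 ?mulr0.
by rewrite ffunE nD mulr0 mul0r.
Qed.

Lemma cl_basis0 : cl_basis finset.set0 = 1. Proof. by []. Qed.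

Lemma gen_basis i : gen i = cl_basis [set i]%SET. Proof. by []. Qed.

Lemma prod_gen_sorted (r : seq 'I_m) : sorted ltn (map val r) ->
  \prod_(i <- r) (gen i : Cl) = cl_basis [set i in r]%SET.
Proof.
elim: r => [_|i r IH /=].
  rewrite big_nil -cl_basis0; congr cl_basis.
rewrite (path_sortedE ltn_trans) => /andP[/allP lt_ir /IH {}IH].
rewrite big_cons IH gen_basis cl_basisM.
have -> : cl_sign [set i] [set i in r] = false.
  rewrite /cl_sign big_set1 big1 // => j; rewrite inE => jr.
  by apply/negbTE; rewrite -ltnNge; apply: lt_ir; apply: map_f.
rewrite scale1r; congr cl_basis; apply/setP => j; rewrite !inE.
case: eqVneq => [->|//] /=; case ir: (i \in r) => //.
by move: (lt_ir _ (map_f val ir)); rewrite ltnn.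
Qed.

Lemma cl_basis_prod A : cl_basis A = \prod_(i <- enum A) gen i.
Proof.
rewrite prod_gen_sorted; last first.
  rewrite {1}/enum_mem -enumT.
  apply: (subseq_sorted ltn_trans (map_subseq _ (filter_subseq _ _))).
  by rewrite val_enum_ord iota_ltn_sorted.
by congr cl_basis; apply/setP => i; rewrite !inE mem_enum.
Qed.

Lemma cl_ind (P : Cl -> Prop) :
  P 1 -> (forall c a b, P a -> P b -> P (c *: a + b)) ->
  (forall i a, P a -> P (gen i * a)) -> forall a, P a.
Proof.
move=> P1 PD PM a.
have P0 : P 0 by rewrite -[0](addNr 1) -scaleN1r; apply: PD.
rewrite (cl_basis_sum a); elim/big_rec: _ => // A b _ Pb; apply: PD => //.
rewrite cl_basis_prod; elim/big_rec: _ => // i c _; exact: PM.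
Qed.

(** Reversion multiplies e_A by the sign of a quadratic form in A whose polar
form is the commutation sign of e_A and e_B. *)
Definition rev_sign A : bool := cl_sign A A (+) odd #|A|.

Definition rev_diag a : Cl := [ffun A => (-1) ^+ rev_sign A * a A].

Lemma rev_sign_symdiff A B :
  rev_sign (symdiff A B) (+) cl_sign A B =
  rev_sign A (+) rev_sign B (+) cl_sign B A.
Proof.
rewrite /rev_sign odd_card_symdiff cl_signDl !cl_signDr.
by case: (cl_sign A A); case: (cl_sign A B); case: (cl_sign B A);
   case: (cl_sign B B); case: (odd #|A|); case: (odd #|B|).
Qed.

Lemma rev_diag_is_linear : linear rev_diag.
Proof.
by move=> c a b; apply/ffunP => A; rewrite !ffunE mulrDr /GRing.scale /= mulrCA.
Qed.
HB.instance Definition _ :=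
  GRing.isLinear.Build K Cl Cl _ rev_diag rev_diag_is_linear.

Lemma rev_diag_basis A : rev_diag (cl_basis A) = (-1) ^+ rev_sign A *: cl_basis A.
Proof.
apply/ffunP => B; rewrite cl_scaleE !ffunE.
by case: eqVneq => [->|]; rewrite ?mulr1 ?mulr0.
Qed.

Lemma rev_diagM a b : rev_diag (a * b) = rev_diag b * rev_diag a.
Proof.
rewrite (cl_basis_sum a) (cl_basis_sum b) mulr_suml !linear_sum mulr_sumr /=.
apply: eq_bigr => A _; rewrite mulr_sumr mulr_suml linear_sum /=.
apply: eq_bigr => B _.
rewrite -scalerAl -scalerAr cl_basisM !linearZ_LR /= !rev_diag_basis.
rewrite -!scalerAl -!scalerAr cl_basisM (symdiffC B) !scalerA.
congr (_ *: _); move: (rev_sign_symdiff A B).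
by case: (rev_sign (symdiff A B)); case: (cl_sign A B); case: (rev_sign A);
  case: (rev_sign B); case: (cl_sign B A) => //= _; rewrite ?expr0 ?expr1; ring.
Qed.


Lemma rev_diag_gen i : rev_diag (gen i) = gen i.
Proof.
rewrite gen_basis rev_diag_basis /rev_sign /cl_sign !big_set1 leqnn cards1.
by rewrite scale1r.
Qed.

Lemma rev_diag1 : rev_diag 1 = 1.
Proof.
rewrite -cl_basis0 rev_diag_basis /rev_sign cards0.
by rewrite /cl_sign big_set0 scale1r.
Qed.

Lemma rev_diag_prod (I : Type) (r : seq I) (F : I -> Cl) :
  rev_diag (\prod_(i <- r) F i) = \prod_(i <- rev r) rev_diag (F i).
Proof.
elim: r => [|a r IH]; first by rewrite !big_nil rev_diag1.
by rewrite big_cons rev_diagM IH rev_cons -cats1 big_cat big_seq1.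
Qed.

Lemma reversionE : @reversion K m =1 rev_diag.
Proof.
move=> a; rewrite {2}(cl_basis_sum a) linear_sum; apply: eq_bigr => A _.
rewrite linearZ /= cl_basis_prod rev_diag_prod.
congr (_ *: _); apply: eq_bigr => i _.
by rewrite rev_diag_gen.
Qed.

Lemma reversionM a b : reversion (a * b) = reversion b * reversion a.
Proof. by rewrite !reversionE rev_diagM. Qed.

Lemma reversion1 : reversion (1 : Cl) = 1.
Proof. by rewrite reversionE rev_diag1. Qed.

Lemma reversion_gen i : reversion (gen i : Cl) = gen i.
Proof. by rewrite reversionE rev_diag_gen. Qed.

Lemma reversionD a b : reversion (a + b) = reversion a + reversion b.
Proof. by rewrite !reversionE linearD. Qed.

Lemma reversionZ (c : K) a : reversion (c *: a) = c *: reversion a.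
Proof. by rewrite !reversionE linearZ. Qed.

Lemma reversion_vec (u : 'rV[K]_m) : reversion (vec u) = vec u.
Proof.
rewrite reversionE /vec linear_sum; apply: eq_bigr => i _.
by rewrite linearZ /= rev_diag_gen.
Qed.

Lemma gen_sq i : gen i * gen i = - 1 :> Cl.
Proof.
rewrite gen_basis cl_basisM /cl_sign !big_set1 leqnn expr1 scaleN1r.
rewrite -cl_basis0; congr (- cl_basis _); apply/setP => j.
by rewrite !inE addbb.
Qed.

Lemma gen_anti i j : i != j -> gen i * gen j = - (gen j * gen i) :> Cl.
Proof.
move=> /negPf nij; apply/eqP; rewrite -addr_eq0 gen_anticomm nij mulr0.
by rewrite scale0r oppr0.
Qed.

Lemma vec_is_linear : linear (@vec K m).
Proof.
move=> c u v; rewrite /vec scaler_sumr -big_split /=; apply: eq_bigr => i _.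
by rewrite !mxE scalerDl scalerA.
Qed.
HB.instance Definition _ :=
  GRing.isLinear.Build K 'rV[K]_m Cl _ (@vec K m) vec_is_linear.

Lemma vec_part_is_linear : linear (@vec_part K m).
Proof.
move=> c a b; apply/rowP => i; rewrite !mxE.
by rewrite !ffunE.
Qed.
HB.instance Definition _ :=
  GRing.isLinear.Build K Cl 'rV[K]_m _ (@vec_part K m) vec_part_is_linear.

Lemma vecE (u : 'rV[K]_m) i : vec u [set i]%SET = u 0 i.
Proof.
rewrite cl_sumE (bigD1 i) //= cl_scaleE !ffunE eqxx mulr1 big1 ?addr0 // => j nj.
rewrite cl_scaleE !ffunE; case: eqP => [/set1_inj ji|]; last by rewrite mulr0.
by rewrite ji eqxx in nj.
Qed.

Lemma vecK : cancel (@vec K m) (@vec_part K m).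
Proof. by move=> u; apply/rowP => i; rewrite mxE vecE. Qed.

Lemma vec_delta i : vec ('e_i) = gen i :> Cl.
Proof.
rewrite /vec (bigD1 i) //= big1 => [|j nj]; rewrite !mxE ?eqxx /=.
  by rewrite scale1r addr0.
by rewrite (negPf nj) scale0r.
Qed.

Definition row_dot (u v : 'rV[K]_m) : K := \sum_i u 0 i * v 0 i.

Lemma vec_anticomm (u v : 'rV[K]_m) :
  vec u * vec v + vec v * vec u = - ((row_dot u v) *+ 2)%:A.
Proof.
have -> : vec v * vec u =
    \sum_i \sum_j (u 0 i * v 0 j) *: (gen j * gen i : Cl).
  rewrite /vec mulr_suml exchange_big; apply: eq_bigr => i _ /=.
  rewrite mulr_sumr; apply: eq_bigr => j _.
  by rewrite -scalerAl -scalerAr scalerA mulrC.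
have -> : vec u * vec v =
    \sum_i \sum_j (u 0 i * v 0 j) *: (gen i * gen j : Cl).
  rewrite /vec mulr_suml; apply: eq_bigr => i _ /=.
  rewrite mulr_sumr; apply: eq_bigr => j _.
  by rewrite -scalerAl -scalerAr scalerA.
rewrite -big_split /row_dot -sumrMnl scaler_suml -sumrN; apply: eq_bigr => i _.
rewrite -big_split (bigD1 i) //= big1 => [|j nj]; last first.
  by rewrite -scalerDr gen_anticomm eq_sym (negPf nj) mulr0 scale0r oppr0 scaler0.
rewrite addr0 -scalerDr gen_anticomm eqxx mulr1 scalerN scalerA.
by rewrite mulr_natr.
Qed.

End CliffordBasis.

(** * The spin group and its rotations *)
Section Complexification.
Variables (R : realType) (m : nat).
Local Notation Cl := (clifford R m).
Implicit Types (a b : Cl).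

Lemma complexify_basis A : complexify (cl_basis R A : Cl) = cl_basis R[i] A.
Proof. by apply/ffunP => B; rewrite !ffunE; case: (_ == _). Qed.

Lemma complexifyM a b : complexify (a * b) = complexify a * complexify b.
Proof.
apply/ffunP => A; rewrite !ffunE rmorph_sum; apply: eq_bigr => B _.
by rewrite !ffunE !rmorphM rmorph_sign.
Qed.

Lemma complexify1 : complexify (1 : Cl) = 1.
Proof. exact: complexify_basis. Qed.

Lemma complexifyD a b : complexify (a + b) = complexify a + complexify b.
Proof. by apply/ffunP => A; rewrite !ffunE rmorphD. Qed.

Lemma complexifyZ (c : R) a : complexify (c *: a) = c%:C *: complexify a.
Proof. by apply/ffunP => A; rewrite !ffunE rmorphM. Qed.

Lemma complexify0 : complexify (0 : Cl) = 0.
Proof. by apply/ffunP => A; rewrite !ffunE. Qed.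

Lemma complexify_gen i : complexify (gen i : Cl) = gen i.
Proof. exact: complexify_basis. Qed.

Lemma complexify_vec (u : 'rV[R]_m) :
  complexify (vec u) = \sum_i (u 0 i)%:C *: gen i.
Proof.
rewrite /vec; elim/big_rec2: _ => [|i y x _ <-]; first exact: complexify0.
by rewrite complexifyD complexifyZ complexify_gen.
Qed.

End Complexification.

Section SpinGroup.
Variables (R : realType) (m : nat).
Local Notation Cl := (clifford R m).
Implicit Types (u v w y : 'rV[R]_m) (s : Cl).

Lemma vec_sq u : vec u * vec u = - (row_dot u u)%:A :> Cl.
Proof.
have h : vec u * vec u *+ 2 = - (row_dot u u)%:A *+ 2 :> Cl.
  by rewrite mulr2n vec_anticomm mulNrn scalerMnl.
have two : (2%:R : R) != 0 by rewrite pnatr_eq0.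
by apply: (scalerI two); rewrite !scaler_nat.
Qed.

Lemma unit_vector_sq y : unit_vector y -> vec y * vec y = - 1 :> Cl.
Proof.
move=> /eqP y1; rewrite vec_sq.
suff -> : row_dot y y = 1 by rewrite scale1r.
by rewrite -y1; apply: eq_bigr => i _; rewrite expr2.
Qed.

(** A sandwich by a vector is a reflection up to a scalar, hence gives a vector. *)
Lemma reflection u y : exists w, vec y * vec u * vec y = vec w :> Cl.
Proof.
exists ((row_dot y y) *: u - (row_dot u y *+ 2) *: y).
have -> : vec y * vec u * vec y = vec y * (vec u * vec y) :> Cl by rewrite mulrA.
have -> : vec u * vec y = - (vec y * vec u) - ((row_dot u y) *+ 2)%:A :> Cl.
  by rewrite -vec_anticomm addrC addrK.
rewrite mulrBr mulrN mulrA vec_sq mulNr opprK mulr_algl mulr_algr.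
by rewrite linearB !linearZ.
Qed.

Lemma reversion_prod_vec (r : seq 'rV[R]_m) :
  reversion (\prod_(y <- r) vec y : Cl) = \prod_(y <- rev r) vec y.
Proof.
rewrite reversionE rev_diag_prod; apply: eq_bigr => y _.
by rewrite -reversionE reversion_vec.
Qed.

Lemma spin_reversion s : spin s -> spin (reversion s).
Proof.
case=> r [er ur ->]; exists (rev r); split; rewrite ?size_rev ?all_rev //.
exact: reversion_prod_vec.
Qed.

Lemma reversionK s : reversion (reversion s) = s.
Proof.
rewrite !reversionE; apply/ffunP => A; rewrite !ffunE mulrA -signr_addb addbb.
by rewrite mul1r.
Qed.

Lemma spin_mul_rev s : spin s -> s * reversion s = 1.
Proof.
case=> r [er ur ->]; rewrite reversion_prod_vec.
suff -> : (\prod_(y <- r) vec y) * \prod_(y <- rev r) vec y =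
    (-1) ^+ odd (size r) :> Cl by rewrite (negPf er).
elim: r ur {er} => [_|y r IH /= /andP[uy /IH {}IH]].
  by rewrite !big_nil mulr1.
rewrite big_cons rev_cons -cats1 big_cat big_seq1 /= -mulrA [_ * (_ * vec y)]mulrA.
rewrite IH; case: (odd _); rewrite ?expr0 ?expr1 ?mul1r ?mulN1r ?mulrN.
  by rewrite unit_vector_sq // opprK.
by rewrite unit_vector_sq.
Qed.

Lemma spin_rev_mul s : spin s -> reversion s * s = 1.
Proof.
by move=> /spin_reversion/spin_mul_rev; rewrite reversionK.
Qed.

Lemma spin_conj_vec s u : spin s ->
  exists w, s * vec u * reversion s = vec w.
Proof.
case=> r [er ur ->]; rewrite reversion_prod_vec; clear er ur.
elim: r => [|y r [w IH]]; first by exists u; rewrite !big_nil mul1r mulr1.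
rewrite big_cons rev_cons -cats1 big_cat big_seq1 /=.
have -> : vec y * \prod_(j <- r) vec j * vec u *
    (\prod_(j <- rev r) vec j * vec y) = vec y * (\prod_(j <- r) vec j * vec u *
    \prod_(j <- rev r) vec j) * vec y :> Cl by rewrite !mulrA.
by rewrite IH; apply: reflection.
Qed.

Lemma rho1_gen s j : spin s ->
  s * gen j * reversion s = \sum_i rho1 s i j *: gen i.
Proof.
move=> sS; have [w sw] := spin_conj_vec ('e_j) sS.
rewrite vec_delta in sw; rewrite sw /vec; apply: eq_bigr => i _.
by rewrite mxE sw vecK.
Qed.

Lemma rho1_vec s u : spin s ->
  s * vec u * reversion s = vec (u *m (rho1 s)^T).
Proof.
move=> sS; rewrite {1}/vec [s * _]mulr_sumr mulr_suml.
under eq_bigr do rewrite -scalerAr -scalerAl rho1_gen // scaler_sumr.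
rewrite exchange_big; apply: eq_bigr => i _ /=.
rewrite mxE scaler_suml; apply: eq_bigr => j _.
by rewrite scalerA !mxE.
Qed.

Lemma row_dotE u v : row_dot u v = (u *m v^T) 0 0.
Proof. by rewrite mxE; apply: eq_bigr => i _; rewrite mxE. Qed.

Lemma sandwich_vec s u : spin s ->
  vec (sandwich s u) = reversion s * vec u * s.
Proof.
move=> sS; have [w] := spin_conj_vec u (spin_reversion sS).
by rewrite reversionK /sandwich => ->; rewrite vecK.
Qed.

(** The matrix of the inverse rotation is the transpose: compare the
anticommutator of two vectors before and after conjugation by s. *)
Lemma sandwichE s u : spin s -> sandwich s u = u *m rho1 s.
Proof.
move=> sS; apply/rowP => j.
have h : row_dot (sandwich s u) 'e_j *+ 2 = row_dot u ('e_j *m (rho1 s)^T) *+ 2.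
  apply: oppr_inj.
  have : - (row_dot (sandwich s u) 'e_j *+ 2)%:A =
         - (row_dot u ('e_j *m (rho1 s)^T) *+ 2)%:A :> Cl.
    rewrite -vec_anticomm sandwich_vec //.
    have -> : vec 'e_j = reversion s * (s * vec 'e_j * reversion s) * s.
      by rewrite !mulrA spin_rev_mul // mul1r -mulrA spin_rev_mul // mulr1.
    rewrite rho1_vec //; set v := _ *m _.
    transitivity (reversion s * (vec u * vec v + vec v * vec u) * s).
      rewrite mulrDr mulrDl; congr (_ + _); rewrite !mulrA.
        by rewrite -[_ * vec u * s * reversion s]mulrA spin_mul_rev // mulr1.
      by rewrite -[_ * vec v * s * reversion s]mulrA spin_mul_rev // mulr1.
    rewrite vec_anticomm mulrN mulNr -mulr_algl -scalerAl mul1r -scalerAr mulr1.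
    by rewrite -scalerAl spin_rev_mul.
  move/ffunP/(_ finset.set0); rewrite -!scaleNr !cl_scaleE.
  by rewrite -cl_basis0 !ffunE eqxx !mulr1.
have {h} : row_dot (sandwich s u) 'e_j = row_dot u ('e_j *m (rho1 s)^T).
  by apply/eqP; rewrite -(@eqr_pMn2r _ 2) ?h.
have e (z : 'rV[R]_m) : (z *m ('e_j)^T) 0 0 = z 0 j.
  rewrite mxE (bigD1 j) //= big1 => [|i ni]; rewrite !mxE ?eqxx ?mulr1 ?addr0 //.
  by rewrite (negPf ni) mulr0.
by rewrite row_dotE (row_dotE u) trmx_mul trmxK mulmxA !e.
Qed.

Lemma rho1_orth s : spin s -> (rho1 s)^T *m rho1 s = 1%:M.
Proof.
move=> sS; apply/row_matrixP => i; rewrite !rowE mulmx1 mulmxA -sandwichE //.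
apply: (can_inj (@vecK _ _)); rewrite sandwich_vec // -rho1_vec //.
by rewrite !mulrA spin_rev_mul // mul1r -mulrA spin_rev_mul // mulr1.
Qed.

Lemma rho1_orthT s : spin s -> rho1 s *m (rho1 s)^T = 1%:M.
Proof. by move=> sS; apply: mulmx1C; apply: rho1_orth. Qed.

Lemma rho1_reversion s : spin s -> rho1 (reversion s) = (rho1 s)^T.
Proof.
move=> sS; apply/matrixP => i j; rewrite mxE reversionK.
have := sandwichE ('e_j) sS; rewrite /sandwich vec_delta => ->.
by rewrite -rowE !mxE.
Qed.

(** For c and s the cosine and sine of t/2 this is exp (t/2 e_a e_b). *)
Definition rotor (a b : 'I_m) (c s : R) : Cl := c%:A + s *: (gen a * gen b).

Lemma rotor_spin (a b : 'I_m) (c s : R) : a != b -> c ^+ 2 + s ^+ 2 = 1 ->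
  spin (rotor a b c s).
Proof.
move=> nab cs1; exists [:: 'e_a; - c *: 'e_a + s *: 'e_b]; split => //=.
  rewrite andbT; apply/andP; split; apply/eqP.
    rewrite (bigD1 a) //= big1 => [|i ni]; rewrite !mxE ?eqxx ?expr1n ?addr0 //.
    by rewrite (negPf ni) expr0n.
  rewrite (bigD1 a) //= (bigD1 b) 1?eq_sym //= big1 => [|i /andP[na nb]].
    rewrite !mxE !eqxx /= [b == a]eq_sym (negPf nab) /= !mulr1 !mulr0 addr0 add0r addr0.
    by rewrite sqrrN.
  by rewrite !mxE (negPf na) (negPf nb) /= !mulr0 addr0 expr0n.
rewrite big_cons big_seq1 linearD !linearZ /= !vec_delta mulrDr -!scalerAr.
by rewrite gen_sq scalerN scaleNr opprK.
Qed.

Lemma reversion_rotor (a b : 'I_m) (c s : R) : a != b ->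
  reversion (rotor a b c s) = rotor a b c (- s).
Proof.
move=> nab; rewrite reversionD !reversionZ reversionM reversion1 !reversion_gen.
by rewrite (gen_anti _ (_ : b != a)) 1?eq_sym // /rotor scalerN scaleNr.
Qed.

Lemma rotor_conj_gen (a b j : 'I_m) (c s : R) : a != b ->
  rotor a b c s * gen j * reversion (rotor a b c s) =
  if j == a then (c ^+ 2 - s ^+ 2) *: gen a + (2 * c * s) *: gen b
  else if j == b then (c ^+ 2 - s ^+ 2) *: gen b - (2 * c * s) *: gen a
  else (c ^+ 2 + s ^+ 2) *: gen j :> Cl.
Proof.
move=> nab; have nba : b != a by rewrite eq_sym.
set rhs := (if _ then _ else _).
rewrite reversion_rotor // /rotor [_%:A + s *: _]lock mulrDr -lock mulr_algr -scalerAr.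
rewrite !mulrDl !mulr_algl -!scalerAl {}/rhs.
set A := gen a; set B := gen b; set J := gen j.
have AA : A * A = -1 by exact: gen_sq.
have BB : B * B = -1 by exact: gen_sq.
have BA : B * A = - (A * B) by exact: gen_anti.
have ABA : A * B * A = B by rewrite -mulrA BA mulrN mulrA AA mulN1r opprK.
have ABB : A * B * B = - A by rewrite -mulrA BB mulrN1.
have AAB : A * (A * B) = - B by rewrite mulrA AA mulN1r.
have BAB : B * (A * B) = A by rewrite mulrA BA mulNr -mulrA BB mulrN1 opprK.
have [ja|nja] := eqVneq j a.
  rewrite /J ja -/A ABA AAB BAB.
  by lin_solve R ltac:(ring).
have [jb|njb] := eqVneq j b.
  by rewrite /J jb -/B ABB BAB mulNr AAB; lin_solve R ltac:(ring).
have AJ : J * A = - (A * J) by exact: gen_anti.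
have BJ : J * B = - (B * J) by exact: gen_anti.
have JAB : J * (A * B) = A * B * J.
  by rewrite mulrA AJ mulNr -[A * J * B]mulrA BJ mulrN opprK mulrA.
have -> : A * B * J * (A * B) = - J.
  by rewrite -[A * B * J * _]mulrA JAB mulrA -[A * B * (A * B)]mulrA BAB AA mulN1r.
by rewrite JAB; set Z := A * B * J; rewrite -?/Z; lin_solve R ltac:(ring).
Qed.

Lemma rho1_rotor (a b i j : 'I_m) (c s : R) : a != b ->
  rho1 (rotor a b c s) i j =
  if j == a then (c ^+ 2 - s ^+ 2) * (i == a)%:R + (2 * c * s) * (i == b)%:R
  else if j == b then
    (c ^+ 2 - s ^+ 2) * (i == b)%:R - (2 * c * s) * (i == a)%:R
  else (c ^+ 2 + s ^+ 2) * (i == j)%:R.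
Proof.
move=> nab; rewrite mxE rotor_conj_gen // -!vec_delta.
by case: ifP => _; [|case: ifP => _];
  rewrite -?scaleNr -?linearZ -?linearD vecK !mxE /= ?mulNr.
Qed.

End SpinGroup.

(** * Partial derivatives *)
Section PartialDerivatives.
Variables (R : realType) (m : nat).
Local Notation C := R[i].
Local Notation Cl := (clifford C m).
Local Notation E := ('rV[R]_m -> Cl).

Lemma is_derive_coord (i j : 'I_m) (x : 'rV[R]_m) :
  is_derive x 'e_i (fun u : 'rV[R]_m => u 0 j) (i == j)%:R.
Proof.
have did : derivable (@id 'rV[R]_m) x 'e_i by exact: derivable_id.
split; first by have /derivable_mxP/(_ 0 j) := did.
by have := derive_mx did; rewrite derive_id => /matrixP/(_ 0 j); rewrite !mxE eq_sym eqxx.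
Qed.

(** Differentiability is part of the relation, so that the rules for sums and
products can be composed without side conditions. *)
Definition is_cpartial (i : 'I_m) (g : 'rV[R]_m -> C) (x : 'rV[R]_m) (dg : C) :=
  is_derive x 'e_i (fun y => complex.Re (g y)) (complex.Re dg) /\
  is_derive x 'e_i (fun y => complex.Im (g y)) (complex.Im dg).

Lemma is_cpartial_cst i (c : C) x : is_cpartial i (fun=> c) x 0.
Proof. by split; exact: is_derive_cst. Qed.

Lemma is_cpartialD i f g x df dg : is_cpartial i f x df -> is_cpartial i g x dg ->
  is_cpartial i (fun y => f y + g y) x (df + dg).
Proof.
move=> [f1 f2] [g1 g2]; split; rewrite raddfD /=.
  have -> : (fun y => complex.Re (f y + g y)) =
     (fun y => complex.Re (f y)) + (fun y => complex.Re (g y)).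
    by apply/funext => y; rewrite raddfD.
  exact: is_deriveD.
have -> : (fun y => complex.Im (f y + g y)) =
   (fun y => complex.Im (f y)) + (fun y => complex.Im (g y)).
  by apply/funext => y; rewrite raddfD.
exact: is_deriveD.
Qed.

Lemma is_cpartial_sum i (I : Type) (r : seq I) (P : pred I)
    (f : I -> 'rV[R]_m -> C) x (df : I -> C) :
  (forall k, is_cpartial i (f k) x (df k)) ->
  is_cpartial i (fun y => \sum_(k <- r | P k) f k y) x (\sum_(k <- r | P k) df k).
Proof.
move=> h; elim: r => [|k r IH].
  rewrite big_nil; have -> : (fun y => \sum_(k <- [::] | P k) f k y) = (fun=> 0).
    by apply/funext => y; rewrite big_nil.
  exact: is_cpartial_cst.
rewrite big_cons; case Pk: (P k).
  have -> : (fun y => \sum_(k0 <- k :: r | P k0) f k0 y) =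
            (fun y => f k y + \sum_(k0 <- r | P k0) f k0 y).
    by apply/funext => y; rewrite big_cons Pk.
  exact: is_cpartialD.
have -> // : (fun y => \sum_(k0 <- k :: r | P k0) f k0 y) =
          (fun y => \sum_(k0 <- r | P k0) f k0 y).
by apply/funext => y; rewrite big_cons Pk.
Qed.

Lemma is_cpartialZ i (c : C) g x dg : is_cpartial i g x dg ->
  is_cpartial i (fun y => c * g y) x (c * dg).
Proof.
have reE (z w : C) : complex.Re (z * w) =
    complex.Re z * complex.Re w - complex.Im z * complex.Im w by case: z; case: w.
have imE (z w : C) : complex.Im (z * w) =
    complex.Re z * complex.Im w + complex.Im z * complex.Re w by case: z; case: w.
move=> [g1 g2]; split.
  rewrite reE; have -> : (fun y => complex.Re (c * g y)) =
      (complex.Re c \*: (fun y => complex.Re (g y))) -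
      (complex.Im c \*: (fun y => complex.Im (g y))).
    by apply/funext => y; rewrite reE.
  by apply: is_deriveB; apply: is_deriveZ.
rewrite imE; have -> : (fun y => complex.Im (c * g y)) =
    (complex.Re c \*: (fun y => complex.Im (g y))) +
    (complex.Im c \*: (fun y => complex.Re (g y))).
  by apply/funext => y; rewrite imE.
by apply: is_deriveD; apply: is_deriveZ.
Qed.

Lemma is_cpartialX i j g x dg : is_cpartial i g x dg ->
  is_cpartial i (fun y => (y 0 j)%:C * g y) x
    ((i == j)%:R * g x + (x 0 j)%:C * dg).
Proof.
have reE (r : R) (w : C) : complex.Re (r%:C * w) = r * complex.Re w.
  by case: w => a b /=; rewrite mul0r subr0.
have imE (r : R) (w : C) : complex.Im (r%:C * w) = r * complex.Im w.
  by case: w => a b /=; rewrite mul0r addr0.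
have -> : (i == j)%:R = ((i == j)%:R : R)%:C by case: (i == j).
move=> [g1 g2]; have dx := is_derive_coord i j x; split.
  have -> : (fun y : 'rV_m => complex.Re ((y 0 j)%:C * g y)) =
      (fun y : 'rV_m => y 0 j) * (fun y => complex.Re (g y)).
    by apply/funext => y; rewrite reE.
  apply: is_derive_eq; rewrite raddfD /= !reE addrC /GRing.scale /=.
  by congr (_ + _); rewrite mulrC.
have -> : (fun y : 'rV_m => complex.Im ((y 0 j)%:C * g y)) =
    (fun y : 'rV_m => y 0 j) * (fun y => complex.Im (g y)).
  by apply/funext => y; rewrite imE.
apply: is_derive_eq; rewrite raddfD /= !imE addrC /GRing.scale /=.
by congr (_ + _); rewrite mulrC.
Qed.

Lemma is_cpartial_val i g x dg : is_cpartial i g x dg ->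
  'D_'e_i (fun y => complex.Re (g y)) x +i*
  'D_'e_i (fun y => complex.Im (g y)) x = dg.
Proof. by case: dg => a b [h1 h2]; rewrite !derive_val. Qed.

Definition is_partial (i : 'I_m) (F : E) (x : 'rV[R]_m) (dF : Cl) :=
  forall A, is_cpartial i (fun y => F y A) x (dF A).

Lemma is_partial_val i F x dF : is_partial i F x dF -> partial i F x = dF.
Proof. by move=> h; apply/ffunP => A; rewrite ffunE; apply: is_cpartial_val. Qed.

Lemma is_partial_cst i (c : Cl) x : is_partial i (fun=> c) x 0.
Proof. by move=> A; rewrite ffunE; exact: is_cpartial_cst. Qed.

Lemma is_partialD i F G x dF dG : is_partial i F x dF -> is_partial i G x dG ->
  is_partial i (fun y => F y + G y) x (dF + dG).
Proof.
move=> f g A; rewrite ffunE.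
have -> : (fun y => (F y + G y) A) = (fun y => F y A + G y A).
  by apply/funext => y; rewrite ffunE.
exact: is_cpartialD.
Qed.

Lemma is_partialM i a F x dF : is_partial i F x dF ->
  is_partial i (fun y => a * F y) x (a * dF).
Proof.
move=> f A; rewrite ffunE.
have -> : (fun y => (a * F y) A) = (fun y =>
    \sum_B (-1) ^+ cl_sign B (symdiff B A) * a B * F y (symdiff B A)).
  by apply/funext => y; rewrite ffunE.
by apply: is_cpartial_sum => B; apply: is_cpartialZ.
Qed.

Lemma is_partialX i j F x dF : is_partial i F x dF ->
  is_partial i (fun y => (y 0 j)%:C *: F y) x
    ((i == j)%:R *: F x + (x 0 j)%:C *: dF).
Proof.
move=> f A; rewrite ffunE !cl_scaleE.
have -> : (fun y : 'rV_m => ((y 0 j)%:C *: F y) A) = (fun y => (y 0 j)%:C * F y A).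
  by apply/funext => y; rewrite cl_scaleE.
exact: is_cpartialX.
Qed.

End PartialDerivatives.

(** * Clifford-valued polynomials *)
Section Polynomials.
Variables (R : realType) (m : nat).
Local Notation C := R[i].
Local Notation Cl := (clifford C m).
Local Notation E := ('rV[R]_m -> Cl).

Inductive pol : E -> Prop :=
| PolCst c : pol (fun=> c)
| PolAdd F G : pol F -> pol G -> pol (fun u => F u + G u)
| PolX i F : pol F -> pol (fun u => (u 0 i)%:C *: F u).

Lemma pol_lmul a F : pol F -> pol (fun u => a * F u).
Proof.
elim=> [c|G H _ IG _ IH|i G _ IG]; first exact: PolCst.
  have -> : (fun u => a * (G u + H u)) = (fun u => a * G u + a * H u).
    by apply/funext => u; rewrite mulrDr.
  exact: PolAdd.
have -> : (fun u : 'rV_m => a * ((u 0 i)%:C *: G u)) =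
          (fun u : 'rV_m => (u 0 i)%:C *: (a * G u)).
  by apply/funext => u; rewrite scalerAr.
exact: PolX.
Qed.

Lemma pol_scale (c : C) F : pol F -> pol (fun u => c *: F u).
Proof.
move=> /(pol_lmul c%:A).
by under [X in pol X -> _]eq_fun do rewrite mulr_algl.
Qed.

Lemma pol_sum (I : Type) (r : seq I) (P : pred I) (F : I -> E) :
  (forall k, pol (F k)) -> pol (fun u => \sum_(k <- r | P k) F k u).
Proof.
move=> h; elim: r => [|k r IH].
  have -> : (fun u => \sum_(k <- [::] | P k) F k u) = (fun=> 0).
    by apply/funext => u; rewrite big_nil.
  exact: PolCst.
case Pk: (P k).
  have -> : (fun u => \sum_(k0 <- k :: r | P k0) F k0 u) =
            (fun u => F k u + \sum_(k0 <- r | P k0) F k0 u).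
    by apply/funext => y; rewrite big_cons Pk.
  exact: PolAdd.
have -> // : (fun u => \sum_(k0 <- k :: r | P k0) F k0 u) =
          (fun u => \sum_(k0 <- r | P k0) F k0 u).
by apply/funext => y; rewrite big_cons Pk.
Qed.

Lemma pol_comp (M : 'M[R]_m) F : pol F -> pol (fun u => F (u *m M)).
Proof.
elim=> [c|G H _ IG _ IH|i G _ IG]; [exact: PolCst|exact: PolAdd|].
have -> : (fun u => ((u *m M) 0 i)%:C *: G (u *m M)) =
    (fun u => \sum_j (u 0 j)%:C *: ((M j i)%:C *: G (u *m M))).
  apply/funext => u; rewrite mxE rmorph_sum scaler_suml /=.
  by apply: eq_bigr => j _; rewrite rmorphM scalerA.
by apply: pol_sum => j; apply: PolX; apply: pol_scale.
Qed.

Lemma pol_partial F i : pol F ->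
  pol (partial i F) /\ forall x, is_partial i F x (partial i F x).
Proof.
elim=> {F} [c|F G _ [pF hF] _ [pG hG]|j F pF0 [pF hF]].
- have h x : is_partial i (fun=> c) x 0 by exact: is_partial_cst.
  have e x : partial i (fun=> c) x = 0 by exact: is_partial_val.
  split; last by move=> x; rewrite e.
  by have -> : partial i (fun=> c) = (fun=> 0); [apply/funext|exact: PolCst].
- have h x : is_partial i (fun u => F u + G u) x (partial i F x + partial i G x).
    exact: is_partialD.
  have e x := is_partial_val (h x).
  split; last by move=> x; rewrite e.
  by rewrite (funext e : partial i _ = _); exact: PolAdd.
have h x : is_partial i (fun u : 'rV_m => (u 0 j)%:C *: F u) x
    ((i == j)%:R *: F x + (x 0 j)%:C *: partial i F x).
  exact: is_partialX.
have e x := is_partial_val (h x).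
split; last by move=> x; rewrite e.
rewrite (funext e : partial i _ = _); apply: PolAdd; first exact: pol_scale.
exact: PolX.
Qed.

Lemma partialD F G i u : pol F -> pol G ->
  partial i (fun u => F u + G u) u = partial i F u + partial i G u.
Proof.
by move=> /(pol_partial i)[_ f] /(pol_partial i)[_ g];
  apply: is_partial_val; apply: is_partialD.
Qed.

Lemma partialM a F i u : pol F ->
  partial i (fun u => a * F u) u = a * partial i F u.
Proof.
by move=> /(pol_partial i)[_ f]; apply: is_partial_val; apply: is_partialM.
Qed.

Lemma partialX F i j u : pol F ->
  partial i (fun u : 'rV_m => (u 0 j)%:C *: F u) u =
  (i == j)%:R *: F u + (u 0 j)%:C *: partial i F u.
Proof.
by move=> /(pol_partial i)[_ f]; apply: is_partial_val; apply: is_partialX.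
Qed.

Definition pol_pred : pred E := fun F => `[< pol F >].

Fact pol_pred_closed : subsemimod_closed pol_pred.
Proof.
split; first split.
- by apply/asboolP; exact: PolCst.
- by move=> F G /asboolP f /asboolP g; apply/asboolP; exact: PolAdd.
- by move=> c F /asboolP f; apply/asboolP; exact: pol_scale.
Qed.
HB.instance Definition _ := GRing.isSubmodClosed.Build C E pol_pred pol_pred_closed.

(** On this type the partial derivatives are total linear operators, so that the
Clifford-Weyl relations hold without side conditions. *)
Record cl_poly := ClPoly { cl_fun :> E; _ : pol_pred cl_fun }.
HB.instance Definition _ := [isSub for cl_fun].
HB.instance Definition _ := [Choice of cl_poly by <:].
HB.instance Definition _ := [SubChoice_isSubLmodule of cl_poly by <:].

Lemma cl_polyP (p : cl_poly) : pol p.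
Proof. by case: p => f /= /asboolP. Qed.

Lemma cl_poly_eq (p q : cl_poly) : (forall u, p u = q u) -> p = q.
Proof. by move=> h; apply/val_inj/funext. Qed.

Definition mk_poly F (pF : pol F) : cl_poly := ClPoly (introT (asboolP _) pF).

Lemma cl_polyDE (p q : cl_poly) u : (p + q) u = p u + q u. Proof. by []. Qed.
Lemma cl_polyZE c (p : cl_poly) u : (c *: p) u = c *: p u. Proof. by []. Qed.
Definition to_poly (F : E) : cl_poly := insubd 0 F.

Lemma to_polyK F : pol F -> to_poly F = F :> E.
Proof. by move=> /asboolP pF; apply: (@insubdK _ _ _ _ F). Qed.

Lemma cl_funK (p : cl_poly) : to_poly p = p.
Proof. exact: valKd. Qed.

End Polynomials.

(** * Clifford-Weyl operators *)

Lemma big_sumD (W : nmodType) (I : Type) (r : seq I) (P : pred I) (F G : I -> W) :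
  \sum_(i <- r | P i) (F i + G i) = \sum_(i <- r | P i) F i + \sum_(i <- r | P i) G i.
Proof. exact: big_split. Qed.

Lemma big_sumB (W : zmodType) (I : Type) (r : seq I) (P : pred I) (F G : I -> W) :
  \sum_(i <- r | P i) (F i - G i) = \sum_(i <- r | P i) F i - \sum_(i <- r | P i) G i.
Proof. exact: sumrB. Qed.

Section Operators.
Variables (R : realType) (m : nat).
Local Notation C := R[i].
Local Notation Cl := (clifford C m).
Local Notation V := (cl_poly R m).
Implicit Types (p q : V) (i j : 'I_m) (F G : 'I_m -> V).

Definition lmul (a : Cl) p : V := mk_poly (pol_lmul a (cl_polyP p)).
Definition eop i p : V := lmul (gen i) p.
Definition xop i p : V := mk_poly (PolX i (cl_polyP p)).
Definition dop i p : V := mk_poly (proj1 (pol_partial i (cl_polyP p))).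

Lemma lmulE a p u : lmul a p u = a * p u. Proof. by []. Qed.
Lemma eopE i p u : eop i p u = gen i * p u. Proof. by []. Qed.
Lemma xopE i p u : xop i p u = (u 0 i)%:C *: p u. Proof. by []. Qed.
Lemma dopE i p u : dop i p u = partial i p u. Proof. by []. Qed.

Fact lmul_linear a : linear (lmul a).
Proof.
by move=> c p q; apply: cl_poly_eq => u; rewrite lmulE mulrDr -scalerAr.
Qed.
HB.instance Definition _ a := GRing.isLinear.Build C V V _ (lmul a) (lmul_linear a).

Fact eop_linear i : linear (eop i). Proof. exact: lmul_linear. Qed.
HB.instance Definition _ i := GRing.isLinear.Build C V V _ (eop i) (eop_linear i).

Fact xop_linear i : linear (xop i).
Proof.
move=> c p q; apply: cl_poly_eq => u; rewrite xopE cl_polyDE cl_polyZE scalerDr.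
by rewrite !scalerA mulrC -scalerA.
Qed.
HB.instance Definition _ i := GRing.isLinear.Build C V V _ (xop i) (xop_linear i).

Fact dop_linear i : linear (dop i).
Proof.
move=> c p q; apply: cl_poly_eq => u; rewrite dopE.
have -> : cl_fun (c *: p + q) = (fun u => c%:A * p u + q u).
  by apply/funext => v; rewrite cl_polyDE cl_polyZE mulr_algl.
rewrite partialD ?partialM ?mulr_algl //; first exact: cl_polyP.
  by apply: pol_lmul; exact: cl_polyP.
exact: cl_polyP.
Qed.
HB.instance Definition _ i := GRing.isLinear.Build C V V _ (dop i) (dop_linear i).

Lemma lmulA a b p : lmul a (lmul b p) = lmul (a * b) p.
Proof. by apply: cl_poly_eq => u; rewrite !lmulE mulrA. Qed.

Lemma lmulX a i p : lmul a (xop i p) = xop i (lmul a p).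
Proof. by apply: cl_poly_eq => u; rewrite lmulE !xopE -scalerAr. Qed.

Lemma dop_lmul a i p : dop i (lmul a p) = lmul a (dop i p).
Proof.
by apply: cl_poly_eq => u; rewrite dopE (partialM a i u (cl_polyP p)).
Qed.

Lemma ee i j p : eop i (eop j p) = - eop j (eop i p) - (i == j)%:R *: (p *+ 2).
Proof.
apply: cl_poly_eq => u; rewrite !eopE !mulrA.
have -> : gen i * gen j = - (gen j * gen i) - ((i == j)%:R *+ 2)%:A :> Cl.
  by rewrite -mulr_natl -gen_anticomm addrCA addNr addr0.
rewrite mulrBl mulNr mulr_algl -mulrA.
rewrite -[RHS]/(- (gen j * (gen i * p u)) - (i == j)%:R *: (p *+ 2) u).
by rewrite -scalerMnl scalerMnr !mulr2n.
Qed.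

Lemma ee_same i p : eop i (eop i p) = - p.
Proof. by apply: cl_poly_eq => u; rewrite !eopE mulrA gen_sq mulN1r. Qed.

Lemma ex i j p : eop i (xop j p) = xop j (eop i p).
Proof. exact: lmulX. Qed.

Lemma de i j p : dop i (eop j p) = eop j (dop i p).
Proof. exact: dop_lmul. Qed.

Lemma dx i j p : dop i (xop j p) = (i == j)%:R *: p + xop j (dop i p).
Proof.
by apply: cl_poly_eq => u; rewrite dopE (partialX i j u (cl_polyP p)).
Qed.

Lemma xxC i j p : xop i (xop j p) = xop j (xop i p).
Proof. by apply: cl_poly_eq => u; rewrite !xopE !scalerA mulrC. Qed.

Definition cpol (c : Cl) : V := mk_poly (PolCst c).

Lemma dcst i c : dop i (cpol c) = 0.
Proof.
apply: cl_poly_eq => u; rewrite dopE.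
by apply: is_partial_val; exact: is_partial_cst.
Qed.

Lemma cl_poly_ind (P : V -> Prop) :
  (forall c, P (cpol c)) -> (forall p q, P p -> P q -> P (p + q)) ->
  (forall i p, P p -> P (xop i p)) -> forall p, P p.
Proof.
move=> Pc PD PX p; suff h (F : 'rV[R]_m -> Cl) : pol F -> forall p : V, cl_fun p = F -> P p.
  exact: (h _ (cl_polyP p)).
elim=> {p} [c|F1 F2 pF1 IH1 pF2 IH2|i F1 pF1 IH] p pE.
- have -> : p = cpol c by apply: cl_poly_eq => u; rewrite pE.
  exact: Pc.
- have -> : p = mk_poly pF1 + mk_poly pF2 by apply: cl_poly_eq => u; rewrite pE.
  by apply: PD; [apply: IH1|apply: IH2].
- have -> : p = xop i (mk_poly pF1) by apply: cl_poly_eq => u; rewrite pE.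
  by apply: PX; apply: IH.
Qed.

(** Polynomials are generated by constants and coordinates, and the Weyl
relation dx carries the commutation from p to x_l p. *)
Lemma ddC i j p : dop i (dop j p) = dop j (dop i p).
Proof.
elim/cl_poly_ind: p => [c|p q hp hq|k p hp].
- by rewrite !dcst !linear0.
- by rewrite !linearD /= hp hq.
- rewrite !dx !linearD !linearZ /= !dx hp; lin_solve (R[i]) ltac:(ring).
Qed.

Lemma sum_delta (W : lmodType C) i (f : 'I_m -> W) :
  \sum_j (i == j)%:R *: f j = f i.
Proof.
rewrite (bigD1 i) //= eqxx scale1r big1 ?addr0 // => j /negPf nj.
by rewrite eq_sym nj scale0r.
Qed.

(** The three equivariant contractions of a tuple, that is, of an element of the
tensor product with R^m. *)
Definition cone F : V := \sum_i eop i (F i).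
Definition conx F : V := \sum_i xop i (F i).
Definition cond F : V := \sum_i dop i (F i).

Definition Dir p : V := cone (fun i => dop i p).
Definition umul p : V := cone (fun i => xop i p).
Definition Eul p : V := conx (fun i => dop i p).

Fact Dir_linear : linear Dir.
Proof.
move=> c p q; rewrite /Dir /cone scaler_sumr -big_split /=.
by apply: eq_bigr => i _ /=; rewrite !linearP.
Qed.
HB.instance Definition _ := GRing.isLinear.Build C V V _ Dir Dir_linear.

Fact umul_linear : linear umul.
Proof.
move=> c p q; rewrite /umul /cone scaler_sumr -big_split /=.
by apply: eq_bigr => i _ /=; rewrite !linearP.
Qed.
HB.instance Definition _ := GRing.isLinear.Build C V V _ umul umul_linear.

Fact Eul_linear : linear Eul.
Proof.
move=> c p q; rewrite /Eul /conx scaler_sumr -big_split /=.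
by apply: eq_bigr => i _ /=; rewrite !linearP.
Qed.
HB.instance Definition _ := GRing.isLinear.Build C V V _ Eul Eul_linear.

(* Instances of linearity for each operator: rewriting with the generic lemmas
is ambiguous here. *)
Lemma eopD i p q : eop i (p + q) = eop i p + eop i q. Proof. exact: linearD. Qed.
Lemma eopN i p : eop i (- p) = - eop i p. Proof. exact: linearN. Qed.
Lemma eopZ i c p : eop i (c *: p) = c *: eop i p. Proof. exact: linearZ. Qed.
Lemma eopMn i p n : eop i (p *+ n) = eop i p *+ n. Proof. exact: linearMn. Qed.
Lemma eop0 i : eop i 0 = 0. Proof. exact: linear0. Qed.
Lemma xopD i p q : xop i (p + q) = xop i p + xop i q. Proof. exact: linearD. Qed.
Lemma xopN i p : xop i (- p) = - xop i p. Proof. exact: linearN. Qed.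
Lemma xopZ i c p : xop i (c *: p) = c *: xop i p. Proof. exact: linearZ. Qed.
Lemma xopMn i p n : xop i (p *+ n) = xop i p *+ n. Proof. exact: linearMn. Qed.
Lemma xop0 i : xop i 0 = 0. Proof. exact: linear0. Qed.
Lemma dopD i p q : dop i (p + q) = dop i p + dop i q. Proof. exact: linearD. Qed.
Lemma dopN i p : dop i (- p) = - dop i p. Proof. exact: linearN. Qed.
Lemma dopZ i c p : dop i (c *: p) = c *: dop i p. Proof. exact: linearZ. Qed.
Lemma dopMn i p n : dop i (p *+ n) = dop i p *+ n. Proof. exact: linearMn. Qed.
Lemma dop0 i : dop i 0 = 0. Proof. exact: linear0. Qed.
Lemma umulD p q : umul (p + q) = umul p + umul q. Proof. exact: linearD. Qed.
Lemma umulN p : umul (- p) = - umul p. Proof. exact: linearN. Qed.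
Lemma umulZ c p : umul (c *: p) = c *: umul p. Proof. exact: linearZ. Qed.
Lemma umulMn p n : umul (p *+ n) = umul p *+ n. Proof. exact: linearMn. Qed.
Lemma umul0  : umul 0 = 0. Proof. exact: linear0. Qed.
Lemma DirD p q : Dir (p + q) = Dir p + Dir q. Proof. exact: linearD. Qed.
Lemma DirN p : Dir (- p) = - Dir p. Proof. exact: linearN. Qed.
Lemma DirZ c p : Dir (c *: p) = c *: Dir p. Proof. exact: linearZ. Qed.
Lemma DirMn p n : Dir (p *+ n) = Dir p *+ n. Proof. exact: linearMn. Qed.
Lemma Dir0  : Dir 0 = 0. Proof. exact: linear0. Qed.
Lemma EulD p q : Eul (p + q) = Eul p + Eul q. Proof. exact: linearD. Qed.
Lemma EulN p : Eul (- p) = - Eul p. Proof. exact: linearN. Qed.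
Lemma EulZ c p : Eul (c *: p) = c *: Eul p. Proof. exact: linearZ. Qed.
Lemma EulMn p n : Eul (p *+ n) = Eul p *+ n. Proof. exact: linearMn. Qed.
Lemma Eul0  : Eul 0 = 0. Proof. exact: linear0. Qed.

Definition opE := (eopD, eopN, eopZ, eopMn, eop0, xopD, xopN, xopZ, xopMn, xop0, dopD, dopN, dopZ, dopMn, dop0, umulD, umulN, umulZ, umulMn, umul0, DirD, DirN, DirZ, DirMn, Dir0, EulD, EulN, EulZ, EulMn, Eul0).

Lemma coneP c F G : cone (fun i => c *: F i + G i) = c *: cone F + cone G.
Proof.
rewrite /cone scaler_sumr -big_split /=.
by apply: eq_bigr => i _ /=; rewrite linearP.
Qed.
Lemma conxP c F G : conx (fun i => c *: F i + G i) = c *: conx F + conx G.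
Proof.
rewrite /conx scaler_sumr -big_split /=.
by apply: eq_bigr => i _ /=; rewrite linearP.
Qed.
Lemma condP c F G : cond (fun i => c *: F i + G i) = c *: cond F + cond G.
Proof.
rewrite /cond scaler_sumr -big_split /=.
by apply: eq_bigr => i _ /=; rewrite linearP.
Qed.

Lemma eq_cone F G : F =1 G -> cone F = cone G.
Proof. by move=> h; apply: eq_bigr => i _ /=; rewrite h. Qed.
Lemma eq_conx F G : F =1 G -> conx F = conx G.
Proof. by move=> h; apply: eq_bigr => i _ /=; rewrite h. Qed.
Lemma eq_cond F G : F =1 G -> cond F = cond G.
Proof. by move=> h; apply: eq_bigr => i _ /=; rewrite h. Qed.

Lemma sum_const_ord (W : lmodType C) (w : W) : \sum_(i < m) w = m%:R *: w.
Proof. by rewrite sumr_const card_ord scaler_nat. Qed.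

Lemma cone_e p : cone (fun i => eop i p) = - (m%:R *: p).
Proof.
rewrite /cone -sum_const_ord -sumrN.
by apply: eq_bigr => i _ /=; rewrite ee_same.
Qed.

Lemma Dir_e i p : Dir (eop i p) = - eop i (Dir p) - dop i p *+ 2.
Proof.
rewrite /Dir /cone linear_sum -sumrN -(sum_delta i (fun j => dop j p *+ 2)).
rewrite -sumrB; apply: eq_bigr => j _ /=.
by rewrite de ee eq_sym.
Qed.

Lemma Dir_x i p : Dir (xop i p) = eop i p + xop i (Dir p).
Proof.
rewrite /Dir /cone linear_sum -(sum_delta i (fun j => eop j p)) -big_split /=.
by apply: eq_bigr => j _ /=; rewrite dx linearD linearZ /= ex eq_sym.
Qed.

Lemma d_umul i p : dop i (umul p) = eop i p + umul (dop i p).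
Proof.
rewrite /umul /cone linear_sum -(sum_delta i (fun j => eop j p)) -big_split /=.
by apply: eq_bigr => j _ /=; rewrite de dx linearD linearZ.
Qed.

Lemma e_umul i p : eop i (umul p) = - umul (eop i p) - xop i p *+ 2.
Proof.
rewrite /umul /cone linear_sum -(sum_delta i (fun j => xop j p *+ 2)) -sumrN -sumrB.
by apply: eq_bigr => j _ /=; rewrite /= ee !ex.
Qed.

Lemma x_umul i p : xop i (umul p) = umul (xop i p).
Proof.
rewrite /umul /cone linear_sum; apply: eq_bigr => j _ /=.
by rewrite -ex xxC.
Qed.

Lemma Dir_umul p : Dir (umul p) = - (m%:R *: p) - Eul p *+ 2 - umul (Dir p).
Proof.
transitivity (\sum_i (eop i (eop i p) - xop i (dop i p) *+ 2 -
                      umul (eop i (dop i p)))).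
  apply: eq_bigr => i _ /=; rewrite d_umul linearD /= e_umul.
  by lin_solve (R[i]) ltac:(ring).
by rewrite !big_split /= !sumrN sumrMnl -cone_e /Dir {2}/cone (linear_sum umul).
Qed.

(** The square of the vector variable is minus the square of its norm. *)
Lemma umul_umul p : umul (umul p) = - conx (fun i => xop i p).
Proof.
have h : umul (umul p) = - umul (umul p) - conx (fun i => xop i p) *+ 2.
  transitivity (\sum_i (- umul (eop i (xop i p)) - xop i (xop i p) *+ 2)).
    apply: eq_bigr => i _ /=; rewrite ex e_umul linearB linearN linearMn /=.
    by rewrite x_umul ex.
  by rewrite big_split /= !sumrN sumrMnl {3}/umul /cone (linear_sum umul).
have two : (2%:R : C) != 0 by rewrite pnatr_eq0.
apply: (scalerI two); rewrite scaler_nat mulr2n {1}h.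
by lin_solve (R[i]) ltac:(ring).
Qed.

Lemma cone_umul_e p : cone (fun i => umul (eop i p)) = m%:R *: umul p - umul p *+ 2.
Proof.
have -> : m%:R *: umul p = - umul (cone (fun i => eop i p)).
  by rewrite cone_e linearN linearZ opprK.
transitivity (\sum_i (- umul (eop i (eop i p)) - xop i (eop i p) *+ 2)).
  by apply: eq_bigr => i _ /=; rewrite e_umul.
rewrite big_split /= !sumrN sumrMnl /cone (linear_sum umul); congr (_ - _ *+ 2).
by apply: eq_bigr => i _ /=; rewrite ex.
Qed.

Lemma cone_umul_d p : cone (fun i => umul (dop i p)) = - umul (Dir p) - Eul p *+ 2.
Proof.
transitivity (\sum_i (- umul (eop i (dop i p)) - xop i (dop i p) *+ 2)).
  by apply: eq_bigr => i _ /=; rewrite e_umul.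
by rewrite big_split /= !sumrN sumrMnl /Dir /cone (linear_sum umul).
Qed.

Lemma cond_e p : cond (fun i => eop i p) = Dir p.
Proof. by apply: eq_bigr => i _ /=; rewrite de. Qed.

Lemma cond_x p : cond (fun i => xop i p) = m%:R *: p + Eul p.
Proof.
rewrite -sum_const_ord /cond /Eul /conx -big_split /=.
by apply: eq_bigr => i _ /=; rewrite dx eqxx scale1r.
Qed.

Lemma Dir_d i p : Dir (dop i p) = dop i (Dir p).
Proof.
rewrite /Dir /cone linear_sum; apply: eq_bigr => j _ /=.
by rewrite de ddC.
Qed.

Lemma cond_d p : cond (fun i => dop i p) = - Dir (Dir p).
Proof.
have h : Dir (Dir p) = - Dir (Dir p) - cond (fun i => dop i p) *+ 2.
  transitivity (\sum_i (- eop i (Dir (dop i p)) - dop i (dop i p) *+ 2)).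
    by rewrite {2}/Dir /cone linear_sum; apply: eq_bigr => i _ /=; rewrite Dir_e.
  rewrite big_split /= !sumrN sumrMnl; congr (- _ - _).
  by apply: eq_bigr => i _ /=; rewrite Dir_d.
have two : (2%:R : C) != 0 by rewrite pnatr_eq0.
apply: (scalerI two); rewrite scalerN [2%:R *: Dir _]scaler_nat [Dir _ *+ 2]mulr2n {1}h.
by lin_solve (R[i]) ltac:(ring).
Qed.

Lemma Dir_cone F : Dir (cone F) = - cone (fun i => Dir (F i)) - cond F *+ 2.
Proof.
rewrite {1}/cone linear_sum /cond /cone -sumrMnl -!sumrN -big_split /=.
by apply: eq_bigr => i _ /=; rewrite Dir_e.
Qed.

Lemma Dir_conx F : Dir (conx F) = cone F + conx (fun i => Dir (F i)).
Proof.
rewrite {1}/conx linear_sum /cone /conx -big_split /=.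
by apply: eq_bigr => i _ /=; rewrite Dir_x.
Qed.

Lemma Eul_x i p : Eul (xop i p) = xop i p + xop i (Eul p).
Proof.
rewrite /Eul /conx linear_sum -{2}(sum_delta i (fun j => xop j p)) -big_split /=.
by apply: eq_bigr => j _ /=; rewrite dx linearD linearZ /= xxC eq_sym.
Qed.

Lemma Eul_cst c : Eul (cpol c) = 0.
Proof. by rewrite /Eul /conx big1 // => i _; rewrite dcst linear0. Qed.

End Operators.

(** * The Lie algebra and the operator Omega *)
Section Omega.
Variables (R : realType) (m : nat).
Local Notation C := R[i].
Local Notation V := (cl_poly R m).
Implicit Types (p q : V) (a b i j : 'I_m) (F G : 'I_m -> V).

Lemma two_neq0 : (2%:R : C) != 0. Proof. by rewrite pnatr_eq0. Qed.

(** The derivative at t = 0 of the action of exp (t/2 e_a e_b); the term with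
a = b corrects e_a e_a = -1, so that X_aa = 0. *)
Definition Xop a b p : V :=
  2^-1 *: (eop a (eop b p) + (a == b)%:R *: p) + xop b (dop a p) - xop a (dop b p).

Fact Xop_linear a b : linear (Xop a b).
Proof.
move=> c p q; rewrite /Xop !opE.
by lin_solve (R[i]) ltac:(ring).
Qed.
HB.instance Definition _ a b := GRing.isLinear.Build C V V _ (Xop a b) (Xop_linear a b).

Lemma XopC a b p : Xop a b p = - Xop b a p.
Proof.
rewrite /Xop (ee a b) eq_sym; case: (b == a); rewrite ?scale1r ?scale0r;
by lin_solve (R[i]) ltac:(field).
Qed.

Lemma d_Xop i a b p : dop i (Xop a b p) =
  Xop a b (dop i p) + (i == b)%:R *: dop a p - (i == a)%:R *: dop b p.
Proof.
rewrite /Xop !opE !de !dx.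
rewrite (ddC i a) (ddC i b).
by lin_solve (R[i]) ltac:(ring).
Qed.

Lemma Xop_cst a b c : Xop a b (cpol c) =
  2^-1 *: (eop a (eop b (cpol c)) + (a == b)%:R *: cpol c).
Proof. by rewrite /Xop !dcst !opE addr0 subr0. Qed.

(** The mixed part of the Casimir operator of the tensor product with the vector
representation, up to a scalar factor and a scalar term. *)
Definition Omega F a : V := \sum_b Xop a b (F b).

(** In X_ab F_b, moving e_b, x_b and d_b next to F_b produces the contractions;
the commutation terms are multiples of F_a. *)
Lemma OmegaE F a : Omega F a =
  2^-1 *: eop a (cone F) - 2^-1 *: F a + dop a (conx F) - xop a (cond F).
Proof.
rewrite /cone /conx /cond !linear_sum /=.
transitivity (\sum_b (2^-1 *: eop a (eop b (F b)) +
   (a == b)%:R *: (2^-1 *: F b - F b) + dop a (xop b (F b)) -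
   xop a (dop b (F b)))).
  by apply: eq_bigr => b _; rewrite /Xop dx; lin_solve (R[i]) ltac:(ring).
rewrite !big_sumD sum_delta sumrN.
by lin_solve (R[i]) ltac:(field).
Qed.

Lemma OmegaP c F G a :
  Omega (fun i => c *: F i + G i) a = c *: Omega F a + Omega G a.
Proof.
rewrite /Omega scaler_sumr -big_split; apply: eq_bigr => b _ /=.
by rewrite linearP.
Qed.

Lemma eq_Omega F G : F =1 G -> Omega F =1 Omega G.
Proof. by move=> h a; apply: eq_bigr => b _; rewrite h. Qed.

Lemma umul_sum F : umul (\sum_i F i) = \sum_i umul (F i).
Proof. exact: linear_sum. Qed.

Lemma Eul_e i p : Eul (eop i p) = eop i (Eul p).
Proof.
by rewrite /Eul /conx linear_sum; apply: eq_bigr => j _ /=; rewrite de ex.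
Qed.

Lemma Eul_d i p : Eul (dop i p) = dop i (Eul p) - dop i p.
Proof.
rewrite /Eul /conx linear_sum -{2}(sum_delta i (fun j => dop j p)) -sumrB.
by apply: eq_bigr => j _ /=; rewrite dx ddC; lin_solve (R[i]) ltac:(ring).
Qed.

Lemma Eul_umul p : Eul (umul p) = umul p + umul (Eul p).
Proof.
transitivity (\sum_i (eop i (xop i p) + eop i (xop i (Eul p)))).
  rewrite {1}/umul /cone linear_sum; apply: eq_bigr => i _ /=.
  by rewrite Eul_e Eul_x eopD.
by rewrite big_sumD.
Qed.

Lemma conx_umul F : conx (fun i => umul (F i)) = umul (conx F).
Proof.
by rewrite /conx umul_sum; apply: eq_bigr => i _ /=; rewrite x_umul.
Qed.

Lemma conx_e p : conx (fun i => eop i p) = umul p.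
Proof. by apply: eq_bigr => i _; rewrite ex. Qed.

Lemma cond_umul F : cond (fun i => umul (F i)) = cone F + umul (cond F).
Proof.
rewrite /cond umul_sum -big_split; apply: eq_bigr => i _ /=.
by rewrite d_umul.
Qed.

Variable k : nat.
Local Notation M := (m%:R : C).
Local Notation J := (k%:R : C).
Local Notation n := (m%:R + 2%:R * k%:R : C).

(** Monogenic parts of e_i p and of x_i q, for p monogenic of degree k + 1 and q
monogenic of degree k: the corrections by multiples of u and u u cancel the
Dirac derivative. *)
Definition iota1 p i : V := eop i p - (2%:R / n) *: umul (dop i p).
Definition iota2 q i : V :=
  xop i q + n^-1 *: (umul (eop i q) + umul (umul (dop i q))).

Lemma iota1P c p q i : iota1 (c *: p + q) i = c *: iota1 p i + iota1 q i.
Proof. by rewrite /iota1 !opE; lin_solve (R[i]) ltac:(ring). Qed.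
Lemma iota2P c p q i : iota2 (c *: p + q) i = c *: iota2 p i + iota2 q i.
Proof.
by rewrite /iota2 !opE; lin_solve (R[i]) ltac:(ring).
Qed.

Hypothesis m3 : (3 <= m)%N.

(** The denominators that occur are nonzero because the dimension is at least 3:
this is where dimension 2 would fail. *)
Lemma dim_neq0 : [/\ n != 0, n + 2 != 0, M - 2 != 0 & M + J - 1 != 0].
Proof.
have m0 : (0 < m)%N by rewrite (leq_trans _ m3).
split.
- by rewrite -natrM -natrD pnatr_eq0 addn_eq0 negb_and -lt0n m0.
- by rewrite -natrM -!natrD pnatr_eq0 addn_eq0 andbF.
- by rewrite subr_eq0 (eqr_nat _ m 2) gtn_eqF.
- rewrite -natrD subr_eq0 (eqr_nat _ _ 1) gtn_eqF //.
  by rewrite (leq_trans _ (leq_addr _ _)) // (leq_trans _ m3).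
Qed.

Section OnMonogenic.
Variable p : V.
Hypotheses (Dp : Dir p = 0) (Ep : Eul p = k.+1%:R *: p).

Lemma Dir_iota1 i : Dir (iota1 p i) = 0.
Proof.
have [n0 _ _ _] := dim_neq0.
rewrite /iota1 !opE Dir_e Dp Dir_umul Eul_d Ep Dir_d Dp !opE -natr1.
by lin_solve (R[i]) ltac:(field).
Qed.

Lemma cone_iota1 : cone (iota1 p) = - ((M - 2) * (n + 2) / n) *: p.
Proof.
have [n0 _ _ _] := dim_neq0.
transitivity (cone (fun i => (- (2%:R / n)) *: umul (dop i p) + eop i p)).
  by apply: eq_cone => i; rewrite /iota1; lin_solve (R[i]) ltac:(ring).
rewrite coneP cone_e cone_umul_d Dp Ep !opE -natr1.
by lin_solve (R[i]) ltac:(field).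
Qed.

Lemma cond_iota1 : cond (iota1 p) = 0.
Proof.
transitivity (cond (fun i => (- (2%:R / n)) *: umul (dop i p) + eop i p)).
  by apply: eq_cond => i; rewrite /iota1; lin_solve (R[i]) ltac:(ring).
rewrite condP cond_e Dp cond_umul cond_d -/(Dir p) Dp !opE.
by lin_solve (R[i]) ltac:(ring).
Qed.

Lemma conx_iota1 : conx (iota1 p) = ((M - 2) / n) *: umul p.
Proof.
have [n0 _ _ _] := dim_neq0.
transitivity (conx (fun i => (- (2%:R / n)) *: umul (dop i p) + eop i p)).
  by apply: eq_conx => i; rewrite /iota1; lin_solve (R[i]) ltac:(ring).
rewrite conxP conx_e conx_umul -/(Eul p) Ep opE -natr1.
by lin_solve (R[i]) ltac:(field).
Qed.

Lemma Omega_iota1 i : Omega (iota1 p) i = - ((M - 1) / 2) *: iota1 p i.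
Proof.
have [n0 _ _ _] := dim_neq0.
rewrite OmegaE cone_iota1 conx_iota1 cond_iota1 !opE d_umul /iota1.
by lin_solve (R[i]) ltac:(field).
Qed.

End OnMonogenic.

Section OnMonogenic2.
Variable q : V.
Hypotheses (Dq : Dir q = 0) (Eq : Eul q = k%:R *: q).

Lemma Dir_iota2 i : Dir (iota2 q i) = 0.
Proof.
have [n0 _ _ _] := dim_neq0.
rewrite /iota2 !opE Dir_x Dq !Dir_umul Dir_e Dq Eul_umul Eul_e Eul_d Eq Dir_d Dq.
rewrite !opE.
by lin_solve (R[i]) ltac:(field).
Qed.

Lemma cone_iota2 : cone (iota2 q) = (2%:R * (M + J - 1) / n) *: umul q.
Proof.
have [n0 _ _ _] := dim_neq0.
transitivity (cone (fun i => n^-1 *: (umul (eop i q)) +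
    (n^-1 *: umul (umul (dop i q)) + xop i q))).
  by apply: eq_cone => i; rewrite /iota2; lin_solve (R[i]) ltac:(ring).
rewrite coneP coneP cone_umul_e -/(umul q).
have -> : cone (fun i => umul (umul (dop i q))) = 0.
  transitivity (umul (umul (cone (fun i => dop i q)))).
    rewrite /cone !umul_sum; apply: eq_bigr => i _ /=.
    by rewrite !e_umul !opE x_umul; lin_solve (R[i]) ltac:(ring).
  by rewrite -/(Dir q) Dq !opE.
by lin_solve (R[i]) ltac:(field).
Qed.

Lemma cond_iota2 : cond (iota2 q) = (M + J - 1) *: q.
Proof.
have [n0 _ _ _] := dim_neq0.
transitivity (cond (fun i => n^-1 *: (umul (eop i q)) +
    (n^-1 *: umul (umul (dop i q)) + xop i q))).
  by apply: eq_cond => i; rewrite /iota2; lin_solve (R[i]) ltac:(ring).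
rewrite condP condP cond_umul cone_e cond_e Dq cond_umul cone_umul_d.
rewrite Dq cond_umul cond_d Dq -/(Dir q) Dq cond_x Eq !opE.
by lin_solve (R[i]) ltac:(field).
Qed.

Lemma conx_iota2 : conx (iota2 q) = ((J + 1) / n - 1) *: umul (umul q).
Proof.
have [n0 _ _ _] := dim_neq0.
transitivity (conx (fun i => n^-1 *: (umul (eop i q)) +
    (n^-1 *: umul (umul (dop i q)) + xop i q))).
  by apply: eq_conx => i; rewrite /iota2; lin_solve (R[i]) ltac:(ring).
rewrite conxP conxP conx_umul conx_e conx_umul conx_umul -/(Eul q) Eq !opE.
have -> : conx (fun i => xop i q) = - umul (umul q) by rewrite umul_umul opprK.
by lin_solve (R[i]) ltac:(field).
Qed.

Lemma Omega_iota2 i : Omega (iota2 q) i = - (M + J - 2^-1) *: iota2 q i.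
Proof.
have [n0 _ _ _] := dim_neq0.
rewrite OmegaE cone_iota2 conx_iota2 cond_iota2 !opE !d_umul e_umul.
rewrite !opE /iota2.
by lin_solve (R[i]) ltac:(field).
Qed.

End OnMonogenic2.

(** Stable spaces that contain the tuples iota2 (d_i q) contain q: this is the
step from the derivatives of a polynomial back to the polynomial. *)
Lemma conx_part_iota2 (K : C) q : Dir q = 0 -> Eul q = K *: q ->
  \sum_i iota2 (dop i q) i = K *: q.
Proof.
move=> Dq Eq; transitivity (\sum_i (xop i (dop i q) + n^-1 *: (umul (eop i (dop i q)) +
   umul (umul (dop i (dop i q)))))); first by [].
rewrite big_split /= -scaler_sumr big_split /= -!umul_sum.
rewrite -/(cone (fun i => dop i q)) -/(cond (fun i => dop i q)) cond_d.
rewrite -/(Dir q) Dq !opE -/(conx (fun i => dop i q)) -/(Eul q) Eq.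
by lin_solve (R[i]) ltac:(ring).
Qed.


Lemma Omega_grad p i : Dir p = 0 -> Eul p = k.+2%:R *: p ->
  Omega (fun j => dop j p) i = (J + 3%:R / 2%:R) *: dop i p.
Proof.
move=> Dp Ep; rewrite OmegaE -/(Dir p) -/(Eul p) Ep cond_d Dp !opE.
rewrite -2!natr1.
by lin_solve (R[i]) ltac:(field).
Qed.

Lemma Omega_simplicial F i : cone F = 0 -> cond F = 0 -> conx F = 0 ->
  Omega F i = (- 2^-1 : C) *: F i.
Proof.
move=> e d x; rewrite OmegaE e d x !opE.
by lin_solve (R[i]) ltac:(ring).
Qed.

End Omega.

(** * Casimir operators and the decomposition of a tuple *)
Section Casimir.
Variables (R : realType) (m : nat).
Local Notation C := R[i].
Local Notation V := (cl_poly R m).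
Local Notation M := (m%:R : C).
Implicit Types (p q : V) (a b i j : 'I_m) (F G : 'I_m -> V).

Definition Cas p : V := \sum_a \sum_b Xop a b (Xop a b p).

(** On the vector factor exp (t/2 e_a e_b) rotates the plane of e_a and e_b,
whence the two terms without X_ab. *)
Definition XT a b F i : V :=
  Xop a b (F i) + (i == b)%:R *: F a - (i == a)%:R *: F b.

Definition CasT F i : V := \sum_a \sum_b XT a b (XT a b F) i.

Lemma XopD a b p q : Xop a b (p + q) = Xop a b p + Xop a b q.
Proof. exact: linearD. Qed.
Lemma XopN a b p : Xop a b (- p) = - Xop a b p.
Proof. exact: linearN. Qed.
Lemma XopZ a b (c : C) p : Xop a b (c *: p) = c *: Xop a b p.
Proof. exact: linearZ. Qed.

Lemma cond_const p : \sum_(i < m) p = M *: p.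
Proof. exact: sum_const_ord. Qed.

(** Expanding the square of X_ab acting on a tensor product gives the two
Casimir operators and twice the mixed term. *)
Lemma CasTE F i : CasT F i = Cas (F i) - 4%:R *: Omega F i - (2%:R * (M - 1)) *: F i.
Proof.
pose A a b := (i == b)%:R *: (2%:R *: Xop a b (F a) + (a == b)%:R *: F a - F b).
pose B a b := (i == a)%:R *: (2%:R *: Xop a b (F b) + F a - (a == b)%:R *: F b).
transitivity (\sum_a \sum_b (Xop a b (Xop a b (F i)) + A a b - B a b)).
  apply: eq_bigr => a _; apply: eq_bigr => b _.
  rewrite /XT !XopD !XopN !XopZ !eqxx [b == a]eq_sym /A /B /=.
  by lin_solve (R[i]) ltac:(ring).
under eq_bigr do rewrite big_sumB big_sumD.
rewrite big_sumB big_sumD -/(Cas (F i)).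
have -> : \sum_a \sum_b A a b = - (2%:R *: Omega F i) + F i - M *: F i.
  under eq_bigr do rewrite sum_delta.
  rewrite big_sumB big_sumD cond_const; congr (_ + _ - _).
    rewrite /Omega scaler_sumr -sumrN; apply: eq_bigr => a _.
    by rewrite XopC scalerN.
  by under eq_bigr do rewrite eq_sym; rewrite sum_delta.
have -> : \sum_a \sum_b B a b = 2%:R *: Omega F i + M *: F i - F i.
  rewrite /B; under eq_bigr do rewrite -scaler_sumr.
  rewrite sum_delta big_sumB big_sumD cond_const sum_delta.
  by rewrite /Omega scaler_sumr.
by lin_solve (R[i]) ltac:(ring).
Qed.

Section CasimirOnMonogenics.
Variables (K : C) (p : V).
Hypotheses (Dp : Dir p = 0) (Ep : Eul p = K *: p).

Lemma Xop_same a q : Xop a a q = 0.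
Proof.
rewrite /Xop eqxx ee_same /=.
by lin_solve (R[i]) ltac:(ring).
Qed.

Lemma cone_Xop a : cone (fun b => Xop b a p) =
  - ((M - 1) / 2) *: eop a p - umul (dop a p).
Proof.
transitivity (\sum_b (2^-1 *: eop b (eop b (eop a p)) + (a == b)%:R *: (2^-1 *: eop b p) +
   xop a (eop b (dop b p)) - eop b (xop b (dop a p)))).
  apply: eq_bigr => b _; rewrite /Xop !opE !ex [b == a]eq_sym.
  by lin_solve (R[i]) ltac:(ring).
rewrite big_sumB !big_sumD sum_delta -[X in _ - X = _]/(umul (dop a p)).
have -> : \sum_i xop a (eop i (dop i p)) = xop a (Dir p).
  by rewrite /Dir /cone linear_sum.
rewrite Dp opE -scaler_sumr -/(cone (fun i => eop i (eop a p))) cone_e.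
by lin_solve (R[i]) ltac:(field).
Qed.

Lemma conx_Xop a : conx (fun b => Xop b a p) =
  2^-1 *: umul (eop a p) + (K + 2^-1) *: xop a p + umul (umul (dop a p)).
Proof.
rewrite umul_umul.
transitivity (\sum_b (2^-1 *: eop b (xop b (eop a p)) + (a == b)%:R *: (2^-1 *: xop b p) +
   xop a (xop b (dop b p)) - xop b (xop b (dop a p)))).
  apply: eq_bigr => b _; rewrite /Xop !opE !ex [b == a]eq_sym (xxC a b).
  by lin_solve (R[i]) ltac:(ring).
rewrite big_sumB !big_sumD sum_delta -scaler_sumr
  -[X in 2^-1 *: X + _ + _ - _]/(umul (eop a p)).
have -> : \sum_i xop a (xop i (dop i p)) = xop a (Eul p).
  by rewrite /Eul /conx linear_sum.
rewrite Ep opE -[X in _ - X = _]/(conx (fun i => xop i (dop a p))).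
by lin_solve (R[i]) ltac:(ring).
Qed.

Lemma cond_Xop a : cond (fun b => Xop b a p) = - (M + K - 3%:R / 2%:R) *: dop a p.
Proof.
transitivity (\sum_b (2^-1 *: eop b (dop b (eop a p)) + (a == b)%:R *: (2^-1 *: dop b p + dop b p) +
   xop a (dop b (dop b p)) - dop b (xop b (dop a p)))).
  apply: eq_bigr => b _; rewrite /Xop !opE !de (dx b a) [b == a]eq_sym.
  by lin_solve (R[i]) ltac:(ring).
rewrite big_sumB !big_sumD sum_delta -scaler_sumr
  -[X in 2^-1 *: X + _ + _ - _]/(cone (fun i => dop i (eop a p))).
rewrite -/(Dir (eop a p)) Dir_e Dp.
have -> : \sum_i xop a (dop i (dop i p)) = xop a (cond (fun i => dop i p)).
  by rewrite /cond linear_sum.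
rewrite -[X in _ - X = _]/(cond (fun i => xop i (dop a p))) cond_x cond_d Dp Eul_d Ep !opE.
by lin_solve (R[i]) ltac:(field).
Qed.

(** The Casimir operator is minus the sum of the operators Omega applied to the
tuples X_ba p, whose contractions are computed above. *)
Lemma Cas_monogenic :
  Cas p = - (M * (M - 1) / 4%:R + 2%:R * K * (K + M - 1)) *: p.
Proof.
have -> : Cas p = - \sum_a Omega (fun b => Xop b a p) a.
  rewrite /Cas -sumrN; apply: eq_bigr => a _.
  rewrite /Omega -sumrN; apply: eq_bigr => b _.
  by rewrite [in LHS](XopC a b p) XopN.
transitivity (- \sum_a ((- ((M - 1) / 4%:R)) *: eop a (eop a p) -
   2^-1 *: eop a (umul (dop a p)) + 2^-1 *: dop a (umul (eop a p)) +
   (K + 2^-1) *: dop a (xop a p) + dop a (umul (umul (dop a p))) +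
   (M + K - 3%:R / 2%:R) *: xop a (dop a p))).
  congr (- _); apply: eq_bigr => a _.
  rewrite OmegaE cone_Xop conx_Xop cond_Xop Xop_same !opE.
  by lin_solve (R[i]) ltac:(field).
rewrite !big_sumD sumrN -!scaler_sumr.
rewrite -/(cone (fun a => eop a p)) -/(cone (fun a => umul (dop a p))).
rewrite -/(cond (fun a => umul (eop a p))) -/(cond (fun a => xop a p)).
rewrite -/(cond (fun a => umul (umul (dop a p)))) -/(conx (fun a => dop a p)).
rewrite -/(Eul p) !cond_umul cond_e cond_d cone_e cone_umul_d cond_x.
rewrite -/(Dir p) Ep Dp !opE.
by lin_solve (R[i]) ltac:(field).
Qed.

End CasimirOnMonogenics.
End Casimir.

Section Decomposition.
Variables (R : realType) (m k : nat).
Local Notation C := R[i].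
Local Notation V := (cl_poly R m).
Local Notation M := (m%:R : C).
Local Notation J := (k%:R : C).
Local Notation n := (m%:R + 2%:R * k%:R : C).
Implicit Types (p q : V) (a b i j : 'I_m) (F G : 'I_m -> V).
Hypothesis m3 : (3 <= m)%N.

(** The monogenic part of cone F. Its Dirac derivative vanishes because
Dir (cone F) = - 2 cond F. *)
Definition monoT F : V := cone F - (2%:R / n) *: umul (cond F).

(** The preimages of F under the three embeddings and the remainder; the scalars
invert those by which the contractions act on the embedded spaces. *)
Definition comp1 F : V := (- ((M - 2) * (n + 2) / n))^-1 *: monoT F.
Definition comp2 F : V := (M + J - 1)^-1 *: cond F.
Definition rest F i : V := F i - iota1 k (comp1 F) i - iota2 k (comp2 F) i.
Definition comp3 F : V := (J + 2)^-1 *: conx (rest F).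
Definition comp4 F i : V := rest F i - dop i (comp3 F).

Lemma decompE F i :
  F i = iota1 k (comp1 F) i + iota2 k (comp2 F) i + dop i (comp3 F) + comp4 F i.
Proof. by rewrite /comp4 /rest; lin_solve (R[i]) ltac:(ring). Qed.

Lemma monoTP c F G : monoT (fun i => c *: F i + G i) = c *: monoT F + monoT G.
Proof. by rewrite /monoT coneP condP !opE; lin_solve (R[i]) ltac:(ring). Qed.

Lemma comp1P c F G : comp1 (fun i => c *: F i + G i) = c *: comp1 F + comp1 G.
Proof. by rewrite /comp1 monoTP; lin_solve (R[i]) ltac:(ring). Qed.

Lemma comp2P c F G : comp2 (fun i => c *: F i + G i) = c *: comp2 F + comp2 G.
Proof. by rewrite /comp2 condP; lin_solve (R[i]) ltac:(ring). Qed.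

Lemma restP c F G i : rest (fun i => c *: F i + G i) i = c *: rest F i + rest G i.
Proof. by rewrite /rest comp1P comp2P iota1P iota2P; lin_solve (R[i]) ltac:(ring). Qed.

Lemma comp3P c F G : comp3 (fun i => c *: F i + G i) = c *: comp3 F + comp3 G.
Proof.
rewrite /comp3 (eq_conx (restP c F G)) conxP.
by lin_solve (R[i]) ltac:(ring).
Qed.

Lemma comp4P c F G i : comp4 (fun i => c *: F i + G i) i = c *: comp4 F i + comp4 G i.
Proof. by rewrite /comp4 comp3P restP !opE; lin_solve (R[i]) ltac:(ring). Qed.

Lemma Eul_cone F : Eul (cone F) = cone (fun i => Eul (F i)).
Proof. by rewrite /cone linear_sum; apply: eq_bigr => i _ /=; rewrite Eul_e. Qed.

Lemma Eul_conx F : Eul (conx F) = conx F + conx (fun i => Eul (F i)).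
Proof.
rewrite {1}/conx linear_sum /conx -big_sumD.
by apply: eq_bigr => i _ /=; rewrite Eul_x.
Qed.

Lemma Eul_cond F : Eul (cond F) = cond (fun i => Eul (F i)) - cond F.
Proof.
rewrite {1}/cond linear_sum /cond -big_sumB.
by apply: eq_bigr => i _ /=; rewrite Eul_d.
Qed.

Lemma coneZ c F : cone (fun i => c *: F i) = c *: cone F.
Proof. by rewrite /cone scaler_sumr; apply: eq_bigr => i _; rewrite opE. Qed.
Lemma conxZ c F : conx (fun i => c *: F i) = c *: conx F.
Proof. by rewrite /conx scaler_sumr; apply: eq_bigr => i _; rewrite opE. Qed.
Lemma condZ c F : cond (fun i => c *: F i) = c *: cond F.
Proof. by rewrite /cond scaler_sumr; apply: eq_bigr => i _; rewrite opE. Qed.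
Lemma cone0 : cone (fun i => 0 : V) = 0.
Proof. by rewrite /cone big1 // => i _; rewrite opE. Qed.
Lemma conx0 : conx (fun i => 0 : V) = 0.
Proof. by rewrite /conx big1 // => i _; rewrite opE. Qed.
Lemma cond0 : cond (fun i => 0 : V) = 0.
Proof. by rewrite /cond big1 // => i _; rewrite opE. Qed.

Variable F : 'I_m -> V.
Hypotheses (DF : forall i, Dir (F i) = 0)
           (EF : forall i, Eul (F i) = k.+1%:R *: F i).

Lemma Dir_condF : Dir (cond F) = 0.
Proof.
rewrite /cond linear_sum big1 // => i _ /=.
by rewrite Dir_d DF opE.
Qed.

Lemma Eul_condF : Eul (cond F) = J *: cond F.
Proof.
rewrite Eul_cond (eq_cond EF) condZ -natr1.
by lin_solve (R[i]) ltac:(ring).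
Qed.

Lemma Dir_coneF : Dir (cone F) = - (cond F *+ 2).
Proof. by rewrite Dir_cone (eq_cone DF) cone0 oppr0 add0r. Qed.

Lemma Dir_monoT : Dir (monoT F) = 0.
Proof.
have [n0 _ _ _] := dim_neq0 R k m3.
rewrite /monoT !opE Dir_coneF Dir_umul Dir_condF Eul_condF !opE.
by lin_solve (R[i]) ltac:(field).
Qed.

Lemma Eul_monoT : Eul (monoT F) = k.+1%:R *: monoT F.
Proof.
rewrite /monoT !opE Eul_umul Eul_condF Eul_cone (eq_cone EF) coneZ !opE -natr1.
by lin_solve (R[i]) ltac:(ring).
Qed.

Lemma Dir_comp1 : Dir (comp1 F) = 0.
Proof. by rewrite /comp1 opE Dir_monoT scaler0. Qed.
Lemma Eul_comp1 : Eul (comp1 F) = k.+1%:R *: comp1 F.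
Proof. by rewrite /comp1 opE Eul_monoT; lin_solve (R[i]) ltac:(ring). Qed.
Lemma Dir_comp2 : Dir (comp2 F) = 0.
Proof. by rewrite /comp2 opE Dir_condF scaler0. Qed.
Lemma Eul_comp2 : Eul (comp2 F) = J *: comp2 F.
Proof. by rewrite /comp2 opE Eul_condF; lin_solve (R[i]) ltac:(ring). Qed.

Lemma cone_rest : cone (rest F) = 0.
Proof.
have [n0 n2 m2 c2] := dim_neq0 R k m3.
transitivity (cone (fun i => - 1 *: iota1 k (comp1 F) i +
    (- 1 *: iota2 k (comp2 F) i + F i))).
  by apply: eq_cone => i; rewrite /rest; lin_solve (R[i]) ltac:(ring).
rewrite coneP coneP (cone_iota1 m3 Dir_comp1 Eul_comp1) (cone_iota2 k m3 Dir_comp2).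
rewrite /comp1 /comp2 /monoT !opE.
by lin_solve (R[i]) ltac:(field; rewrite ?n0 ?n2 ?m2 ?c2).
Qed.

Lemma cond_rest : cond (rest F) = 0.
Proof.
have [n0 n2 m2 c2] := dim_neq0 R k m3.
transitivity (cond (fun i => - 1 *: iota1 k (comp1 F) i +
    (- 1 *: iota2 k (comp2 F) i + F i))).
  by apply: eq_cond => i; rewrite /rest; lin_solve (R[i]) ltac:(ring).
rewrite condP condP (cond_iota1 _ Dir_comp1) (cond_iota2 m3 Dir_comp2 Eul_comp2).
rewrite /comp2.
by lin_solve (R[i]) ltac:(field).
Qed.

Lemma Dir_rest i : Dir (rest F i) = 0.
Proof.
rewrite /rest 2!DirD 2!DirN DF (Dir_iota1 m3 Dir_comp1 Eul_comp1).
by rewrite (Dir_iota2 m3 Dir_comp2 Eul_comp2) !subr0.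
Qed.

Lemma Eul_iota1 p i : Eul p = k.+1%:R *: p ->
  Eul (iota1 k p i) = k.+1%:R *: iota1 k p i.
Proof.
move=> Ep; rewrite /iota1 !opE Eul_e Eul_umul Eul_d Ep !opE.
by lin_solve (R[i]) ltac:(ring).
Qed.

Lemma Eul_iota2 q i : Eul q = k%:R *: q -> 
  Eul (iota2 k q i) = k.+1%:R *: iota2 k q i.
Proof.
move=> Eq; rewrite /iota2 !opE Eul_x Eul_umul Eul_e Eul_umul Eul_umul Eul_d Eq !opE.
by rewrite -natr1; lin_solve (R[i]) ltac:(ring).
Qed.

Lemma Eul_rest i : Eul (rest F i) = k.+1%:R *: rest F i.
Proof.
rewrite /rest 2!EulD 2!EulN EF (Eul_iota1 i Eul_comp1) (Eul_iota2 i Eul_comp2).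
by lin_solve (R[i]) ltac:(ring).
Qed.

Lemma Dir_comp3 : Dir (comp3 F) = 0.
Proof.
rewrite /comp3 opE Dir_conx cone_rest (eq_conx Dir_rest).
by rewrite /conx big1 ?addr0 ?scaler0 // => i _; rewrite opE.
Qed.

Lemma Eul_comp3 : Eul (comp3 F) = k.+2%:R *: comp3 F.
Proof.
rewrite /comp3 opE Eul_conx (eq_conx Eul_rest) conxZ -2!natr1.
by lin_solve (R[i]) ltac:(ring).
Qed.

Lemma k2_neq0 : J + 2 != 0.
Proof. by rewrite -natrD pnatr_eq0 addn_eq0 andbF. Qed.

Lemma comp4E i : comp4 F i = - 1 *: dop i (comp3 F) + rest F i.
Proof. by rewrite /comp4; lin_solve (R[i]) ltac:(ring). Qed.

Lemma cone_comp4 : cone (comp4 F) = 0.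
Proof. by rewrite (eq_cone comp4E) coneP -/(Dir _) Dir_comp3 cone_rest scaler0 addr0. Qed.

Lemma cond_comp4 : cond (comp4 F) = 0.
Proof.
by rewrite (eq_cond comp4E) condP cond_d Dir_comp3 opE oppr0 scaler0 add0r cond_rest.
Qed.

Lemma conx_comp4 : conx (comp4 F) = 0.
Proof.
have k2 := k2_neq0.
rewrite (eq_conx comp4E) conxP -/(Eul _) Eul_comp3 /comp3 -2!natr1.
by lin_solve (R[i]) ltac:(field).
Qed.

Lemma Omega_decomp i : Omega F i =
  - ((M - 1) / 2) *: iota1 k (comp1 F) i - (M + J - 2^-1) *: iota2 k (comp2 F) i +
  (J + 3%:R / 2%:R) *: dop i (comp3 F) - 2^-1 *: comp4 F i.
Proof.
transitivity (Omega (fun j => 1 *: iota1 k (comp1 F) j + (1 *: iota2 k (comp2 F) j +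
   (1 *: dop j (comp3 F) + comp4 F j))) i).
  by apply: eq_Omega => j; rewrite {1}decompE; lin_solve (R[i]) ltac:(ring).
rewrite !OmegaP (Omega_iota1 m3 Dir_comp1 Eul_comp1) (Omega_iota2 m3 Dir_comp2 Eul_comp2).
rewrite (Omega_grad i Dir_comp3 Eul_comp3).
rewrite (Omega_simplicial i cone_comp4 cond_comp4 conx_comp4).
by lin_solve (R[i]) ltac:(ring).
Qed.

End Decomposition.

(** * Homogeneous polynomials *)
Section Homogeneous.
Variables (R : realType) (m : nat).
Local Notation C := R[i].
Local Notation Cl := (clifford C m).
Local Notation V := (cl_poly R m).
Implicit Types (p q : V) (i j : 'I_m) (F G : 'I_m -> V).

(** Degree k + 1 means a combination of coordinates with coefficients of degree
k; this form suits induction better than sums of monomials. *)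
Fixpoint homo (k : nat) : V -> Prop :=
  if k is k'.+1 then fun p => exists2 F, (forall i, homo k' (F i)) & p = conx F
  else fun p => exists c, p = cpol c.

Lemma cpolP c (a b : Cl) : cpol (c *: a + b) = c *: cpol a + cpol b.
Proof. exact: cl_poly_eq. Qed.

Lemma homoP k c p q : homo k p -> homo k q -> homo k (c *: p + q).
Proof.
elim: k p q => [|k IH] p q /=.
  by move=> [a ->] [b ->]; exists (c *: a + b); rewrite cpolP.
move=> [F hF ->] [G hG ->]; exists (fun i => c *: F i + G i) => [i|].
  exact: IH.
by rewrite conxP.
Qed.

Lemma homo0 k : homo k 0.
Proof.
elim: k => [|k IH] /=; first by exists 0; apply: cl_poly_eq.
by exists (fun=> 0) => //; rewrite conx0.
Qed.

Lemma homoD k p q : homo k p -> homo k q -> homo k (p + q).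
Proof. by move=> hp hq; rewrite -[p]scale1r; apply: homoP. Qed.

Lemma homoZ k c p : homo k p -> homo k (c *: p).
Proof. by move=> hp; rewrite -[_ *: _]addr0; apply: homoP => //; apply: homo0. Qed.

Lemma homoN k p : homo k p -> homo k (- p).
Proof. by move=> hp; rewrite -scaleN1r; apply: homoZ. Qed.

Lemma homo_sum k (I : Type) (r : seq I) (P : pred I) (F : I -> V) :
  (forall l, homo k (F l)) -> homo k (\sum_(l <- r | P l) F l).
Proof. by move=> h; elim/big_rec: _ => [|i x _]; [exact: homo0|exact: homoD]. Qed.

Lemma homo_lmul k a p : homo k p -> homo k (lmul a p).
Proof.
elim: k p => [|k IH] p /=.
  by move=> [c ->]; exists (a * c); apply: cl_poly_eq.
move=> [F hF ->]; exists (fun i => lmul a (F i)) => [i|]; first exact: IH.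
by rewrite /conx linear_sum; apply: eq_bigr => i _ /=; rewrite lmulX.
Qed.

Lemma homo_e k i p : homo k p -> homo k (eop i p).
Proof. exact: homo_lmul. Qed.

Lemma homo_x k i p : homo k p -> homo k.+1 (xop i p).
Proof.
move=> hp; exists (fun j => (i == j)%:R *: p) => [j|]; first exact: homoZ.
rewrite /conx -(sum_delta i (fun j => xop j p)).
by apply: eq_bigr => j _; rewrite opE.
Qed.

Lemma homo0_d i p : homo 0 p -> dop i p = 0.
Proof. by move=> [c ->]; exact: dcst. Qed.

Lemma homo_d k i p : homo k.+1 p -> homo k (dop i p).
Proof.
elim: k p => [|k IH] p [F hF ->]; rewrite /conx linear_sum; apply: homo_sum => j.
  rewrite [_ (xop _ _)]dx (homo0_d _ (hF j)) opE addr0.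
  by apply: homoZ; exact: hF.
rewrite [_ (xop _ _)]dx; apply: homoD; first by apply: homoZ; exact: hF.
by apply: homo_x; apply: IH; exact: hF.
Qed.

Lemma homo_xd k i j p : homo k p -> homo k (xop i (dop j p)).
Proof.
case: k => [|k] hp; first by rewrite (homo0_d _ hp) opE; apply: homo0.
by apply: homo_x; apply: homo_d.
Qed.

Lemma homo_cone k F : (forall i, homo k (F i)) -> homo k (cone F).
Proof. by move=> h; apply: homo_sum => i; apply: homo_e. Qed.

Lemma homo_cond k F : (forall i, homo k.+1 (F i)) -> homo k (cond F).
Proof. by move=> h; apply: homo_sum => i; apply: homo_d. Qed.

Lemma homo_conx k F : (forall i, homo k (F i)) -> homo k.+1 (conx F).
Proof. by move=> h; exists F. Qed.

Lemma homo_umul k p : homo k p -> homo k.+1 (umul p).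
Proof. by move=> hp; apply: homo_cone => i; apply: homo_x. Qed.

Lemma homo_umul_d k i p : homo k p -> homo k (umul (dop i p)).
Proof. by move=> hp; apply: homo_sum => j; apply/homo_e/homo_xd. Qed.

Lemma homo_Eul k p : homo k p -> Eul p = k%:R *: p.
Proof.
elim: k p => [|k IH] p /=.
  by move=> [c ->]; rewrite Eul_cst scale0r.
move=> [F hF ->]; rewrite Eul_conx.
have -> : conx (fun i => Eul (F i)) = k%:R *: conx F.
  by rewrite -conxZ; apply: eq_conx => i; rewrite IH.
by rewrite -natr1; lin_solve (R[i]) ltac:(ring).
Qed.

Lemma homo_iota1 k p i : homo k.+1 p -> homo k.+1 (iota1 k p i).
Proof.
move=> hp; apply: homoD; first exact: homo_e.
by apply/homoN/homoZ/homo_umul_d.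
Qed.

Lemma homo_iota2 k q i : homo k q -> homo k.+1 (iota2 k q i).
Proof.
move=> hq; apply: homoD; first exact: homo_x.
apply/homoZ/homoD; first by apply/homo_umul/homo_e.
by apply/homo_umul/homo_umul_d.
Qed.

Lemma homo_inj_d k p : homo k.+1 p -> (forall i, dop i p = 0) -> p = 0.
Proof.
move=> hp dp; have := homo_Eul hp.
rewrite /Eul /conx big1 => [/esym/eqP|i _]; last by rewrite dp opE.
by rewrite scaler_eq0 pnatr_eq0 => /eqP.
Qed.


Lemma homog_polyD k (p q : 'rV[R]_m -> Cl) :
  homog_poly k p -> homog_poly k q -> homog_poly k (fun u => p u + q u).
Proof.
move=> [c pc] [d qd]; exists [ffun al => c al + d al] => u.
rewrite pc qd -big_split; apply: eq_bigr => al _.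
by rewrite ffunE scalerDr.
Qed.

Lemma homog_poly0 k : homog_poly k (fun u : 'rV[R]_m => 0 : Cl).
Proof.
exists [ffun=> 0] => u; rewrite big1 // => al _.
by rewrite ffunE scaler0.
Qed.

Lemma homog_poly_sum k (I : Type) (r : seq I) (P : pred I)
    (p : I -> 'rV[R]_m -> Cl) : (forall l, P l -> homog_poly k (p l)) ->
  homog_poly k (fun u => \sum_(l <- r | P l) p l u).
Proof.
move=> h; elim: r => [|i r IH].
  rewrite (_ : (fun _ => _) = (fun=> 0)); first exact: homog_poly0.
  by apply/funext => u; rewrite big_nil.
case Pi : (P i).
  rewrite (_ : (fun _ => _) = (fun u => p i u + \sum_(j <- r | P j) p j u)).
    by apply: homog_polyD => //; apply: h.
  by apply/funext => u; rewrite big_cons Pi.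
rewrite (_ : (fun _ => _) = (fun u => \sum_(j <- r | P j) p j u)) //.
by apply/funext => u; rewrite big_cons Pi.
Qed.

Lemma homog_poly_monomial k (f : 'I_m -> nat) (c : Cl) : (\sum_i f i = k)%N ->
  homog_poly k (fun u : 'rV[R]_m => (\prod_i u 0 i ^+ f i)%:C *: c).
Proof.
move=> fk; have fle i : (f i < k.+1)%N by rewrite ltnS -fk (bigD1 i) //= leq_addr.
pose al0 := [ffun i => Ordinal (fle i)].
exists [ffun al => if al == al0 then c else 0] => u.
rewrite (bigD1 al0) /=; last first.
  apply/eqP; rewrite /multideg -[RHS]fk.
  by apply: eq_bigr => i _; rewrite ffunE.
rewrite ffunE eqxx [X in _ = _ + X]big1 => [|al /andP[_ /negPf nal]]; last first.
  by rewrite ffunE nal scaler0.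
rewrite addr0 /monomial; congr (_%:C *: _).
by apply: eq_bigr => i _; rewrite ffunE.
Qed.

Lemma homo_homog_poly k p : homo k p -> homog_poly k p.
Proof.
suff h (j : nat) : forall p (f : 'I_m -> nat),
    homo j p -> homog_poly (j + \sum_i f i)
      (fun u => (\prod_i u 0 i ^+ f i)%:C *: p u).
  move=> hp; have := h _ _ (fun=> 0%N) hp.
  rewrite big1 // addn0; congr homog_poly; apply/funext => u.
  by rewrite big1 ?scale1r.
elim: j => [|j IH] {}p f.
  by move=> [c ->]; apply: homog_poly_monomial.
move=> [F hF ->]; rewrite (_ : (fun _ => _) = (fun u : 'rV_m => \sum_i
    (\prod_l u 0 l ^+ (f l + (l == i)))%:C *: F i u)); last first.
  apply/funext => u.
  have -> : conx F u = \sum_i (u 0 i)%:C *: F i u.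
    rewrite /conx; elim/big_rec2: _ => // i _ y _ <-.
    by rewrite cl_polyDE.
  rewrite scaler_sumr; apply: eq_bigr => i _.
  rewrite scalerA -rmorphM; congr (_%:C *: _).
  under [RHS]eq_bigr do rewrite exprD.
  rewrite big_split; congr (_ * _); rewrite (bigD1 i) //= eqxx expr1 big1 ?mulr1 //.
  by move=> l /negPf ->.
apply: homog_poly_sum => i _.
have -> : (j.+1 + \sum_l f l = j + \sum_l (f l + (l == i)))%N.
  rewrite big_split /= [X in (_ + (_ + X))%N](bigD1 i) //= eqxx.
  by rewrite [X in (true + X)%N]big1 => [|l /negPf ->] //; rewrite addn0 addn1 addnS.
exact: (IH (F i) (fun l => (f l + (l == i))%N) (hF i)).
Qed.

Lemma homog_poly_homo k (p : 'rV[R]_m -> Cl) : homog_poly k p ->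
  exists2 q, homo k q & cl_fun q = p.
Proof.
move=> [c pc].
have iter_x n i q (j : nat) : homo j q -> homo (n + j) (iter n (xop i) q).
  by move=> hq; elim: n => //= n IH; apply: homo_x.
have iter_xE n i q u : iter n (xop i) q u = ((u 0 i) ^+ n)%:C *: q u.
  elim: n => [|n IH]; first by rewrite scale1r.
  by rewrite iterS xopE IH scalerA -rmorphM exprS.
have mono (r : seq 'I_m) (f : 'I_m -> nat) (a : Cl) :
    exists2 q, homo (\sum_(i <- r) f i)%N q &
    forall u, q u = (\prod_(i <- r) u 0 i ^+ f i)%:C *: a.
  elim: r => [|i r [q hq qE]].
    exists (cpol a); first by rewrite big_nil; exists a.
    by move=> u; rewrite big_nil scale1r.
  exists (iter (f i) (xop i) q); first by rewrite big_cons; apply: iter_x.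
  by move=> u; rewrite iter_xE qE big_cons rmorphM scalerA.
have /choice[q qP] (al : {ffun 'I_m -> 'I_k.+1}) : exists q,
    homo (multideg al) q /\ forall u, q u = (monomial al u)%:C *: c al.
  have [q hq qE] := mono (index_enum 'I_m) (fun i => al i : nat) (c al).
  by exists q.
exists (\sum_(al | multideg al == k) q al).
  elim/big_rec: _ => [|al x /eqP alk hx]; first exact: homo0.
  by apply: homoD => //; rewrite -alk; exact: (qP al).1.
apply/funext => u; rewrite pc.
elim/big_rec2: _ => // al y x _ <-.
by rewrite cl_polyDE (qP al).2.
Qed.

End Homogeneous.

(** * The action of the spin group *)
Section SpinAction.
Variables (R : realType) (m : nat).
Local Notation C := R[i].
Local Notation Cl := (clifford C m).
Local Notation V := (cl_poly R m).
Implicit Types (p q : V) (i j : 'I_m) (F G : 'I_m -> V) (s : clifford R m)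
  (M : 'M[R]_m).

Definition rotp M p : V := mk_poly (pol_comp M (cl_polyP p)).

Lemma rotpE M p u : rotp M p u = p (u *m M). Proof. by []. Qed.

Fact rotp_linear M : linear (rotp M).
Proof. by move=> c p q; apply: cl_poly_eq. Qed.
HB.instance Definition _ M := GRing.isLinear.Build C V V _ (rotp M) (rotp_linear M).

Lemma rotpD M p q : rotp M (p + q) = rotp M p + rotp M q. Proof. exact: linearD. Qed.
Lemma rotpZ M c p : rotp M (c *: p) = c *: rotp M p. Proof. exact: linearZ. Qed.

Lemma sumVE (I : Type) (r : seq I) (P : pred I) (H : I -> V) u :
  (\sum_(l <- r | P l) H l) u = \sum_(l <- r | P l) H l u.
Proof. by elim/big_rec2: _ => // l y x _ <-; rewrite cl_polyDE. Qed.

Lemma rotp_x M i p : rotp M (xop i p) = \sum_j (M j i)%:C *: xop j (rotp M p).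
Proof.
apply: cl_poly_eq => u; rewrite rotpE xopE sumVE mxE rmorph_sum scaler_suml.
by apply: eq_bigr => j _; rewrite rmorphM cl_polyZE xopE rotpE scalerA mulrC.
Qed.

Lemma d_rotp M i p : dop i (rotp M p) = \sum_j (M i j)%:C *: rotp M (dop j p).
Proof.
elim/cl_poly_ind: p => [c|p q hp hq|l p hp].
- rewrite big1 => [|j _]; last by rewrite dcst linear0 scaler0.
  by rewrite (_ : rotp M (cpol c) = cpol c) ?dcst //; apply: cl_poly_eq.
- rewrite linearD opE hp hq -big_sumD; apply: eq_bigr => j _.
  by rewrite opE linearD scalerDr.
rewrite rotp_x linear_sum /=.
transitivity (\sum_j ((i == j)%:R *: ((M j l)%:C *: rotp M p) +
                      (M j l)%:C *: xop j (dop i (rotp M p)))).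
  by apply: eq_bigr => j _; rewrite opE dx; lin_solve (R[i]) ltac:(ring).
rewrite big_sumD sum_delta.
transitivity (\sum_j ((l == j)%:R *: ((M i j)%:C *: rotp M p) +
                      (M i j)%:C *: rotp M (xop l (dop j p)))); last first.
  apply: eq_bigr => j _; rewrite dx rotpD rotpZ eq_sym.
  by lin_solve (R[i]) ltac:(ring).
rewrite big_sumD sum_delta; congr (_ + _).
under [RHS]eq_bigr do rewrite rotp_x scaler_sumr.
rewrite [RHS]exchange_big; apply: eq_bigr => a _ /=.
rewrite hp (linear_sum (xop a)) scaler_sumr; apply: eq_bigr => j _ /=.
by rewrite opE; lin_solve (R[i]) ltac:(ring).
Qed.

Lemma homo_rotp k M p : homo k p -> homo k (rotp M p).
Proof.
elim: k p => [|k IH] p.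
  by move=> [c ->]; exists c; apply: cl_poly_eq.
move=> [F hF ->]; rewrite /conx linear_sum; apply: homo_sum => i.
rewrite [_ (xop _ _)]rotp_x; apply: homo_sum => j; apply/homoZ/homo_x; apply: IH; exact: hF.
Qed.

(** The matrix form of the action: polynomial in the coefficients of s and total,
it agrees with act_mono on the spin group. *)
Definition actV s p : V := lmul (complexify s) (rotp (rho1 s) p).

Fact actV_linear s : linear (actV s).
Proof. by move=> c p q; rewrite /actV !linearP. Qed.
HB.instance Definition _ s := GRing.isLinear.Build C V V _ (actV s) (actV_linear s).

Lemma actVD s p q : actV s (p + q) = actV s p + actV s q. Proof. exact: linearD. Qed.
Lemma actVZ s c p : actV s (c *: p) = c *: actV s p. Proof. exact: linearZ. Qed.

Lemma actVB s p q : actV s (p - q) = actV s p - actV s q. Proof. exact: linearB. Qed.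

Lemma actVE s p : spin s -> actV s p = act_mono s p :> ('rV[R]_m -> Cl).
Proof.
by move=> sS; apply/funext => u; rewrite /act_mono sandwichE.
Qed.

Lemma homo_act k s p : homo k p -> homo k (actV s p).
Proof. by move=> hp; apply/homo_lmul/homo_rotp. Qed.

Lemma orth_sum s i l : spin s ->
  \sum_j (rho1 s i j)%:C * (rho1 s l j)%:C = (i == l)%:R :> C.
Proof.
move=> sS; have /matrixP/(_ i l) := rho1_orthT sS; rewrite !mxE => h.
have -> : (i == l)%:R = (((i == l)%:R : R))%:C by case: (i == l).
rewrite -h rmorph_sum; apply: eq_bigr => j _.
by rewrite [_^T _ _]mxE -rmorphM.
Qed.

(** Families of operators that transform like the coordinates; their contractions
with tuples are equivariant by orthogonality. *)
Definition vector_op (c : 'I_m -> V -> V) := forall s i p, spin s ->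
  c i (actV s p) = \sum_j (rho1 s i j)%:C *: actV s (c j p).

Lemma vector_xop : vector_op (@xop R m).
Proof.
move=> s i p sS; rewrite -lmulX -/(lmul _ _).
under eq_bigr do rewrite /actV rotp_x linear_sum scaler_sumr.
rewrite exchange_big /=.
transitivity (\sum_l (i == l)%:R *: lmul (complexify s) (xop l (rotp (rho1 s) p))).
  by rewrite sum_delta.
apply: eq_bigr => l _; rewrite -(orth_sum i l sS) scaler_suml.
by apply: eq_bigr => j _; rewrite linearZ /= scalerA.
Qed.

Lemma vector_dop : vector_op (@dop R m).
Proof.
move=> s i p sS; rewrite dop_lmul d_rotp linear_sum /=.
by apply: eq_bigr => j _; rewrite linearZ.
Qed.

Lemma spin_gen s j : spin s -> s * gen j = \sum_i rho1 s i j *: (gen i * s).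
Proof.
move=> sS; rewrite -[LHS]mulr1 -(spin_rev_mul sS) mulrA rho1_gen // mulr_suml.
by apply: eq_bigr => i _; rewrite scalerAl.
Qed.

Lemma vector_eop : vector_op (@eop R m).
Proof.
move=> s i p sS; apply: cl_poly_eq => u; rewrite sumVE eopE !lmulE mulrA.
transitivity (\sum_j (rho1 s i j)%:C *: (complexify s * gen j * p (u *m rho1 s))); last first.
  by apply: eq_bigr => j _; rewrite cl_polyZE lmulE rotpE eopE mulrA.
rewrite -complexify_gen -complexifyM.
under eq_bigr do rewrite -complexify_gen -complexifyM spin_gen // scalerAl -complexifyZ.
rewrite -mulr_suml; congr (_ * _).
transitivity (complexify (\sum_j rho1 s i j *: \sum_l rho1 s l j *: (gen l * s))).
  congr complexify; under eq_bigr do rewrite scaler_sumr.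
  rewrite exchange_big /= (bigD1 i) //= [X in _ = _ + X]big1 => [|l nl].
    rewrite addr0 -[LHS]scale1r; under eq_bigr do rewrite scalerA.
    rewrite -scaler_suml; congr (_ *: _).
    have /matrixP/(_ i i) := rho1_orthT sS; rewrite !mxE eqxx => h; rewrite -[LHS]h.
    by apply: eq_bigr => j _; rewrite [_^T _ _]mxE.
  under eq_bigr do rewrite scalerA.
  rewrite -scaler_suml -[RHS](scale0r (gen l * s)); congr (_ *: _).
  have /matrixP/(_ i l) := rho1_orthT sS; rewrite !mxE eq_sym (negPf nl) => h.
  rewrite -[RHS]h.
  by apply: eq_bigr => j _; rewrite [_^T _ _]mxE.
elim/big_rec2: _ => [|j y x _ <-]; first exact: complexify0.
by rewrite complexifyD.
Qed.

Definition actT s F i : V := \sum_j (rho1 s i j)%:C *: actV s (F j).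

Lemma actTP s c F G i :
  actT s (fun j => c *: F j + G j) i = c *: actT s F i + actT s G i.
Proof.
rewrite /actT scaler_sumr -big_sumD; apply: eq_bigr => j _.
by rewrite actVD actVZ; lin_solve (R[i]) ltac:(ring).
Qed.

Lemma eq_actT s F G : F =1 G -> actT s F =1 actT s G.
Proof. by move=> h i; apply: eq_bigr => j _; rewrite h. Qed.

Lemma vector_contraction (c : 'I_m -> {linear V -> V}) s F : spin s ->
  vector_op (fun i => c i) ->
  \sum_i c i (actT s F i) = actV s (\sum_i c i (F i)).
Proof.
move=> sS vc; rewrite linear_sum /=.
transitivity (\sum_i \sum_l \sum_j
   ((rho1 s i j)%:C * (rho1 s i l)%:C) *: actV s (c l (F j))).
  apply: eq_bigr => i _; rewrite linear_sum exchange_big /=; apply: eq_bigr => j _.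
  rewrite linearZ /= vc // scaler_sumr; apply: eq_bigr => l _.
  by rewrite scalerA.
have orth j l : \sum_i (rho1 s i j)%:C * (rho1 s i l)%:C = (j == l)%:R :> C.
  have := orth_sum j l (spin_reversion sS); rewrite rho1_reversion // => <-.
  by apply: eq_bigr => i _; rewrite ![_^T _ _]mxE.
rewrite exchange_big; apply: eq_bigr => l _ /=.
rewrite exchange_big /= -(sum_delta l (fun j => actV s (c l (F j)))).
by apply: eq_bigr => j _; rewrite -orth scaler_suml; apply: eq_bigr => i _; rewrite mulrC.
Qed.

Lemma cone_act s F : spin s -> cone (actT s F) = actV s (cone F).
Proof.
by move=> sS; apply: (@vector_contraction (fun i => eop i)) => //; exact: vector_eop.
Qed.

Lemma conx_act s F : spin s -> conx (actT s F) = actV s (conx F).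
Proof.
by move=> sS; apply: (@vector_contraction (fun i => xop i)) => //; exact: vector_xop.
Qed.

Lemma cond_act s F : spin s -> cond (actT s F) = actV s (cond F).
Proof.
by move=> sS; apply: (@vector_contraction (fun i => dop i)) => //; exact: vector_dop.
Qed.

Lemma Dir_act s p : spin s -> Dir (actV s p) = actV s (Dir p).
Proof.
move=> sS; rewrite /Dir -cone_act //; apply: eq_cone => i.
by rewrite vector_dop.
Qed.

Lemma umul_act s p : spin s -> umul (actV s p) = actV s (umul p).
Proof.
move=> sS; rewrite /umul -cone_act //; apply: eq_cone => i.
by rewrite vector_xop.
Qed.

Lemma e_act s i p : spin s -> eop i (actV s p) = actT s (fun j => eop j p) i.
Proof. by move=> sS; rewrite vector_eop. Qed.
Lemma x_act s i p : spin s -> xop i (actV s p) = actT s (fun j => xop j p) i.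
Proof. by move=> sS; rewrite vector_xop. Qed.
Lemma d_act s i p : spin s -> dop i (actV s p) = actT s (fun j => dop j p) i.
Proof. by move=> sS; rewrite vector_dop. Qed.

Lemma umul_actT s F i : spin s -> umul (actT s F i) = actT s (fun j => umul (F j)) i.
Proof.
move=> sS; rewrite /actT linear_sum; apply: eq_bigr => j _ /=.
by rewrite opE umul_act.
Qed.

Section Components.
Variable k : nat.

Lemma iota1_act s p i : spin s ->
  iota1 k (actV s p) i = actT s (iota1 k p) i.
Proof.
move=> sS; rewrite /iota1 e_act // d_act // umul_actT //.
rewrite [RHS](@eq_actT s _ (fun j => (- (2%:R / (m%:R + 2%:R * k%:R : C))) *: umul (dop j p) + eop j p)).
  by rewrite actTP; lin_solve (R[i]) ltac:(ring).
by move=> j; lin_solve (R[i]) ltac:(ring).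
Qed.

Lemma iota2_act s q i : spin s ->
  iota2 k (actV s q) i = actT s (iota2 k q) i.
Proof.
move=> sS; rewrite /iota2 x_act // e_act // d_act // !umul_actT //.
set n := (m%:R + 2%:R * k%:R : C).
rewrite [RHS](@eq_actT s _ (fun j => n^-1 *: umul (eop j q) +
    (n^-1 *: umul (umul (dop j q)) + xop j q))).
  by rewrite !actTP; lin_solve (R[i]) ltac:(ring).
by move=> j; lin_solve (R[i]) ltac:(ring).
Qed.

Lemma monoT_act s F : spin s -> monoT k (actT s F) = actV s (monoT k F).
Proof.
by move=> sS; rewrite /monoT actVB actVZ cone_act // cond_act // umul_act.
Qed.

Lemma comp1_act s F : spin s -> comp1 k (actT s F) = actV s (comp1 k F).
Proof. by move=> sS; rewrite /comp1 monoT_act // actVZ. Qed.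

Lemma comp2_act s F : spin s -> comp2 k (actT s F) = actV s (comp2 k F).
Proof. by move=> sS; rewrite /comp2 cond_act // actVZ. Qed.

Lemma rest_act s F i : spin s -> rest k (actT s F) i = actT s (rest k F) i.
Proof.
move=> sS; rewrite /rest comp1_act // comp2_act // iota1_act // iota2_act //.
rewrite [RHS](@eq_actT s _ (fun j => -1 *: iota1 k (comp1 k F) j +
   (-1 *: iota2 k (comp2 k F) j + F j))).
  by rewrite !actTP; lin_solve (R[i]) ltac:(ring).
by move=> j; rewrite /rest; lin_solve (R[i]) ltac:(ring).
Qed.

Lemma comp3_act s F : spin s -> comp3 k (actT s F) = actV s (comp3 k F).
Proof.
move=> sS; rewrite /comp3 actVZ; congr (_ *: _).
rewrite -conx_act //; apply: eq_conx => i; exact: rest_act.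
Qed.

Lemma comp4_act s F i : spin s -> comp4 k (actT s F) i = actT s (comp4 k F) i.
Proof.
move=> sS; rewrite /comp4 comp3_act // rest_act // d_act //.
rewrite [RHS](@eq_actT s _ (fun j => -1 *: dop j (comp3 k F) + rest k F j)).
  by rewrite !actTP; lin_solve (R[i]) ltac:(ring).
by move=> j; rewrite /comp4; lin_solve (R[i]) ltac:(ring).
Qed.

End Components.
End SpinAction.

(** * From the spin group to its Lie algebra *)
Section PolynomialFamilies.
Variables (R : realType).
Local Notation C := R[i].

(** Polynomial functions of a real parameter with values in an arbitrary module,
remembering the two lowest coefficients: the derivative at 0 is read off the
linear one. *)
Definition poly_family (W : lmodType C) (d : nat) (phi : R -> W) (y0 y1 : W) :=
  exists q : nat -> W, [/\ q 0%N = y0, q 1%N = y1, forall j, (d < j)%N -> q j = 0 &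
    forall r, phi r = \sum_(j < d.+1) (r ^+ j)%:C *: q j].

Section Closure.
Variable W : lmodType C.
Implicit Types (phi psi : R -> W).

Lemma poly_family_widen d d' phi y0 y1 : (d <= d')%N ->
  poly_family d phi y0 y1 -> poly_family d' phi y0 y1.
Proof.
move=> dd' [q [q0 q1 qd qE]]; exists q; split => // [j jd|r].
  by apply: qd; apply: leq_ltn_trans jd.
rewrite qE (big_ord_widen d'.+1 (fun j => (r ^+ j)%:C *: q j)) //.
rewrite big_mkcond; apply: eq_bigr => j _; case: ifP => // /negbT.
by rewrite -leqNgt => jd; rewrite qd // scaler0.
Qed.

Lemma poly_family_cst d (y : W) : poly_family d (fun=> y) y 0.
Proof.
exists (fun j => if j is 0 then y else 0); split => // [[]//|r].
rewrite big_ord_recl expr0 scale1r big1 ?addr0 // => j _.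
by rewrite scaler0.
Qed.

Lemma poly_familyP d c phi psi y0 y1 z0 z1 :
  poly_family d phi y0 y1 -> poly_family d psi z0 z1 ->
  poly_family d (fun r => c *: phi r + psi r) (c *: y0 + z0) (c *: y1 + z1).
Proof.
move=> [q [q0 q1 qd qE]] [s [s0 s1 sd sE]].
exists (fun j => c *: q j + s j); split.
- by rewrite q0 s0.
- by rewrite q1 s1.
- by move=> j jd; rewrite qd // sd // scaler0 addr0.
move=> r.
rewrite qE sE scaler_sumr -big_sumD; apply: eq_bigr => j _.
by rewrite scalerDr !scalerA mulrC.
Qed.

Lemma poly_family0 d : poly_family d (fun=> 0 : W) 0 0.
Proof. exact: poly_family_cst. Qed.

Lemma poly_family_ext d phi psi y0 y1 : phi =1 psi ->
  poly_family d phi y0 y1 -> poly_family d psi y0 y1.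
Proof. by move=> /funext ->. Qed.

Lemma poly_familyD d phi psi y0 y1 z0 z1 :
  poly_family d phi y0 y1 -> poly_family d psi z0 z1 ->
  poly_family d (fun r => phi r + psi r) (y0 + z0) (y1 + z1).
Proof.
move=> h1 h2; have := poly_familyP 1 h1 h2; rewrite !scale1r.
by apply: poly_family_ext => r; rewrite scale1r.
Qed.

Lemma poly_familyZ d c phi y0 y1 : poly_family d phi y0 y1 ->
  poly_family d (fun r => c *: phi r) (c *: y0) (c *: y1).
Proof.
move=> h1; have := poly_familyP c h1 (poly_family0 d); rewrite !addr0.
by apply: poly_family_ext => r; rewrite addr0.
Qed.

Lemma poly_family_sum d n (phi : 'I_n -> R -> W) y0 y1 :
  (forall i, poly_family d (phi i) (y0 i) (y1 i)) ->
  poly_family d (fun r => \sum_i phi i r) (\sum_i y0 i) (\sum_i y1 i).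
Proof.
move=> h; elim: (index_enum _) => [|i s IH].
  rewrite !big_nil; apply: poly_family_ext (poly_family0 d) => r.
  by rewrite big_nil.
rewrite !big_cons; apply: poly_family_ext (poly_familyD (h i) IH) => r.
by rewrite big_cons.
Qed.

Lemma poly_family_mul d phi y0 y1 : poly_family d phi y0 y1 ->
  poly_family d.+1 (fun r => r%:C *: phi r) 0 y0.
Proof.
move=> [q [q0 q1 qd qE]]; exists (fun j => if j is j'.+1 then q j' else 0).
split => // [[//|j]|r]; first by rewrite ltnS; exact: qd.
rewrite big_ord_recl scaler0 add0r qE scaler_sumr; apply: eq_bigr => j _.
by rewrite scalerA -rmorphM exprS.
Qed.

Lemma poly_family_quad d (c0 c1 c2 : C) phi y0 y1 : poly_family d phi y0 y1 ->
  poly_family d.+2 (fun r => (c0 + c1 * r%:C + c2 * (r ^+ 2)%:C) *: phi r)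
    (c0 *: y0) (c0 *: y1 + c1 *: y0).
Proof.
move=> h; have h1 := poly_family_mul h; have h2 := poly_family_mul h1.
have w1 := poly_family_widen (leqnSn _) h1.
have w0 := poly_family_widen (leqW (leqnSn _)) h.
have := poly_familyP c0 w0 (poly_familyP c1 w1 (poly_familyZ c2 h2)).
rewrite !scaler0 !addr0; apply: poly_family_ext => r.
by rewrite expr2 rmorphM; lin_solve (R[i]) ltac:(ring).
Qed.

Lemma poly_family_opp d phi y0 y1 : poly_family d phi y0 y1 ->
  poly_family d (fun r => phi (- r)) y0 (- y1).
Proof.
move=> [q [q0 q1 qd qE]]; exists (fun j => (-1) ^+ j *: q j); split.
- by rewrite expr0 scale1r.
- by rewrite expr1 scaleN1r q1.
- by move=> j jd; rewrite qd // scaler0.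
move=> r; rewrite qE; apply: eq_bigr => j _.
by rewrite scalerA [(- r) ^+ j]exprNn rmorphM mulrC !rmorphXn rmorphN1.
Qed.

End Closure.

Lemma poly_family_lin (W W' : lmodType C) (f : {linear W -> W'}) d phi y0 y1 :
  poly_family d phi y0 y1 ->
  poly_family d (fun r => f (phi r)) (f y0) (f y1).
Proof.
move=> [q [q0 q1 qd qE]]; exists (fun j => f (q j)); split; rewrite ?q0 ?q1 //.
  by move=> j jd; rewrite qd // linear0.
move=> r; rewrite qE linear_sum; apply: eq_bigr => j _ /=.
by rewrite linearZ.
Qed.

(** Invert the Vandermonde matrix of the points 0, 1, ..., d. *)
Lemma poly_family_extract d : exists w : 'I_d.+1 -> R,
  forall (W : lmodType C) (phi : R -> W) y0 y1, poly_family d phi y0 y1 -> (0 < d)%N ->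
  y1 = \sum_l (w l)%:C *: phi l%:R.
Proof.
pose nodes : 'rV[R]_d.+1 := \row_l (l : nat)%:R.
pose A := Vandermonde d.+1 nodes.
have uA : A \in unitmx.
  rewrite unitmxE unitfE det_Vandermonde; apply/prodf_neq0 => i _.
  apply/prodf_neq0 => j ij; rewrite !mxE subr_eq0 eqr_nat.
  by rewrite gtn_eqF.
exists (fun l => (invmx A *m (\col_j (j == 1%N :> nat)%:R)) l 0).
move=> W phi y0 y1 [q [q0 q1 qd qE]] d0.
set w := _ *m _.
have wE (j : 'I_d.+1) : \sum_l nodes 0 l ^+ j * w l 0 = (j == 1%N :> nat)%:R.
  have : (A *m w) j 0 = (j == 1%N :> nat)%:R by rewrite mulKVmx // mxE.
  by rewrite mxE => <-; apply: eq_bigr => l _; rewrite [A _ _]mxE.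
transitivity (\sum_(j < d.+1) (\sum_l nodes 0 l ^+ j * w l 0)%:C *: q j).
  have d1 : (1 < d.+1)%N by [].
  rewrite (bigD1 (Ordinal d1)) // (wE (Ordinal d1)) eqxx scale1r.
  rewrite [q _]q1 big1 /= ?addr0 // => j nj.
  rewrite wE; have -> : (j == 1%N :> nat) = false by apply/negbTE.
  by rewrite scale0r.
under eq_bigr do rewrite rmorph_sum scaler_suml.
rewrite exchange_big; apply: eq_bigr => l _ /=.
rewrite qE scaler_sumr; apply: eq_bigr => j _.
by rewrite scalerA -rmorphM mulrC [nodes _ _]mxE.
Qed.

End PolynomialFamilies.

Section SpinGenerators.
Variables (R : realType) (m : nat).
Local Notation C := R[i].
Local Notation V := (cl_poly R m).
Implicit Types (p q : V) (a b i j : 'I_m) (F G : 'I_m -> V) (r : R).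

Definition hyp r : R := Num.sqrt (1 + r ^+ 2).

Lemma hyp_sq r : hyp r ^+ 2 = 1 + r ^+ 2.
Proof. by rewrite sqr_sqrtr // addr_ge0 // sqr_ge0. Qed.

Lemma hyp_neq0 r : hyp r != 0.
Proof.
by rewrite -sqrf_eq0 hyp_sq gt_eqF // ltr_pwDl ?ltr01 ?sqr_ge0.
Qed.

(** The rational parametrization of the rotations of a plane, proportional to
1 + r e_a e_b. *)
Definition rat_rotor a b r := rotor a b (hyp r)^-1 (r / hyp r).

Lemma rat_rotor_spin a b r : a != b -> spin (rat_rotor a b r).
Proof.
move=> ab; apply: rotor_spin => //.
rewrite exprMn exprVn hyp_sq.
have h : 1 + r ^+ 2 != 0 by rewrite -hyp_sq sqrf_eq0 hyp_neq0.
by field.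
Qed.

Lemma rat_rotorN a b r : a != b -> rat_rotor a b (- r) = reversion (rat_rotor a b r).
Proof.
by move=> ab; rewrite reversion_rotor // /rat_rotor /hyp sqrrN mulNr.
Qed.

Lemma rotp_scale k (c : R) (M : 'M[R]_m) p : homo k p ->
  rotp (c *: M) p = (c ^+ k)%:C *: rotp M p.
Proof.
elim: k p => [|k IH] p.
  by move=> [d ->]; rewrite expr0 scale1r; apply: cl_poly_eq.
move=> [F hF ->]; rewrite /conx !linear_sum /=; apply: eq_bigr => i _.
rewrite !rotp_x scaler_sumr; apply: eq_bigr => j _; rewrite (IH _ (hF i)).
by rewrite mxE opE exprS !rmorphM; lin_solve (R[i]) ltac:(ring).
Qed.

(** The rotation matrix cleared of denominators, hence polynomial in r. *)
Definition rat_mx a b r : 'M[R]_m := (hyp r ^+ 2) *: rho1 (rat_rotor a b r).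

Lemma rat_mxE a b r i j : a != b -> (rat_mx a b r i j)%:C =
  ((i == j)%:R +
   (2%:R * ((j == a)%:R * (i == b)%:R - (j == b)%:R * (i == a)%:R)) * r%:C +
   (if (j == a) || (j == b) then - 1 else 1) * (i == j)%:R * (r ^+ 2)%:C).
Proof.
move=> ab; rewrite mxE rho1_rotor //.
have h := hyp_neq0 r; have hh := hyp_sq r.
have natC (c : bool) : (c%:R : C) = (c%:R : R)%:C by case: c.
have twoC : (2%:R : C) = (2%:R : R)%:C by rewrite rmorph_nat.
rewrite !natC twoC.
have [ja|nja] := eqVneq j a.
  rewrite ja (negPf ab) /= mul0r subr0 mul1r.
  rewrite -(rmorphN1 (real_complex R)) -!(rmorphM (real_complex R)) -!(rmorphD (real_complex R)).
  by congr (_%:C); field.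
have [jb|njb] := eqVneq j b.
  rewrite jb /= mul0r mul1r sub0r.
  rewrite -(rmorphN1 (real_complex R)) -!(rmorphN (real_complex R)) -!(rmorphM (real_complex R)) -!(rmorphD (real_complex R)).
  by congr (_%:C); field.
rewrite /= !mul0r subr0 mulr0 mul0r addr0 mul1r.
rewrite -!(rmorphM (real_complex R)) -!(rmorphD (real_complex R)); congr (_%:C).
by field.
Qed.

Lemma rot_family k a b p : a != b -> homo k p ->
  poly_family k.*2 (fun r => rotp (rat_mx a b r) p) p
    (2%:R *: (xop b (dop a p) - xop a (dop b p))).
Proof.
move=> ab; elim: k p => [|k IH] p.
  move=> hp; rewrite !(homo0_d _ hp) !opE subr0 scaler0.
  apply: poly_family_ext (poly_family_cst 0 p) => r.
  by move: hp => [c ->]; apply: cl_poly_eq.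
move=> [F hF ->].
pose c1 i j : C := 2%:R * ((i == a)%:R * (j == b)%:R - (i == b)%:R * (j == a)%:R).
have h i j : poly_family k.+1.*2
    (fun r => (rat_mx a b r j i)%:C *: xop j (rotp (rat_mx a b r) (F i)))
    ((j == i)%:R *: xop j (F i))
    ((j == i)%:R *: xop j (2%:R *: (xop b (dop a (F i)) - xop a (dop b (F i)))) +
     c1 i j *: xop j (F i)).
  have := poly_family_quad ((j == i)%:R) (c1 i j)
    ((if (i == a) || (i == b) then - 1 else 1) * (j == i)%:R)
    (poly_family_lin (xop j) (IH _ (hF i))).
  by apply: poly_family_ext => r; rewrite rat_mxE.
have := poly_family_sum (fun i => poly_family_sum (h i)).
have -> : \sum_i \sum_j (j == i)%:R *: xop j (F i) = conx F.
  apply: eq_bigr => i _; rewrite -[RHS](sum_delta i (fun j => xop j (F i))).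
  by apply: eq_bigr => j _; rewrite eq_sym.
have -> : \sum_i \sum_j ((j == i)%:R *: xop j (2%:R *: (xop b (dop a (F i)) -
    xop a (dop b (F i)))) + c1 i j *: xop j (F i)) =
    2%:R *: (xop b (dop a (conx F)) - xop a (dop b (conx F))).
  have xd_sum x y : xop x (dop y (conx F)) = \sum_i xop x (dop y (xop i (F i))).
    by rewrite /conx !linear_sum.
  rewrite (xd_sum b a) (xd_sum a b) -big_sumB scaler_sumr; apply: eq_bigr => i _.
  rewrite big_sumD /=.
  have delta (z : V) : \sum_j (j == i)%:R *: xop j z = xop i z.
    rewrite -[RHS](sum_delta i (fun j => xop j z)).
    by apply: eq_bigr => j _; rewrite eq_sym.
  rewrite delta.
  have -> : \sum_j c1 i j *: xop j (F i) = 2%:R *: ((i == a)%:R *: xop b (F i) -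
      (i == b)%:R *: xop a (F i)).
    rewrite -(sum_delta b (fun j => (i == a)%:R *: xop j (F i))).
    rewrite -(sum_delta a (fun j => (i == b)%:R *: xop j (F i))) -big_sumB scaler_sumr.
    apply: eq_bigr => j _; rewrite /c1 [b == j]eq_sym [a == j]eq_sym.
    by lin_solve (R[i]) ltac:(ring).
  rewrite !dx !opE (xxC i b) (xxC i a) [a == i]eq_sym [b == i]eq_sym.
  by lin_solve (R[i]) ltac:(ring).
apply: poly_family_ext => r.
by rewrite /conx linear_sum; apply: eq_bigr => i _ /=; rewrite rotp_x.
Qed.

Lemma complexify_rat_rotor a b r :
  (hyp r)%:C *: complexify (rat_rotor a b r) =
  1 + r%:C *: (gen a * gen b) :> clifford C m.
Proof.
have e1 : (hyp r)%:C * ((hyp r)^-1)%:C = 1 :> C.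
  by rewrite -(rmorphM (real_complex R)) mulfV ?hyp_neq0 // rmorph1.
have e2 : (hyp r)%:C * (r / hyp r)%:C = r%:C :> C.
  by rewrite -(rmorphM (real_complex R)) mulrCA mulfV ?hyp_neq0 // mulr1.
rewrite complexifyD !complexifyZ complexify1 complexifyM !complexify_gen scalerDr.
by rewrite !scalerA e1 e2 scale1r.
Qed.

Lemma act_rat_rotor k a b r p : homo k p ->
  (hyp r ^+ k.*2.+1)%:C *: actV (rat_rotor a b r) p =
  rotp (rat_mx a b r) p + r%:C *: eop a (eop b (rotp (rat_mx a b r) p)).
Proof.
move=> hp; rewrite /rat_mx (rotp_scale _ _ hp) -exprM mul2n.
have -> : (hyp r ^+ k.*2.+1)%:C = (hyp r ^+ k.*2)%:C * (hyp r)%:C :> C.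
  by rewrite exprSr rmorphM.
move: ((hyp r ^+ k.*2)%:C) => c; rewrite !opE /actV.
have lmulZ (d : C) x q : d *: lmul x q = lmul (d *: x) q.
  by apply: cl_poly_eq => u; rewrite cl_polyZE !lmulE scalerAl.
rewrite -scalerA lmulZ complexify_rat_rotor.
move: (rotp _ p) => q; apply: cl_poly_eq => u.
rewrite cl_polyDE !cl_polyZE !lmulE mulrDl mul1r scalerDr -scalerAl mulrA.
by rewrite [in RHS]scalerA [r%:C * c]mulrC -[in RHS]scalerA.
Qed.

Lemma act_family k a b p : a != b -> homo k p ->
  poly_family k.*2.+1 (fun r => (hyp r ^+ k.*2.+1)%:C *: actV (rat_rotor a b r) p)
    p (2%:R *: Xop a b p).
Proof.
move=> ab hp; have h := rot_family ab hp.
have h1 := poly_family_mul (poly_family_lin (eop a) (poly_family_lin (eop b) h)).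
have h0 := poly_family_widen (leqnSn _) h.
have := poly_familyD h0 h1; rewrite addr0.
have -> : 2%:R *: (xop b (dop a p) - xop a (dop b p)) + eop a (eop b p) =
    2%:R *: Xop a b p.
  by rewrite /Xop (negPf ab) scale0r; lin_solve (R[i]) ltac:(field).
by apply: poly_family_ext => r; rewrite (act_rat_rotor _ _ _ hp).
Qed.

Lemma act_family2 k a b p : a != b -> homo k p ->
  poly_family k.*2.+3 (fun r => (hyp r ^+ k.*2.+3)%:C *: actV (rat_rotor a b r) p)
    p (2%:R *: Xop a b p).
Proof.
move=> ab hp; have := poly_family_quad 1 0 1 (act_family ab hp).
rewrite !scale1r scale0r addr0; apply: poly_family_ext => r.
rewrite scalerA mul0r addr0 mul1r; congr (_ *: _).
have -> : 1 + (r ^+ 2)%:C = (hyp r ^+ 2)%:C :> C by rewrite hyp_sq [RHS]rmorphD rmorph1.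
by rewrite -(rmorphM (real_complex R)) -exprD.
Qed.

Lemma actT_family k a b F i : a != b -> (forall j, homo k (F j)) ->
  poly_family k.*2.+3 (fun r => (hyp r ^+ k.*2.+3)%:C *: actT (rat_rotor a b r) F i)
    (F i) (2%:R *: XT a b F i).
Proof.
move=> ab hF.
pose c1 j : C := 2%:R * ((j == a)%:R * (i == b)%:R - (j == b)%:R * (i == a)%:R).
have h j := poly_family_quad ((i == j)%:R) (c1 j)
    ((if (j == a) || (j == b) then - 1 else 1) * (i == j)%:R)
    (act_family ab (hF j)).
have := poly_family_sum h.
rewrite sum_delta big_sumD sum_delta.
have -> : 2%:R *: Xop a b (F i) + \sum_j c1 j *: F j = 2%:R *: XT a b F i.
  rewrite /XT -(sum_delta a (fun j => (i == b)%:R *: F j)).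
  rewrite -(sum_delta b (fun j => (i == a)%:R *: F j)) -addrA -big_sumB [RHS]scalerDr.
  congr (_ + _); rewrite scaler_sumr; apply: eq_bigr => j _.
  rewrite /c1 [a == j]eq_sym [b == j]eq_sym.
  by lin_solve (R[i]) ltac:(ring).
apply: poly_family_ext => r; rewrite /actT scaler_sumr; apply: eq_bigr => j _.
rewrite -rat_mxE // mxE !scalerA; congr (_ *: _).
rewrite -!(rmorphM (real_complex R)); congr (_%:C).
by rewrite mulrAC -exprD.
Qed.

(** Up to a power of the square root of 1 + r^2 the action of rat_rotor a b r is polynomial in r,
so its linear coefficient is a combination of finitely many values. The weights
are the same for polynomials and for tuples, and with the opposite sign for the
inverse elements; both facts are needed, the former to compare representations
and the latter to see that the generators are skew. *)
Lemma spin_generators k a b : exists n (w : 'I_n -> R) (g : 'I_n -> clifford R m),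
  [/\ forall l, spin (g l),
      forall p, homo k p -> Xop a b p = \sum_l (w l)%:C *: actV (g l) p,
      forall p, homo k p ->
        Xop a b p = - \sum_l (w l)%:C *: actV (reversion (g l)) p &
      forall F i, (forall j, homo k (F j)) ->
        XT a b F i = \sum_l (w l)%:C *: actT (g l) F i].
Proof.
have [ab|ab] := eqVneq a b.
  exists 0%N, (fun=> 0), (fun=> 0); split => [[]//|p _|p _|F i _]; rewrite big_ord0.
  - by rewrite ab Xop_same.
  - by rewrite ab Xop_same oppr0.
  - by rewrite /XT ab Xop_same add0r subrr.
have [w wE] := poly_family_extract R k.*2.+3.
exists k.*2.+4, (fun l => 2^-1 * w l * hyp l%:R ^+ k.*2.+3), (fun l => rat_rotor a b l%:R).
have two : (2%:R : C) != 0 by rewrite pnatr_eq0.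
have half (l : R) (v : V) (x : R) : (2^-1 * l * x)%:C *: v = 2^-1 *: (l%:C *: (x%:C *: v)).
  by rewrite !scalerA !rmorphM fmorphV rmorph_nat !mulrA.
have two' (v w' : V) : 2%:R *: v = w' -> v = 2^-1 *: w'.
  by move=> <-; rewrite scalerA mulVf // scale1r.
split => [l|p hp|p hp|F i hF].
- exact: rat_rotor_spin.
- rewrite [LHS](two' _ _ (wE _ _ _ _ (act_family2 ab hp) isT)) scaler_sumr.
  by apply: eq_bigr => l _; rewrite half.
- have := wE _ _ _ _ (poly_family_opp (act_family2 ab hp)) isT.
  move/(congr1 -%R); rewrite opprK => /two' ->; rewrite scalerN scaler_sumr.
  congr (- _); apply: eq_bigr => l _.
  by rewrite half rat_rotorN // /hyp sqrrN.
- rewrite [LHS](two' _ _ (wE _ _ _ _ (actT_family i ab hF) isT)) scaler_sumr.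
  by apply: eq_bigr => l _; rewrite half.
Qed.

End SpinGenerators.

(** * Monogenic polynomials with values in a subspace *)
Section Monogenics.
Variables (R : realType) (m : nat).
Local Notation C := R[i].
Local Notation Cl := (clifford C m).
Local Notation V := (cl_poly R m).
Implicit Types (p q : V) (a b i j : 'I_m) (F G : 'I_m -> V) (S L : set Cl)
  (s : clifford R m).

Definition mono S k p : Prop := [/\ homo k p, forall u, S (p u) & Dir p = 0].

(** The even subalgebra is generated by the products of two generators. *)
Definition even_stable L : Prop :=
  @Defs.subspace R Cl L /\ forall a b c, L c -> L (gen a * gen b * c).

Section Subspaces.
Variables (E : lmodType C) (U : set E).
Hypothesis sU : Defs.subspace U.

Lemma sub0 : U 0. Proof. by case: sU. Qed.
Lemma subP c x y : U x -> U y -> U (c *: x + y). Proof. by case: sU => _; apply. Qed.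
Lemma subD x y : U x -> U y -> U (x + y).
Proof. by move=> hx hy; rewrite -[x]scale1r; apply: subP. Qed.
Lemma subZ c x : U x -> U (c *: x).
Proof. by move=> hx; rewrite -[_ *: _]addr0; apply: subP => //; exact: sub0. Qed.
Lemma subN x : U x -> U (- x).
Proof. by move=> hx; rewrite -scaleN1r; apply: subZ. Qed.
Lemma subB x y : U x -> U y -> U (x - y).
Proof. by move=> hx hy; apply: subD => //; apply: subN. Qed.
Lemma sub_sum (I : Type) (r : seq I) (P : pred I) (f : I -> E) :
  (forall l, P l -> U (f l)) -> U (\sum_(l <- r | P l) f l).
Proof. by move=> h; elim/big_rec: _ => [|l x Pl Ux]; [exact: sub0|apply: subD => //; exact: h]. Qed.
Lemma sub_unZ c x : c != 0 -> U (c *: x) -> U x.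
Proof. by move=> c0 /(subZ c^-1); rewrite scalerA mulVf // scale1r. Qed.
End Subspaces.

Lemma left_ideal_subspace S : left_ideal S -> @Defs.subspace R Cl S.
Proof.
move=> [S0 SD SM]; split => // c x y Sx Sy; apply: SD => //.
by rewrite -mulr_algl; apply: SM.
Qed.

Lemma left_ideal_even S : left_ideal S -> even_stable S.
Proof. by move=> h; split; [exact: left_ideal_subspace|case: h => _ _ SM *; exact: SM]. Qed.

Lemma left_idealT : left_ideal [set: Cl]. Proof. by split. Qed.

Section Values.
Variable S : set Cl.
Hypothesis sS : Defs.subspace S.
Definition valued p := forall u, S (p u).

Lemma valued_subspace : @Defs.subspace R V valued.
Proof.
split=> [u|c p q hp hq u]; first exact: sub0 sS.
by rewrite cl_polyDE cl_polyZE; apply: subP.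
Qed.

Lemma valued_x i p : valued p -> valued (xop i p).
Proof. by move=> hp u; rewrite xopE; apply: subZ. Qed.

(** Along a line the values of p form a polynomial family, so the derivative is
a combination of values and stays in any subspace that contains these. *)
Lemma shift_family d p u i : homo d p ->
  poly_family d (fun r => p (u + r *: 'e_i)) (p u) (dop i p u).
Proof.
elim: d p => [|d IH] p.
  move=> hp; rewrite (homo0_d _ hp).
  apply: poly_family_ext (poly_family_cst 0 (p u)) => r.
  by move: hp => [c ->].
move=> [F hF ->]; rewrite /conx sumVE linear_sum sumVE /=.
have h j : poly_family d.+1 (fun r => ((u + r *: 'e_i) 0 j)%:C *: F j (u + r *: 'e_i))
    (xop j (F j) u) (dop i (xop j (F j)) u).
  have w1 := poly_familyZ (i == j)%:R (poly_family_mul (IH _ (hF j))).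
  have w0 := poly_familyZ (u 0 j)%:C (poly_family_widen (leqnSn d) (IH _ (hF j))).
  have e0 : xop j (F j) u = (u 0 j)%:C *: F j u + (i == j)%:R *: 0.
    by rewrite scaler0 addr0.
  have e1 : dop i (xop j (F j)) u =
      (u 0 j)%:C *: dop i (F j) u + (i == j)%:R *: F j u by rewrite dx addrC.
  rewrite e0 e1; apply: poly_family_ext (poly_familyD w0 w1) => r.
  have -> : (u + r *: 'e_i) 0 j = u 0 j + (i == j)%:R * r.
    by rewrite !mxE /= eq_sym mulrC.
  move: (F j _) => X; rewrite (rmorphD (real_complex R)) scalerDl; congr (_ + _).
  by case: (i == j); rewrite ?scale0r ?scale1r ?mul0r ?mul1r ?scale0r.
apply: poly_family_ext (poly_family_sum h) => r.
by rewrite sumVE.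
Qed.

Lemma valued_d k i p : homo k p -> valued p -> valued (dop i p).
Proof.
case: k => [|k] hp vp u; first by rewrite (homo0_d _ hp); exact: sub0.
have [w wE] := poly_family_extract R k.+1.
by rewrite (wE _ _ _ _ (shift_family u i hp) isT); apply: sub_sum => // l _; apply: subZ.
Qed.

Lemma mono_subspace k : @Defs.subspace R V (mono S k).
Proof.
split; first by split; [exact: homo0|exact: sub0 valued_subspace|rewrite opE].
move=> c p q [hp vp Dp] [hq vq Dq]; split; first exact: homoP.
  exact: (subP valued_subspace).
by rewrite !opE Dp Dq scaler0 addr0.
Qed.

Lemma mono_d k i p : mono S k.+1 p -> mono S k (dop i p).
Proof.
move=> [hp vp Dp]; split; [exact: homo_d|exact: valued_d hp vp|].
by rewrite Dir_d Dp opE.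
Qed.

End Values.

Lemma mono_sub S S' k p : S `<=` S' -> mono S k p -> mono S' k p.
Proof. by move=> SS' [hp vp Dp]; split => // u; apply: SS'. Qed.

Lemma mono_Eul S k p : mono S k p -> Eul p = k%:R *: p.
Proof. by move=> [/homo_Eul]. Qed.

Lemma even_stable_spin L s c : even_stable L -> spin s -> L c ->
  L (complexify s * c).
Proof.
move=> [sL eL] [r [er _ ->]] Lc {s}; move: er.
have [n] := ubnP (size r); elim: n r => // n IH [|y [|z r]] //=.
  by rewrite big_nil complexify1 mul1r.
rewrite ltnS negbK => rn er; rewrite !big_cons mulrA !complexifyM -mulrA.
have {IH} := IH r (ltnW rn) er; move: (_ * c) => {Lc}c Lc.
rewrite !complexify_vec mulr_suml mulr_suml; apply: sub_sum => // i _.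
rewrite mulr_sumr mulr_suml; apply: sub_sum => // j _.
rewrite -scalerAl -scalerAr scalerA -scalerAl; apply: subZ => //.
exact: eL.
Qed.

Lemma mono_act L k s p : even_stable L -> spin s -> mono L k p ->
  mono L k (actV s p).
Proof.
move=> eL sS [hp vp Dp]; split; [exact: homo_act| |by rewrite Dir_act // Dp linear0].
move=> u; apply: (even_stable_spin eL sS); exact: vp.
Qed.

Lemma mono_X L k a b p : even_stable L -> mono L k p -> mono L k (Xop a b p).
Proof.
move=> eL hp; have sL := mono_subspace eL.1 k.
have [n [w [g [gS gE _ _]]]] := spin_generators R k a b.
rewrite gE; last by case: hp.
by apply: sub_sum => // l _; apply: subZ => //; apply: mono_act.
Qed.

Lemma mono_iota1 S k p i : (3 <= m)%N -> left_ideal S -> mono S k.+1 p ->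
  mono S k.+1 (iota1 k p i).
Proof.
move=> m3 lS hp; have sS := left_ideal_subspace lS.
have vS := valued_subspace sS; have [_ _ SM] := lS.
split; first by apply: homo_iota1; case: hp.
  apply: (subB vS) => [u|]; first by rewrite eopE; apply: SM; case: hp.
  apply: (subZ vS); apply: (sub_sum vS) => j _ u; rewrite eopE; apply: SM.
  by apply: valued_x => //; case: (mono_d sS i hp).
by apply: Dir_iota1 => //; [case: hp|exact: (mono_Eul hp)].
Qed.

Lemma mono_iota2 L k q i : (3 <= m)%N -> even_stable L -> mono L k q ->
  mono L k.+1 (iota2 k q i).
Proof.
move=> m3 [sL eL] hq; have vL := valued_subspace sL.
have [hhq vq Dq] := hq.
split; first exact: homo_iota2.
  apply: (subD vL); first exact: valued_x.
  apply: (subZ vL); apply: (subD vL).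
    apply: (sub_sum vL) => j _; rewrite ex; apply: valued_x => // u.
    by rewrite !eopE mulrA; apply: eL.
  apply: (sub_sum vL) => j _; rewrite ex; apply: valued_x => //.
  rewrite /umul /cone linear_sum; apply: (sub_sum vL) => l _.
  rewrite -[X in valued _ X]/(eop j (eop l (xop l (dop i q)))) !ex; apply: valued_x => // u.
  rewrite !eopE mulrA; apply: eL.
  exact: (valued_d sL i hhq vq).
by apply: Dir_iota2 => //; exact: mono_Eul hq.
Qed.

Section Components.
Variables (S : set Cl) (k : nat).
Hypotheses (m3 : (3 <= m)%N) (lS : left_ideal S).
Let sS := left_ideal_subspace lS.
Let vS := valued_subspace sS.
Variable F : 'I_m -> V.
Hypothesis hF : forall i, mono S k.+1 (F i).

Let DF i : Dir (F i) = 0. Proof. by case: (hF i). Qed.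
Let EF i : Eul (F i) = k.+1%:R *: F i. Proof. exact: mono_Eul (hF i). Qed.

Lemma mono_condF : mono S k (cond F).
Proof.
split; first by apply: homo_cond => i; case: (hF i).
  by apply: (sub_sum vS) => i _; case: (mono_d sS i (hF i)).
exact: Dir_condF.
Qed.

Lemma mono_monoT : mono S k.+1 (monoT k F).
Proof.
have [_ _ SM] := lS; have [hc vc _] := mono_condF.
split.
- apply: homoD; first by apply: homo_cone => i; case: (hF i).
  by apply/homoN/homoZ/homo_umul.
- apply: (subB vS); first by apply: (sub_sum vS) => i _ u; apply: SM; case: (hF i).
  apply: (subZ vS); apply: (sub_sum vS) => i _ u; apply: SM.
  exact: valued_x.
- exact: Dir_monoT.
Qed.

Lemma mono_comp1 : mono S k.+1 (comp1 k F).
Proof. by apply: (subZ (mono_subspace sS _)); exact: mono_monoT. Qed.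

Lemma mono_comp2 : mono S k (comp2 k F).
Proof. by apply: (subZ (mono_subspace sS _)); exact: mono_condF. Qed.

Lemma mono_rest i : mono S k.+1 (rest k F i).
Proof.
apply: (subB (mono_subspace sS _)); first apply: (subB (mono_subspace sS _)) => //.
  by apply: mono_iota1 => //; exact: mono_comp1.
by apply: mono_iota2 => //; [exact: left_ideal_even|exact: mono_comp2].
Qed.

Lemma mono_comp3 : mono S k.+2 (comp3 k F).
Proof.
split; last exact: Dir_comp3.
  by apply/homoZ/homo_conx => i; case: (mono_rest i).
apply: (subZ vS); apply: (sub_sum vS) => i _; apply: valued_x => //.
by case: (mono_rest i).
Qed.

Lemma mono_comp4 i : mono S k.+1 (comp4 k F i).
Proof.
apply: (subB (mono_subspace sS _)); first exact: mono_rest.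
by apply: mono_d => //; exact: mono_comp3.
Qed.

End Components.

(** * Stable subspaces of monogenics *)

Definition lie_stable (U : set V) : Prop :=
  Defs.subspace U /\ forall a b p, U p -> U (Xop a b p).

Lemma lie_stable_Omega U F : lie_stable U -> (forall i, U (F i)) ->
  forall i, U (Omega F i).
Proof. by move=> [sU XU] hF i; apply: sub_sum => // b _; exact: XU. Qed.

Lemma Xop_cond a b F : Xop a b (cond F) = cond (XT a b F).
Proof.
transitivity (\sum_i (dop i (Xop a b (F i)) + ((a == i)%:R *: dop b (F i) -
   (b == i)%:R *: dop a (F i)))).
  rewrite /cond linear_sum; apply: eq_bigr => i _ /=.
  rewrite d_Xop [a == i]eq_sym [b == i]eq_sym.
  by lin_solve (R[i]) ltac:(ring).
rewrite big_sumD big_sumB !sum_delta.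
transitivity (\sum_i (dop i (Xop a b (F i)) + ((b == i)%:R *: dop i (F a) -
   (a == i)%:R *: dop i (F b)))).
  by rewrite big_sumD big_sumB !sum_delta.
apply: eq_bigr => i _; rewrite /XT !opE [a == i]eq_sym [b == i]eq_sym.
by lin_solve (R[i]) ltac:(ring).
Qed.

(** The operator (Omega - l1) (Omega - l3) (Omega - l4) preserves U and kills
every component of F except the second one, which cond F determines. *)
Lemma lie_stable_iota2 (U : set V) k F : (3 <= m)%N -> lie_stable U ->
  U `<=` mono setT k.+1 -> (forall i, U (F i)) ->
  forall i, U (iota2 k (cond F) i).
Proof.
move=> m3 sU Um hF i; have [n0 n2 m2 c2] := dim_neq0 R k m3.
have hm j : mono setT k.+1 (F j) by exact: Um.
have DF j : Dir (F j) = 0 by case: (hm j).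
have EF j : Eul (F j) = k.+1%:R *: F j by exact: (mono_Eul (hm j)).
pose M : C := m%:R; pose J : C := k%:R.
pose I1 := iota1 k (comp1 k F); pose I2 := iota2 k (comp2 k F).
pose I3 j := dop j (comp3 k F); pose I4 := comp4 k F.
pose l1 : C := - ((M - 1) / 2); pose l2 : C := - (M + J - 2^-1).
pose l3 : C := J + 3%:R / 2; pose l4 : C := - 2^-1.
have O1 j : Omega I1 j = l1 *: I1 j.
  exact: (Omega_iota1 m3 (Dir_comp1 m3 DF EF) (Eul_comp1 EF)).
have O2 j : Omega I2 j = l2 *: I2 j.
  exact: (Omega_iota2 m3 (Dir_comp2 k DF) (Eul_comp2 EF)).
have O3 j : Omega I3 j = l3 *: I3 j.
  exact: (Omega_grad j (Dir_comp3 m3 DF EF) (Eul_comp3 EF)).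
have O4 j : Omega I4 j = l4 *: I4 j.
  by rewrite (Omega_simplicial j (cone_comp4 m3 DF EF) (cond_comp4 m3 DF EF) (conx_comp4 EF)).
(* The tuple (Omega - l) F, in terms of the coefficients of F. *)
have step (c1 c2' c3 c4 l : C) :
    (forall j, U (c1 *: I1 j + (c2' *: I2 j + (c3 *: I3 j + c4 *: I4 j)))) ->
    forall j, U (((l1 - l) * c1) *: I1 j + (((l2 - l) * c2') *: I2 j +
      (((l3 - l) * c3) *: I3 j + ((l4 - l) * c4) *: I4 j))).
  move=> h j; have := lie_stable_Omega sU h j.
  have -> : Omega (fun j => c1 *: I1 j + (c2' *: I2 j + (c3 *: I3 j + c4 *: I4 j))) j =
      (c1 * l1) *: I1 j + ((c2' * l2) *: I2 j + ((c3 * l3) *: I3 j + (c4 * l4) *: I4 j)).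
    rewrite OmegaP OmegaP.
    have -> : Omega (fun j => c3 *: I3 j + c4 *: I4 j) j =
        c3 *: Omega I3 j + c4 *: Omega I4 j.
      have -> : c4 *: Omega I4 j = Omega (fun j => c4 *: I4 j) j.
        rewrite /Omega scaler_sumr; apply: eq_bigr => b _.
        by rewrite XopZ.
      by rewrite OmegaP.
    by rewrite O1 O2 O3 O4; lin_solve (R[i]) ltac:(ring).
  move=> h'; have := subB sU.1 h' (subZ sU.1 l (h j)).
  set x := _ - _; set y := _ + _; suff -> : x = y by [].
  by rewrite /x /y; lin_solve (R[i]) ltac:(ring).
have h0 j : U (1 *: I1 j + (1 *: I2 j + (1 *: I3 j + 1 *: I4 j))).
  have := hF j; rewrite (decompE k F j) -/(I1 j) -/(I2 j) -/(I3 j) -/(I4 j).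
  by rewrite !scale1r !addrA.
have := step _ _ _ _ l1 (step _ _ _ _ l3 (step _ _ _ _ l4 h0)) i.
rewrite !subrr !(mul0r, mulr0, scale0r, addr0, add0r).
move/(sub_unZ sU.1) => h.
have {}h : U (I2 i).
  apply: h; rewrite mulr1 !mulf_neq0 //.
  - have -> : l2 - l1 = - (m%:R + 2 * k%:R) / 2 by rewrite /l1 /l2 /M /J; field.
    by rewrite mulf_neq0 ?oppr_eq0 ?invr_neq0 ?two_neq0.
  - have -> : l2 - l3 = - (m + k.*2.+1)%:R.
      by rewrite natrD -natr1 -mul2n natrM /l2 /l3 /M /J; field.
    by rewrite oppr_eq0 pnatr_eq0 addnS.
  - have -> : l2 - l4 = - (m%:R + k%:R - 1) by rewrite /l2 /l4 /M /J; field.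
    by rewrite oppr_eq0.
have -> : iota2 k (cond F) i = (M + J - 1) *: I2 i; last exact: (subZ sU.1).
rewrite /I2 /comp2 -/M -/J.
have e : cond F = (M + J - 1) *: ((M + J - 1)^-1 *: cond F).
  by rewrite scalerA mulfV // scale1r.
rewrite {1}e -[X in iota2 _ X]addr0 iota2P.
have -> : iota2 k (0 : V) i = 0; last by rewrite addr0.
by rewrite /iota2 !opE; lin_solve (R[i]) ltac:(ring).
Qed.

(** Induction on the degree: the derivatives of the elements of U span a stable
subspace, that of the monogenics with values in some L. Conversely U contains
iota2 (cond F) for all tuples F in U, hence every L-valued monogenic p, as the
derivatives of p are such divergences and conx_part_iota2 recovers p. *)
Lemma lie_stable_mono (U : set V) k : (3 <= m)%N -> lie_stable U ->
  U `<=` mono setT k -> exists2 L, even_stable L & U = mono L k.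
Proof.
move=> m3; elim: k U => [|k IH] U sU Um.
  exists [set c | U (cpol c)].
    split; first split.
    - rewrite /= (_ : cpol 0 = 0); first exact: (sub0 sU.1).
      exact: cl_poly_eq.
    - by move=> c x y hx hy; rewrite /= cpolP; apply: (subP sU.1).
    move=> a b c hc /=.
    have -> : cpol (gen a * gen b * c) =
        2%:R *: Xop a b (cpol c) - (a == b)%:R *: cpol c :> V.
      have -> : cpol (gen a * gen b * c) = eop a (eop b (cpol c)) :> V.
        by apply: cl_poly_eq => u; rewrite !eopE mulrA.
      by rewrite Xop_cst; lin_solve (R[i]) ltac:(field).
    apply: (subB sU.1); apply: (subZ sU.1) => //.
    exact: sU.2.
  apply/seteqP; split => p.
    move=> Up; have [hp _ Dp] := Um _ Up; split => // u.
    by move: hp Up => [c ->].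
  by move=> [[c ->] vc _]; exact: (vc 0).
pose dU : set V := [set q | exists2 F, (forall i, U (F i)) & q = cond F].
have sdU : lie_stable dU.
  split; first split.
  - by exists (fun=> 0); [move=> _; exact: (sub0 sU.1)|rewrite cond0].
  - move=> c _ _ [F hF ->] [G hG ->]; exists (fun i => c *: F i + G i).
      by move=> i; apply: (subP sU.1).
    by rewrite condP.
  move=> a b _ [F hF ->]; exists (XT a b F); last exact: Xop_cond.
  move=> i; apply: (subB sU.1); first apply: (subD sU.1).
  - exact: sU.2.
  - exact: (subZ sU.1).
  - exact: (subZ sU.1).
have sT := left_ideal_subspace left_idealT.
have dUm : dU `<=` mono setT k.
  by move=> _ [F hF ->]; apply: mono_condF => // i; apply: Um.
have [L eL dUE] := IH dU sdU dUm; exists L => //.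
have dU_d i p : U p -> dU (dop i p).
  move=> Up; exists (fun j => (i == j)%:R *: p) => [j|]; first exact: (subZ sU.1).
  rewrite /cond -(sum_delta i (fun j => dop j p)).
  by apply: eq_bigr => j _; rewrite opE.
have k0 : (k.+1%:R : C) != 0 by rewrite pnatr_eq0.
apply/seteqP; split => p.
  move=> Up; have [hp vp Dp] := Um _ Up; split => //.
  apply: (sub_unZ (valued_subspace eL.1) k0).
  rewrite -(mono_Eul (Um _ Up)); apply: (sub_sum (valued_subspace eL.1)) => i _.
  apply: valued_x; first exact: eL.1.
  by have := dU_d i _ Up; rewrite dUE => -[].
move=> hp; apply: (sub_unZ sU.1 k0).
rewrite -(conx_part_iota2 k (K := k.+1%:R)); last exact: (mono_Eul hp).
  apply: (sub_sum sU.1) => i _.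
  have : mono L k (dop i p) by apply: (mono_d _ _ hp); exact: eL.1.
  rewrite -dUE => -[F hF ->].
  exact: lie_stable_iota2.
by case: hp.
Qed.

End Monogenics.

(** * Finite-dimensional spaces of functions *)
Section FiniteDimension.
Variable C : fieldType.

Lemma row_dependence N n (B : 'M[C]_(n, N)) : (N < n)%N ->
  exists2 c : 'rV[C]_n, c != 0 & c *m B = 0.
Proof.
move=> Nn; have : kermx B != 0.
  rewrite -mxrank_eq0 mxrank_ker subn_eq0 -ltnNge.
  exact: leq_ltn_trans (rank_leq_col B) Nn.
move/rowV0Pn => [c /sub_kermxP cB c0]; by exists c.
Qed.

Section InEndomorphism.
Variables (E : lmodType C) (U : set E) (theta : E -> E) (N : nat) (b : 'I_N -> E).
Hypotheses (U0 : U 0) (UP : forall a x y, U x -> U y -> U (a *: x + y))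
  (Ub : forall x, U x -> exists c : 'I_N -> C, x = \sum_j c j *: b j)
  (Ut : forall x, U x -> U (theta x))
  (lt : forall a x y, U x -> U y -> theta (a *: x + y) = a *: theta x + theta y)
  (it : forall x, U x -> theta x = 0 -> x = 0).

(** Take a linear relation between x, theta x, theta^2 x, ...; after removing the
lowest powers by injectivity, its constant coefficient is nonzero. *)
Lemma injective_onto x : U x -> exists2 y, U y & theta y = x.
Proof.
move=> Ux; pose it_ j := iter j theta x.
have Uit j : U (it_ j) by elim: j => //= j; exact: Ut.
have theta0 : theta 0 = 0.
  by have := lt 1 U0 U0; rewrite !scale1r !addr0 => /eqP; rewrite -subr_eq0 opprD addrA addrN sub0r oppr_eq0 => /eqP.
have sumP n (c : 'I_n -> C) (f : 'I_n -> nat) : U (\sum_j c j *: it_ (f j)) /\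
    theta (\sum_j c j *: it_ (f j)) = \sum_j c j *: it_ (f j).+1.
  elim: (index_enum _) => [|j r [IH1 IH2]]; first by rewrite !big_nil.
  by rewrite !big_cons; split; [exact: UP|rewrite lt // IH2].
have Usum n (c : 'I_n -> C) := (sumP n c (fun j => j : nat)).1.
have theta_sum n (c : 'I_n -> C) := (sumP n c (fun j => j : nat)).2.
have dep n (c : 'I_n -> C) : \sum_j c j *: it_ j = 0 -> (exists j, c j != 0) ->
    exists2 y, U y & theta y = x.
  elim: n c => [|n IH] c; first by move=> _ [[]].
  rewrite big_ord_recl => s0 cn.
  have e : \sum_(j < n) c (lift ord0 j) *: it_ (lift ord0 j) =
      theta (\sum_(j < n) c (lift ord0 j) *: it_ j) by rewrite theta_sum.
  have [c0|c0] := eqVneq (c ord0) 0.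
    apply: (IH (fun j => c (lift ord0 j))).
      by apply: it => //; rewrite -e -[LHS]add0r -[RHS]s0 c0 scale0r.
    case: cn => j; case: (unliftP ord0 j) => [l ->|->]; first by exists l.
    by rewrite c0 eqxx.
  exists (- (c ord0)^-1 *: \sum_(j < n) c (lift ord0 j) *: it_ j).
    by rewrite -[_ *: _]addr0; apply: UP.
  have := lt (- (c ord0)^-1) (Usum _ (fun j => c (lift ord0 j))) U0.
  rewrite addr0 theta0 addr0 => ->; rewrite -e.
  have -> : \sum_(j < n) c (lift ord0 j) *: it_ (lift ord0 j) = - (c ord0 *: x).
    by apply/eqP; rewrite -addr_eq0 addrC s0.
  by rewrite scalerN scaleNr opprK scalerA mulVf // scale1r.
have /choice[c cE] j : exists c : 'I_N -> C, it_ j = \sum_l c l *: b l by exact: Ub.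
have [d d0 dB] := row_dependence (\matrix_(j < N.+1, l < N) c j l) (ltnSn N).
apply: (dep N.+1 (fun j => d 0 j)).
  transitivity (\sum_l (d *m (\matrix_(j < N.+1, l < N) c j l)) 0 l *: b l).
    under eq_bigr do rewrite cE scaler_sumr.
    rewrite exchange_big; apply: eq_bigr => l _ /=.
    by rewrite mxE scaler_suml; apply: eq_bigr => j _; rewrite scalerA mxE.
  by rewrite dB big1 // => l _; rewrite mxE scale0r.
apply: contrapT => /forallNP h; move/negP: d0; apply.
by apply/eqP/rowP => j; rewrite mxE; apply/eqP/negPn/negP; exact: h.
Qed.

End InEndomorphism.

(** Choose a maximal set of points with dual functions in U. A function of U that
vanishes at these points but not at another point s would give a larger one. *)
Lemma interpolation (X : Type) (U : set (X -> C)) (N : nat) (b : 'I_N -> X -> C) :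
  (forall x y, U x -> U y -> forall a, U (fun t => a * x t + y t)) ->
  (forall x, U x -> exists c : 'I_N -> C, forall t, x t = \sum_j c j * b j t) ->
  exists n (t : 'I_n -> X) (w : 'I_n -> X -> C), (forall l, U (w l)) /\
    forall f, U f -> forall s, f s = \sum_l f (t l) * w l s.
Proof.
move=> UP Ub.
pose P n := exists (t : 'I_n -> X) (w : 'I_n -> X -> C), (forall l, U (w l)) /\
  forall l j, w l (t j) = (l == j)%:R.
have bound n : P n -> (n <= N)%N.
  move=> [t [w [Uw wt]]]; rewrite leqNgt; apply/negP => Nn.
  have /choice[c cE] l : exists c : 'I_N -> C, forall t, w l t = \sum_j c j * b j t.
    exact: Ub.
  have [d d0 dB] := row_dependence (\matrix_(l < n, j < N) c l j) Nn.
  move/negP: d0; apply; apply/eqP/rowP => j; rewrite mxE.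
  transitivity (\sum_l d 0 l * w l (t j)).
    rewrite (bigD1 j) //= wt eqxx mulr1 big1 ?addr0 // => l /negPf nl.
    by rewrite wt nl mulr0.
  transitivity (\sum_i (d *m (\matrix_(l < n, j < N) c l j)) 0 i * b i (t j)).
    under eq_bigr do rewrite cE mulr_sumr.
    rewrite exchange_big; apply: eq_bigr => l _ /=.
    by rewrite mxE mulr_suml; apply: eq_bigr => i _; rewrite mulrA mxE.
  by rewrite dB big1 // => l _; rewrite mxE mul0r.
have P0 : P 0%N.
  have f0 (j : 'I_0) : False by case: j.
  by exists (fun j => False_rect _ (f0 j)), (fun j => False_rect _ (f0 j)); split=> -[].
have [n Pn maxn] : exists2 n, P n & forall n', P n' -> (n' <= n)%N.
  apply: contrapT => h.
  have grow j : exists2 n, P n & (j <= n)%N.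
    elim: j => [|j [n Pn jn]]; first by exists 0%N.
    apply: contrapT => h'; apply: h; exists n => // n' Pn'.
    rewrite leqNgt; apply/negP => nn'; apply: h'; exists n' => //.
    exact: leq_ltn_trans nn'.
  by have [n /bound nN] := grow N.+1; rewrite leqNgt ltnS nN.
have [t [w [Uw wt]]] := Pn; exists n, t, w; split => // f Uf.
apply: contrapT => /existsNP[s /eqP fs].
pose g x := f x - \sum_l f (t l) * w l x.
have Ug : U g.
  suff h r (c : 'I_n -> C) : U (fun x => f x - \sum_(l <- r) c l * w l x) by exact: h.
  elim: r => [|l r IH].
    have -> // : (fun x => f x - \sum_(l <- [::]) c l * w l x) = f.
    by apply/funext => x; rewrite big_nil subr0.
  have := UP _ _ (Uw l) IH (- c l); congr U; apply/funext => x.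
  by rewrite big_cons opprD addrCA mulNr.
have gt j : g (t j) = 0.
  rewrite /g (bigD1 j) //= wt eqxx mulr1 big1 ?addr0 ?subrr // => l /negPf nl.
  by rewrite wt nl mulr0.
have gs : g s != 0 by rewrite subr_eq0.
have U0 : U (fun=> 0).
  have := UP _ _ Ug Ug (- 1); congr U; apply/funext => x.
  by rewrite mulN1r addNr.
suff /maxn : P n.+1 by rewrite ltnn.
pose w0 x := (g s)^-1 * g x + 0.
have Uw0 : U w0 := UP _ _ Ug U0 _.
(* The points s, t_1, ..., t_n; the function dual to s is g / g(s). *)
exists (fun j => if unlift ord0 j is Some l then t l else s).
exists (fun j => if unlift ord0 j is Some l then
   (fun x => - (w l s) * w0 x + w l x) else w0); split.
  by move=> l; case: unliftP => [j|] _; [exact: UP|].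
move=> l j; case: unliftP => [l' ->|->]; case: unliftP => [j' ->|->].
- rewrite /w0 gt mulr0 addr0 mulr0 add0r wt.
  by rewrite (inj_eq (@lift_inj _ _)).
- rewrite /w0 addr0 mulVf // mulr1 addNr.
  by rewrite -(inj_eq val_inj) /= .
- by rewrite /w0 gt mulr0 addr0.
- by rewrite /w0 mulVf // addr0 eqxx.
Qed.

End FiniteDimension.

(** * Monogenic functions and monogenic polynomials *)
Section Bridge.
Variables (R : realType) (m : nat).
Local Notation C := R[i].
Local Notation Cl := (clifford C m).
Local Notation V := (cl_poly R m).
Local Notation E := ('rV[R]_m -> Cl).
Implicit Types (p q : V) (f : E) (S : set Cl) (s : clifford R m).

Lemma dirac_poly p u : Defs.dirac p u = Dir p u.
Proof. by rewrite /Dir /cone sumVE. Qed.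

Lemma homog_polyE k p : homog_poly k p <-> homo k p.
Proof.
split=> [/homog_poly_homo[q hq pq]|]; last exact: homo_homog_poly.
by have -> // : p = q by apply: cl_poly_eq => u; rewrite pq.
Qed.

Lemma monogenicE S k p : monogenic S k p <-> mono S k p.
Proof.
split=> [[hp vp Dp]|[hp vp Dp]]; split => //.
- exact/homog_polyE.
- by apply: cl_poly_eq => u; rewrite -dirac_poly Dp.
- exact/homog_polyE.
- by move=> u; rewrite dirac_poly Dp.
Qed.

Lemma monogenic_pol S k f : monogenic S k f -> pol f.
Proof. by move=> [/homog_poly_homo[q _ <-] _ _]; exact: cl_polyP. Qed.

Lemma monogenic_to_poly S k f : monogenic S k f -> mono S k (to_poly f).
Proof.
by move=> hf; apply/monogenicE; rewrite to_polyK //; exact: monogenic_pol hf.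
Qed.

Lemma cl_funP c p q : cl_fun (c *: p + q) = c *: cl_fun p + cl_fun q :> E.
Proof. by []. Qed.

Lemma cl_fun_inj : injective (@cl_fun R m).
Proof. exact: val_inj. Qed.

Lemma to_polyP c f g : pol f -> pol g -> to_poly (c *: f + g) = c *: to_poly f + to_poly g.
Proof.
move=> pf pg; apply: cl_fun_inj; rewrite cl_funP !to_polyK //.
by apply: PolAdd => //; exact: pol_scale.
Qed.

Lemma homog_span k : exists N (b : 'I_N -> E), forall f, homog_poly k f ->
  exists c : 'I_N -> C, forall u A, f u A = \sum_j c j * b j u A.
Proof.
pose I : finType := ({ffun 'I_m -> 'I_k.+1} * {set 'I_m})%type.
exists #|{: I}|, (fun j u => (monomial (enum_val j).1 u)%:C *: cl_basis C (enum_val j).2).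
move=> f [c fc].
exists (fun j => if multideg (enum_val j : I).1 == k then c (enum_val j).1 (enum_val j).2 else 0).
move=> u A; rewrite fc.
rewrite -(big_enum_val (A := {: I}) (fun j : I => (if multideg j.1 == k then c j.1 j.2 else 0) *
   ((monomial j.1 u)%:C *: cl_basis C j.2) A)) /=.
rewrite [RHS](eq_bigl xpredT) //.
rewrite -(pair_bigA _ (fun al B => (if multideg al == k then c al B else 0) *
   ((monomial al u)%:C *: cl_basis C B) A)) /=.
rewrite cl_sumE [LHS]big_mkcond; apply: eq_bigr => al _.
case: (multideg al == k); last by rewrite big1 // => B _; rewrite mul0r.
rewrite cl_scaleE {1}(cl_basis_sum (c al)) cl_sumE mulr_sumr; apply: eq_bigr => B _.
by rewrite !cl_scaleE mulrCA.
Qed.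

End Bridge.

(** * The component isomorphic to the monogenics *)
Section Tuples.
Variables (R : realType) (m : nat).
Local Notation C := R[i].
Local Notation Cl := (clifford C m).
Local Notation V := (cl_poly R m).
Local Notation E := ('rV[R]_m -> Cl).
Implicit Types (p q : V) (f : E) (S : set Cl) (s : clifford R m)
  (F G : 'I_m -> V) (H : 'I_m -> E).

Local Notation MkR S k := (@tensor_space R E (monogenic S k) m).
Local Notation act := (@act_mono R m).
Local Notation actR := (act_tensor act (@rho1 R m)).

Definition tval F : 'I_m -> E := fun i => cl_fun (F i).
Definition tpoly H : 'I_m -> V := fun i => to_poly (H i).

Lemma tvalP c F G : tval (fun i => c *: F i + G i) = c *: tval F + tval G.
Proof. by []. Qed.

Lemma tvalK F : tpoly (tval F) =1 F.
Proof. by move=> i; exact: cl_funK. Qed.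

Lemma eq_tval F G : F =1 G -> tval F = tval G.
Proof. by move=> FG; apply/funext => i; rewrite /tval FG. Qed.

Lemma tensorE S k F : MkR S k (tval F) <-> forall i, mono S k (F i).
Proof. by split=> h i; apply/monogenicE; exact: h. Qed.

Lemma tpolyK S k H : MkR S k H -> tval (tpoly H) = H.
Proof.
by move=> hH; apply/funext => i; apply: to_polyK; exact: monogenic_pol (hH i).
Qed.

Lemma tpoly_mono S k H : MkR S k H -> forall i, mono S k (tpoly H i).
Proof. by move=> hH i; exact: monogenic_to_poly. Qed.

Lemma cl_fun_sum (I : Type) (r : seq I) (P : pred I) (h : I -> V) :
  cl_fun (\sum_(l <- r | P l) h l) = \sum_(l <- r | P l) cl_fun (h l).
Proof. by elim/big_rec2: _ => // l y x _ <-. Qed.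

Lemma tval_sum (I : Type) (r : seq I) (P : pred I) (h : I -> 'I_m -> V) :
  tval (fun i => \sum_(l <- r | P l) h l i) = \sum_(l <- r | P l) tval (h l).
Proof.
elim: r => [|l r IH].
  by rewrite big_nil; apply/funext => i; rewrite /tval big_nil.
rewrite big_cons; case: ifP => Pl; rewrite -IH; apply/funext => i.
  by rewrite /tval big_cons Pl.
by rewrite /tval big_cons Pl.
Qed.

Lemma act_tensor_tval s F : spin s ->
  actR s (tval F) = tval (actT s F).
Proof.
move=> sS; apply/funext => i; rewrite /tval /actT cl_fun_sum; apply: eq_bigr => j _.
by rewrite -actVE.
Qed.

Lemma subrep_act S k (U : set E) : subrep act (monogenic S k) U ->
  forall s p, spin s -> U p -> U (actV s p).
Proof. by move=> [_ _ aU] s p sS Up; rewrite actVE //; exact: aU. Qed.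

Lemma subrep_lie S k (U : set E) : subrep act (monogenic S k) U ->
  lie_stable [set p : V | U p].
Proof.
move=> hU; have [sU UM _] := hU; split.
  split; first exact: (sub0 sU).
  by move=> c p q; exact: (subP sU).
move=> a b p Up; have /monogenicE[hp _ _] := UM _ Up.
have [n [w [g [gS gE _ _]]]] := spin_generators R k a b.
change (U (cl_fun (Xop a b p))); rewrite gE // cl_fun_sum; apply: (sub_sum sU) => l _; apply: (subZ sU).
exact: (subrep_act hU).
Qed.

Lemma subrep_actT S k (U : set ('I_m -> E)) :
  subrep actR (MkR S k) U ->
  forall s F, spin s -> U (tval F) -> U (tval (actT s F)).
Proof. by move=> [_ _ aU] s F sS UF; rewrite -act_tensor_tval //; exact: aU. Qed.

Lemma tval_XT k a b : exists n (w : 'I_n -> R) (g : 'I_n -> clifford R m),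
  [/\ forall l, spin (g l),
   forall p, homo k p -> cl_fun (Xop a b p) = \sum_l (w l)%:C *: cl_fun (actV (g l) p) &
   forall F, (forall i, homo k (F i)) ->
     tval (XT a b F) = \sum_l (w l)%:C *: tval (actT (g l) F)].
Proof.
have [n [w [g [gS gE _ gT]]]] := spin_generators R k a b.
exists n, w, g; split => // [p hp|F hF].
  by rewrite gE // cl_fun_sum.
transitivity (tval (fun i => \sum_l (w l)%:C *: actT (g l) F i)).
  by apply: eq_tval => i; exact: gT.
by rewrite tval_sum; apply: eq_bigr => l _.
Qed.

Lemma subrep_XT S k (U : set ('I_m -> E)) :
  subrep actR (MkR S k) U ->
  forall a b F, U (tval F) -> U (tval (XT a b F)).
Proof.
move=> hU a b F UF; have [sU UM _] := hU.
have /tensorE hF := UM _ UF.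
have [n [w [g [gS _ gT]]]] := tval_XT k a b.
rewrite gT => [|i]; last by case: (hF i).
apply: (sub_sum sU) => l _; apply: (subZ sU); exact: (subrep_actT hU).
Qed.

Section LinearOnSubspace.
Variables (E1 E2 : lmodType C) (U : set E1) (psi : E1 -> E2).
Hypotheses (sU : Defs.subspace U)
  (lpsi : forall a y z, U y -> U z -> psi (a *: y + z) = a *: psi y + psi z).

Lemma rep_lin0 : psi 0 = 0.
Proof.
have := lpsi 1 (sub0 sU) (sub0 sU); rewrite !scale1r addr0 => /eqP.
by rewrite addrC -subr_eq subrr eq_sym => /eqP.
Qed.

Lemma rep_linZ c x : U x -> psi (c *: x) = c *: psi x.
Proof.
by move=> Ux; have := lpsi c Ux (sub0 sU); rewrite !addr0 rep_lin0 addr0.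
Qed.

Lemma rep_lin_eigen c x y : (forall z, U z -> psi z = 0 -> z = 0) ->
  U x -> U y -> psi x = c *: psi y -> x = c *: y.
Proof.
move=> ker Ux Uy e; apply/eqP; rewrite -subr_eq0; apply/eqP; apply: ker.
  by apply: subB => //; apply: subZ.
by rewrite -scaleN1r addrC lpsi ?rep_linZ ?e ?scaleN1r ?addNr //; apply: subZ.
Qed.

Lemma tuple_sum (T : ('I_m -> V) -> E1) n (h : 'I_n -> 'I_m -> V) :
  (forall c F G, T (fun i => c *: F i + G i) = c *: T F + T G) ->
  (forall F G, F =1 G -> T F = T G) ->
  (forall l, U (T (h l))) ->
  U (T (fun i => \sum_l h l i)) /\
  psi (T (fun i => \sum_l h l i)) = \sum_l psi (T (h l)).
Proof.
move=> TP Text Uh; elim: (index_enum _) => [|l r [IH1 IH2]].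
  have -> : T (fun i => \sum_(l <- [::]) h l i) = 0.
    rewrite (Text _ (fun i => 0)) => [|i]; last by rewrite big_nil.
    have z : -1 *: T (fun=> 0) + T (fun=> 0) = 0 by rewrite scaleN1r addNr.
    by rewrite -[RHS]z -TP; apply: Text => i; rewrite scaler0 addr0.
  by rewrite big_nil; split; [exact: (sub0 sU)|exact: rep_lin0].
have -> : T (fun i => \sum_(l <- l :: r) h l i) =
    1 *: T (h l) + T (fun i => \sum_(l <- r) h l i).
  by rewrite -TP; apply: Text => i; rewrite big_cons scale1r.
split; first by apply: (subP sU); [exact: Uh|exact: IH1].
rewrite (lpsi _ (Uh l) IH1) scale1r big_cons; congr (_ + _); exact: IH2.
Qed.
Lemma rep_lin_sum n (w : 'I_n -> C) (x : 'I_n -> E1) :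
  (forall l, U (x l)) -> psi (\sum_l w l *: x l) = \sum_l w l *: psi (x l).
Proof.
move=> Ux; suff [] : U (\sum_l w l *: x l) /\
  psi (\sum_l w l *: x l) = \sum_l w l *: psi (x l) by [].
elim: (index_enum _) => [|l r [IH1 IH2]].
  by rewrite !big_nil; split; [exact: sub0|exact: rep_lin0].
by rewrite !big_cons; split; [exact: subP|rewrite lpsi // IH2].
Qed.
End LinearOnSubspace.

Lemma rep_iso_X S k U psi :
  subrep actR (MkR S k) U ->
  rep_iso actR U act (monogenic S k) psi ->
  forall a b F, U (tval F) ->
    psi (tval (XT a b F)) = Xop a b (to_poly (psi (tval F))) :> E.
Proof.
move=> hU [[fpsi _ _] lpsi epsi] a b F UF; have [sU UM _] := hU.
have /tensorE hF := UM _ UF.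
have [n [w [g [gS gX gT]]]] := tval_XT k a b.
have hpsi : monogenic S k (psi (tval F)) by exact: fpsi.
rewrite gT => [|i]; last by case: (hF i).
rewrite gX; last by case: (monogenic_to_poly hpsi).
rewrite (rep_lin_sum sU lpsi) => [|l]; last exact: (subrep_actT hU).
apply: eq_bigr => l _; congr (_ *: _).
by rewrite -act_tensor_tval // epsi // actVE // to_polyK //; exact: monogenic_pol hpsi.
Qed.

Lemma act_mono_poly s p : spin s -> act s p = cl_fun (actV s p).
Proof. by move=> sS; rewrite actVE. Qed.

Lemma set_bij_lin (E1 E2 : lmodType C) (A : set E1) (B : set E2) (f : E1 -> E2) :
  Defs.subspace A -> (forall a y z, A y -> A z -> f (a *: y + z) = a *: f y + f z) ->
  (forall x, A x -> B (f x)) -> (forall x, A x -> f x = 0 -> x = 0) ->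
  (forall y, B y -> exists2 x, A x & f x = y) -> set_bij A B f.
Proof.
move=> sA lf fA kf sf; split => [x /fA //|x y|y /sf [x Ax <-]]; last by exists x.
rewrite !inE => Ax Ay fxy; apply/eqP; rewrite -subr_eq0; apply/eqP.
apply: kf; first exact: subB.
by rewrite -scaleN1r addrC lf // scaleN1r fxy addNr.
Qed.

Lemma rep_iso_ker (E1 E2 : lmodType C) a1 a2 (A : set E1) (B : set E2) (f : E1 -> E2) :
  Defs.subspace A -> @rep_iso R m E1 E2 a1 A a2 B f -> forall x, A x -> f x = 0 -> x = 0.
Proof.
move=> sA [[_ fi _] lf _] x Ax fx; have A0 := sub0 sA.
apply: fi; rewrite ?inE // fx.
have := lf 1 0 0 A0 A0; rewrite !scale1r addr0 => /eqP.
by rewrite addrC -subr_eq subrr => /eqP.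
Qed.

Lemma fun_sumE n (h : 'I_n -> E) u A : (\sum_j h j) u A = \sum_j h j u A.
Proof. by elim/big_rec2: _ => [|j y z _ <-]; rewrite ffunE. Qed.

Lemma monogenic_subspace S k : Defs.subspace S -> Defs.subspace (monogenic S k).
Proof.
move=> sS; have sM := mono_subspace sS k.
split; first exact: ((monogenicE S k (0 : V)).2 (sub0 sM)).
move=> c x y hx hy.
rewrite -(to_polyK (monogenic_pol hx)) -(to_polyK (monogenic_pol hy)).
rewrite -cl_funP; apply/monogenicE.
by apply: (subP sM); [exact: monogenic_to_poly hx|exact: monogenic_to_poly hy].
Qed.

Section Component.
Variables (S : set Cl) (k : nat).
Hypotheses (m3 : (3 <= m)%N) (lS : left_ideal S).
Local Notation M := (m%:R : C).
Local Notation J := (k%:R : C).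
Let sS := left_ideal_subspace lS.
Let eS := left_ideal_even lS.
Let sM := mono_subspace sS k.+1.

Definition mid_comp : set ('I_m -> E) :=
  [set H | exists2 p, mono S k.+1 p & H = tval (iota1 k p)].

Definition mid_proj H : E := cl_fun (monoT k (tpoly H)).

Lemma c1_neq0 : - ((M - 2) * (M + 2%:R * J + 2) / (M + 2%:R * J)) != 0.
Proof.
have [n0 n2 m2 c2] := dim_neq0 R k m3.
by rewrite oppr_eq0 !mulf_neq0 // invr_neq0.
Qed.

Lemma monoT_iota1 p : mono S k.+1 p ->
  monoT k (iota1 k p) = - ((M - 2) * (M + 2%:R * J + 2) / (M + 2%:R * J)) *: p.
Proof.
move=> hp; have [_ _ Dp] := hp; rewrite /monoT (cond_iota1 k Dp) !opE scaler0 subr0.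
by rewrite (cone_iota1 m3 Dp (mono_Eul hp)).
Qed.

Lemma eq_monoT F G : F =1 G -> monoT k F = monoT k G.
Proof. by move=> FG; rewrite /monoT (eq_cone FG) (eq_cond FG). Qed.

Lemma mid_proj_tval F : mid_proj (tval F) = cl_fun (monoT k F).
Proof. by rewrite /mid_proj (eq_monoT (tvalK F)). Qed.

Lemma subrep_MkR : subrep actR (MkR S k.+1) (MkR S k.+1).
Proof.
split => //.
  split=> [i|c H H' hH hH' i].
    by have /monogenicE := sub0 sM.
  have := subP sM c (tpoly_mono hH i) (tpoly_mono hH' i).
  by move=> /monogenicE; rewrite cl_funP !to_polyK; [|exact: monogenic_pol (hH' i)|exact: monogenic_pol (hH i)].
move=> s H sS' hH; rewrite -(tpolyK hH) act_tensor_tval //; apply/tensorE => i.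
apply: (sub_sum sM) => j _; apply: (subZ sM); apply: mono_act => //.
exact: tpoly_mono.
Qed.

Lemma subrep_mid_comp : subrep actR (MkR S k.+1) mid_comp.
Proof.
split.
- split; first by exists 0; [exact: sub0 sM|apply/funext => i; rewrite /tval /iota1 !opE scaler0 subr0].
  move=> c _ _ [p hp ->] [q hq ->]; exists (c *: p + q); first exact: (subP sM).
  by rewrite -tvalP; apply: eq_tval => i; rewrite iota1P.
- by move=> _ [p hp ->]; apply/tensorE => i; exact: mono_iota1.
- move=> s _ sS' [p hp ->]; exists (actV s p); first exact: mono_act.
  by rewrite (act_tensor_tval _ sS'); apply: eq_tval => i; rewrite iota1_act.
Qed.

Lemma mid_proj_lin a H H' : MkR S k.+1 H -> MkR S k.+1 H' ->
  mid_proj (a *: H + H') = a *: mid_proj H + mid_proj H'.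
Proof.
move=> hH hH'; rewrite -(tpolyK hH) -(tpolyK hH') -tvalP !mid_proj_tval monoTP.
exact: cl_funP.
Qed.

Lemma mid_proj_act s H : spin s -> MkR S k.+1 H ->
  mid_proj (actR s H) = act s (mid_proj H).
Proof.
move=> sS' hH; rewrite -(tpolyK hH) (act_tensor_tval _ sS') !mid_proj_tval.
by rewrite (monoT_act _ _ sS') (act_mono_poly _ sS').
Qed.

Lemma mid_proj_mono H : MkR S k.+1 H -> monogenic S k.+1 (mid_proj H).
Proof.
move=> hH; apply/monogenicE; apply: mono_monoT => //.
exact: tpoly_mono.
Qed.

Lemma mid_proj_onto p : mono S k.+1 p -> exists2 H, mid_comp H & mid_proj H = p.
Proof.
set c := - ((M - 2) * (M + 2%:R * J + 2) / (M + 2%:R * J)).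
move=> hp; exists (tval (iota1 k (c^-1 *: p))).
  by exists (c^-1 *: p) => //; exact: (subZ sM).
rewrite mid_proj_tval monoT_iota1; last exact: (subZ sM).
by rewrite -/c scalerA mulfV ?c1_neq0 // scale1r.
Qed.

Lemma mid_proj_iso : rep_iso actR mid_comp act (monogenic S k.+1) mid_proj.
Proof.
have [sK KM aK] := subrep_mid_comp.
split; last 2 first.
- by move=> a H H' hH hH'; apply: mid_proj_lin; exact: KM.
- by move=> s H sS' hH; apply: mid_proj_act => //; exact: KM.
apply: set_bij_lin => //.
- by move=> a H H' hH hH'; apply: mid_proj_lin; exact: KM.
- by move=> H hH; apply: mid_proj_mono; exact: KM.
- move=> _ [p hp ->]; rewrite mid_proj_tval monoT_iota1 // => h.
  have /eqP : - ((M - 2) * (M + 2%:R * J + 2) / (M + 2%:R * J)) *: p = 0.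
    exact: cl_fun_inj.
  rewrite scaler_eq0 (negPf c1_neq0) /= => /eqP ->.
  by apply/funext => i; rewrite /tval /iota1 !opE scaler0 subr0.
- move=> f hf; have [H hH fE] := mid_proj_onto (monogenic_to_poly hf).
  by exists H => //; rewrite fE to_polyK //; exact: monogenic_pol hf.
Qed.

(** Applying cond, then conx, to Omega F + (m - 1)/2 F = 0 shows in turn that the
other components of F vanish. *)
Lemma Omega_eigen_mid F : (forall i, mono S k.+1 (F i)) ->
  (forall i, Omega F i = - ((M - 1) / 2) *: F i) -> F =1 iota1 k (comp1 k F).
Proof.
move=> hF OF; have [n0 n2 m2 c2] := dim_neq0 R k m3.
have DF i : Dir (F i) = 0 by case: (hF i).
have EF i : Eul (F i) = k.+1%:R *: F i by exact: (mono_Eul (hF i)).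
pose I2 := iota2 k (comp2 k F); pose I3 j := dop j (comp3 k F).
pose b2 : C := - (M + 2%:R * J) / 2; pose b3 : C := (M + 2%:R * J + 2%:R) / 2.
pose b4 : C := (M - 2%:R) / 2.
have key i : b2 *: I2 i + (b3 *: I3 i + b4 *: comp4 k F i) = 0.
  have := Omega_decomp m3 DF EF i; rewrite OF {1}(decompE k F i) -/(I2 i) -/(I3 i).
  move/eqP; rewrite eq_sym -subr_eq0 => /eqP <-; rewrite /b2 /b3 /b4.
  by lin_solve (R[i]) ltac:(field).
have b2n : b2 != 0 by rewrite mulf_neq0 ?oppr_eq0 // invr_neq0 // two_neq0.
have b3n : b3 != 0 by rewrite mulf_neq0 // invr_neq0 // two_neq0.
have b4n : b4 != 0 by rewrite mulf_neq0 // invr_neq0 // two_neq0.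
have D2 := Dir_comp2 k DF; have E2 := Eul_comp2 EF.
have D3 := Dir_comp3 m3 DF EF; have E3 := Eul_comp3 EF.
have z2 : comp2 k F = 0.
  have : cond (fun i => b2 *: I2 i + (b3 *: I3 i + b4 *: comp4 k F i)) = 0.
    by rewrite (eq_cond key) cond0.
  rewrite condP condP condZ (cond_comp4 m3 DF EF) cond_d D3 (cond_iota2 m3 D2 E2).
  rewrite opE oppr0 !scaler0 !addr0 scalerA => /eqP.
  by rewrite scaler_eq0 mulf_eq0 (negPf b2n) (negPf c2) /= => /eqP.
have key3 i : b3 *: I3 i + b4 *: comp4 k F i = 0.
  rewrite -[RHS](key i) /I2 z2 /iota2 !opE.
  by lin_solve (R[i]) ltac:(ring).
have z3 : comp3 k F = 0.
  have : conx (fun i => b3 *: I3 i + b4 *: comp4 k F i) = 0.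
    by rewrite (eq_conx key3) conx0.
  rewrite conxP conxZ (conx_comp4 EF) scaler0 addr0 -/(Eul _) E3 scalerA => /eqP.
  by rewrite scaler_eq0 mulf_eq0 (negPf b3n) pnatr_eq0 /= => /eqP.
move=> i; have /eqP : b4 *: comp4 k F i = 0.
  by rewrite -[RHS](key3 i) /I3 z3 opE scaler0 add0r.
rewrite scaler_eq0 (negPf b4n) /= => /eqP z4.
rewrite {1}(decompE k F i) z2 z3 z4 /iota2 !opE.
by lin_solve (R[i]) ltac:(ring).
Qed.

(** An isomorphism with the monogenics of degree k + 1 transports the Casimir
operator, so it prescribes the value of Omega and K' lies in mid_comp. For
equality, the inverse of the isomorphism followed by mid_proj is an injective
endomorphism of a finite-dimensional space. *)
Lemma mid_comp_unique K' : subrep actR (MkR S k.+1) K' ->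
  (exists psi, rep_iso actR K' act (monogenic S k.+1) psi) -> K' = mid_comp.
Proof.
move=> hK [psi ipsi]; have [sK KM aK] := hK.
have [[fpsi psii psis] lpsi epsi] := ipsi.
have sub : K' `<=` mid_comp.
  move=> H KH; have hH := KM _ KH; pose F := tpoly H.
  have HF : H = tval F by rewrite (tpolyK hH).
  have hF i : mono S k.+1 (F i) by exact: tpoly_mono.
  exists (comp1 k F); first exact: mono_comp1.
  rewrite HF; apply: eq_tval; apply: Omega_eigen_mid => //.
  pose K : C := k.+1%:R.
  (* The value of the Casimir operator in degree k + 1. *)
  pose c : C := - (M * (M - 1) / 4%:R + 2%:R * K * (K + M - 1)).
  have KF : K' (tval F) by rewrite -HF.
  have CF i : CasT F i = c *: F i.
    have KX a b : K' (tval (XT a b (XT a b F))).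
      by apply: (subrep_XT hK); apply: (subrep_XT hK).
    have KXs a := tuple_sum sK lpsi tvalP eq_tval (KX a).
    have [KC e0] := tuple_sum sK lpsi tvalP eq_tval (fun a => (KXs a).1).
    have psiF : monogenic S k.+1 (psi (tval F)) by exact: fpsi.
    have [_ _ Dp] := monogenic_to_poly psiF.
    have Ep := mono_Eul (monogenic_to_poly psiF).
    have e1 : psi (tval (CasT F)) = cl_fun (Cas (to_poly (psi (tval F)))).
      rewrite [LHS]e0 /Cas cl_fun_sum; apply: eq_bigr => a _.
      rewrite [LHS](KXs a).2 cl_fun_sum; apply: eq_bigr => b _.
      have X1 := rep_iso_X hK ipsi a b (subrep_XT hK a b KF).
      have X2 := rep_iso_X hK ipsi a b KF.
      apply: (etrans X1); congr (cl_fun (Xop a b _)).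
      by apply: (etrans (congr1 (@to_poly R m) X2)); exact: cl_funK.
    have e2 : psi (tval (CasT F)) = c *: psi (tval F).
      rewrite e1 (Cas_monogenic Dp Ep) -/K -/c.
      by rewrite -[in RHS](to_polyK (monogenic_pol psiF)).
    have e3 := rep_lin_eigen sK lpsi (rep_iso_ker sK ipsi) KC KF e2.
    apply: cl_fun_inj; exact: (congr1 (fun H => H i) e3).
  move=> i; have [_ _ Di] := hF i.
  have := CasTE F i; rewrite CF (Cas_monogenic Di (mono_Eul (hF i))) -/K -/c => e.
  have four : (4%:R : C) != 0 by rewrite pnatr_eq0.
  apply: (scalerI four).
  transitivity (c *: F i - (2%:R * (M - 1)) *: F i - (c *: F i - 4%:R *: Omega F i -
      (2%:R * (M - 1)) *: F i)); first by lin_solve (R[i]) ltac:(ring).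
  by rewrite -e; lin_solve (R[i]) ltac:(field).
apply/seteqP; split => // H KH.
have [sM' MM aM] := subrep_mid_comp.
have /choice[g gP] : forall f, exists H, monogenic S k.+1 f -> K' H /\ psi H = f.
  move=> f; have [hf|nf] := pselect (monogenic S k.+1 f).
    by have [H' KH' <-] := psis _ hf; exists H'.
  by exists 0.
have sMk := monogenic_subspace k.+1 sS.
have glin a x y : monogenic S k.+1 x -> monogenic S k.+1 y ->
    g (a *: x + y) = a *: g x + g y.
  move=> hx hy; have [Kx px] := gP _ hx; have [Ky py] := gP _ hy.
  have [Kxy pxy] := gP _ (subP sMk a hx hy).
  apply: psii; rewrite ?inE //; first exact: (subP sK).
  by rewrite pxy lpsi // px py.
have [N [b bP]] := homog_span R m k.+1.
have onto := @injective_onto _ _ (monogenic S k.+1) (fun f => mid_proj (g f)) N b (sub0 sMk).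
have {}onto := onto (fun a x y => @subP _ _ _ sMk a x y).
have [f hf pf] : exists2 f, monogenic S k.+1 f & mid_proj (g f) = mid_proj H.
  apply: onto.
  - move=> x [/bP[c cx] _ _]; exists c; apply/funext => u; apply/ffunP => A.
    by rewrite cx fun_sumE; apply: eq_bigr => j _; rewrite [RHS]cl_scaleE.
  - by move=> x hx; apply: mid_proj_mono; apply: KM; case: (gP _ hx).
  - move=> a x y hx hy; rewrite glin // mid_proj_lin //; apply: KM.
      by case: (gP _ hx).
    by case: (gP _ hy).
  - move=> x hx pg; have [Kg <-] := gP _ hx.
    rewrite (rep_iso_ker sM' mid_proj_iso (sub _ Kg) pg).
    exact: (rep_lin0 sK lpsi).
  - by apply: mid_proj_mono; exact: MM.
have [Kg _] := gP _ hf.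
have [[_ phii _] _ _] := mid_proj_iso.
have -> : H = g f; last exact: Kg.
apply: phii; [exact: mem_set|exact: (mem_set (sub _ Kg))|exact: (esym pf)].
Qed.

End Component.
End Tuples.

(** * The projected gradient is the Rarita-Schwinger operator *)
Section Gradient.
Variables (R : realType) (m : nat).
Local Notation C := R[i].
Local Notation Cl := (clifford C m).
Local Notation V := (cl_poly R m).
Local Notation E := ('rV[R]_m -> Cl).
Implicit Types (p q : V) (f : 'rV[R]_m -> E) (S : set Cl) (s : clifford R m)
  (F G : 'I_m -> V) (H : 'I_m -> E).

Local Notation MkR S k := (@tensor_space R E (monogenic S k) m).
Local Notation act := (@act_mono R m).
Local Notation actR := (act_tensor act (@rho1 R m)).

Lemma smooth_is_cpartial S k f u A i x : smooth_family (monogenic S k) f ->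
  is_cpartial i (fun y => f y u A) x (partial i (f^~ u) x A).
Proof.
move=> [_ sf]; have [s1 s2] := sf u A; rewrite ffunE; split.
  by apply: DeriveDef => //; have [_ h] := s1 [::]; exact: h.
by apply: DeriveDef => //; have [_ h] := s2 [::]; exact: h.
Qed.

(** Interpolating the values of the family at finitely many points writes it as a
finite combination of fixed monogenics with differentiable coefficients. *)
Lemma gradient_mono S k f x : Defs.subspace S -> smooth_family (monogenic S k) f ->
  MkR S k (gradient f x).
Proof.
move=> sS sf i; have sM := monogenic_subspace k sS.
pose U := [set g : 'rV[R]_m * {set 'I_m} -> C | exists2 q : E, monogenic S k q &
   g = fun t => q t.1 t.2].
have [N [b bP]] := homog_span R m k.
have UP (g g' : 'rV[R]_m * {set 'I_m} -> C) :
    U g -> U g' -> forall a, U (fun t => a * g t + g' t).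
  move=> [q hq ->] [q' hq' ->] a; exists (a *: q + q'); first exact: (subP sM).
  by apply/funext => t; rewrite ffunE cl_scaleE.
have Ub (g : 'rV[R]_m * {set 'I_m} -> C) : U g ->
    exists c : 'I_N -> C, forall t, g t = \sum_j c j * b j t.1 t.2.
  by move=> [q [/bP[c qc] _ _] ->]; exists c => t; exact: qc.
have [n [t [w [Uw wE]]]] := interpolation UP Ub.
have /choice[q qP] l : exists q : E, monogenic S k q /\ w l = fun t => q t.1 t.2.
  by have [q hq ->] := Uw l; exists q.
pose c l := partial i (f^~ (t l).1) x (t l).2.
have -> : gradient f x i = \sum_l c l *: q l.
  apply/funext => u; apply/ffunP => A; rewrite fun_sumE /gradient.
  have fE y : f y u A = \sum_l w l (u, A) * f y (t l).1 (t l).2.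
    have Uf : U (fun t => f y t.1 t.2) by exists (f y); [exact: (sf.1 y)|].
    by rewrite (wE _ Uf (u, A)); apply: eq_bigr => l _; rewrite mulrC.
  have h : is_cpartial i (fun y => f y u A) x (\sum_l w l (u, A) * c l).
    have -> : (fun y => f y u A) = fun y => \sum_l w l (u, A) * f y (t l).1 (t l).2.
      by apply/funext.
    apply: is_cpartial_sum => l; apply: is_cpartialZ.
    exact: (smooth_is_cpartial (t l).1 (t l).2 i x sf).
  rewrite [LHS]ffunE (is_cpartial_val h); apply: eq_bigr => l _.
  by rewrite [RHS]cl_scaleE (qP l).2 mulrC.
by apply: (sub_sum sM) => l _; apply: (subZ sM); exact: (qP l).1.
Qed.

Lemma umulE p u : umul p u = complexify (vec u) * p u.
Proof.
rewrite /umul /cone sumVE complexify_vec mulr_suml; apply: eq_bigr => i _.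
by rewrite eopE xopE -scalerAl scalerAr.
Qed.

Lemma rarita_schwingerE S k f x : (3 <= m)%N -> Defs.subspace S ->
  smooth_family (monogenic S k.+1) f ->
  rarita_schwinger k.+1 f x = mid_proj k (gradient f x).
Proof.
move=> m3 sS sf; have hG := gradient_mono x sS sf.
pose F := tpoly (gradient f x).
have hF i : mono S k.+1 (F i) by exact: (tpoly_mono hG).
have FE : gradient f x = tval F by rewrite (tpolyK hG).
have e : (fun u => Defs.dirac (f^~ u) x) = cone F.
  apply/funext => u; rewrite /cone sumVE; apply: eq_bigr => i _.
  by rewrite eopE; congr (_ * _); rewrite -[LHS]/(gradient f x i u) FE.
rewrite /rarita_schwinger e FE mid_proj_tval /monoT; apply/funext => u.
have DF i : Dir (F i) = 0 by case: (hF i).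
rewrite /mono_proj dirac_poly (Dir_coneF DF) cl_polyDE.
have -> : (m + 2 * k.+1 - 2)%:R = m%:R + 2%:R * k%:R :> C.
  by rewrite mulnS addnCA addKn natrD natrM.
rewrite addrC; congr (_ + _).
transitivity (((m%:R + 2%:R * k%:R)^-1 *: umul (- (cond F *+ 2))) u).
  by rewrite cl_polyZE umulE.
by congr (cl_fun _ u); rewrite !opE; lin_solve (R[i]) ltac:(ring).
Qed.

Section Orthogonality.
Variables (S : set Cl) (k : nat) (h : E -> E -> C).
Hypotheses (m3 : (3 <= m)%N) (lS : left_ideal S).
Hypothesis hh : invariant_inner_product act (monogenic S k.+1) h.
Local Notation M := (m%:R : C).
Local Notation J := (k%:R : C).
Let sS := left_ideal_subspace lS.
Let eS := left_ideal_even lS.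
Let sM := mono_subspace sS k.+1.
Local Notation mo := (mono S k.+1).

Definition pairing p q : C := h (cl_fun p) (cl_fun q).

Lemma pairingP c p q r : mo p -> mo q -> mo r -> pairing (c *: p + q) r = c * pairing p r + pairing q r.
Proof.
by case: hh => lh _ _ _ /monogenicE a1 /monogenicE a2 /monogenicE a3; exact: lh.
Qed.

Lemma pairingC p q : mo p -> mo q -> pairing q p = (pairing p q)^*%C.
Proof. by case: hh => _ ch _ _ /monogenicE a1 /monogenicE a2; exact: ch. Qed.

Lemma pairing_sum n (c : 'I_n -> C) (p : 'I_n -> V) q : (forall l, mo (p l)) -> mo q ->
  pairing (\sum_l c l *: p l) q = \sum_l c l * pairing (p l) q.
Proof.
move=> mp mq; have [//] : mo (\sum_l c l *: p l) /\
  pairing (\sum_l c l *: p l) q = \sum_l c l * pairing (p l) q.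
elim: (index_enum _) => [|l r [IH1 IH2]].
  rewrite !big_nil; split; first exact: (sub0 sM).
  have z : 1 *: 0 + 0 = 0 :> V by rewrite scaler0 addr0.
  have := pairingP 1 (sub0 sM) (sub0 sM) mq; rewrite z mul1r => /eqP.
  by rewrite addrC -subr_eq subrr eq_sym => /eqP.
by rewrite !big_cons; split; [exact: (subP sM)|rewrite pairingP // IH2].
Qed.

Lemma pairingN p q : mo p -> mo q -> pairing (- p) q = - pairing p q.
Proof.
move=> mp mq; have := pairing_sum (fun=> -1) (p := fun _ : 'I_1 => p) (fun=> mp) mq.
by rewrite !big_ord1 scaleN1r mulN1r.
Qed.

Lemma actV_rev s p : spin s -> actV (reversion s) (actV s p) = p.
Proof.
move=> sS'; have sr := spin_reversion sS'; apply: cl_poly_eq => u.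
rewrite /actV lmulE rotpE lmulE rotpE mulrA -complexifyM spin_rev_mul // complexify1.
by rewrite mul1r -mulmxA rho1_reversion // rho1_orth // mulmx1.
Qed.

Lemma pairing_act s p q : spin s -> mo p -> mo q ->
  pairing (actV s p) q = pairing p (actV (reversion s) q).
Proof.
move=> sS' mp mq; have sr := spin_reversion sS'.
have mq' : mo (actV (reversion s) q) by exact: mono_act.
have e : actV s (actV (reversion s) q) = q by rewrite -{1}[s]reversionK actV_rev.
case: hh => _ _ _ ih; rewrite -{1}e /pairing (actVE _ sS') (actVE (actV _ _) sS').
by apply: ih => //; exact/monogenicE.
Qed.

(** X_ab is a combination of spin elements g_l, and with the opposite weights also
of their inverses; invariance moves g_l to the other side as its inverse. *)
Lemma pairing_Xop a b p q : mo p -> mo q -> pairing (Xop a b p) q = - pairing p (Xop a b q).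
Proof.
move=> mp mq; have [n [w [g [gS g1 g2 _]]]] := spin_generators R k.+1 a b.
have [[hp_ _ _] [hq _ _]] := (mp, mq).
have sg l := spin_reversion (gS l).
have mg l : mo (actV (reversion (g l)) q) by exact: mono_act.
have mgp l : mo (actV (g l) p) by exact: mono_act.
have mX : mo (\sum_l (w l)%:C *: actV (reversion (g l)) q).
  by apply: (sub_sum sM) => l _; exact: (subZ sM).
rewrite (g1 _ hp_) (g2 _ hq) (pairing_sum (fun l => (w l)%:C) mgp mq).
rewrite (pairingC (subN sM mX) mp) (pairingN mX mp) (pairing_sum (fun l => (w l)%:C) mg mp).
rewrite rmorphN opprK rmorph_sum; apply: eq_bigr => l _.
rewrite rmorphM pairing_act // (pairingC mp (mg l)) /= .
congr (_ * _); last by rewrite conjcK.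
by rewrite /= oppr0.
Qed.

Definition tuple_pairing F G : C := \sum_i pairing (F i) (G i).

(** Both signs from X_ab being skew and from exchanging a and b cancel. *)
Lemma tuple_pairing_Omega F G : (forall i, mo (F i)) -> (forall i, mo (G i)) ->
  tuple_pairing (Omega F) G = tuple_pairing F (Omega G).
Proof.
move=> mF mG.
have mX a b p : mo p -> mo (Xop a b p) by exact: mono_X.
have e1 a : pairing (Omega F a) (G a) = \sum_b pairing (Xop a b (F b)) (G a).
  rewrite /Omega; under eq_bigr do rewrite -[Xop _ _ _]scale1r.
  by rewrite (pairing_sum (fun=> 1)) // => [|l]; [under eq_bigr do rewrite mul1r|exact: mX].
have e2 a : pairing (F a) (Omega G a) = \sum_b pairing (F a) (Xop a b (G b)).
  have mO : mo (Omega G a) by apply: (sub_sum sM) => b _; exact: mX.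
  rewrite (pairingC mO (mF a)) /Omega; under eq_bigr do rewrite -[Xop _ _ _]scale1r.
  rewrite (pairing_sum (fun=> 1)) // => [|l]; last exact: mX.
  rewrite rmorph_sum; apply: eq_bigr => b _.
  by rewrite mul1r (pairingC (mF a) (mX _ _ _ (mG b))); exact: conjcK.
rewrite /tuple_pairing; under eq_bigr do rewrite e1; under [RHS]eq_bigr do rewrite e2.
rewrite exchange_big; apply: eq_bigr => b _; apply: eq_bigr => a _ /=.
rewrite (pairing_Xop a b (mF b) (mG a)) XopC.
by rewrite (pairingC (subN sM (mX _ _ _ (mG a))) (mF b)) (pairingN (mX _ _ _ (mG a)) (mF b))
  rmorphN opprK (pairingC (mX _ _ _ (mG a)) (mF b)).
Qed.

Lemma tuple_pairing_eigen (c d : C) F G : (forall i, mo (F i)) -> (forall i, mo (G i)) ->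
  (forall i, Omega F i = c *: F i) -> (forall i, Omega G i = d *: G i) ->
  d^*%C = d -> c != d -> tuple_pairing F G = 0.
Proof.
move=> mF mG oF oG dr cd; have := tuple_pairing_Omega mF mG.
have -> : tuple_pairing (Omega F) G = c * tuple_pairing F G.
  rewrite /tuple_pairing mulr_sumr; apply: eq_bigr => i _.
  have := pairing_sum (fun=> c) (p := fun _ : 'I_1 => F i) (fun=> mF i) (mG i).
  by rewrite !big_ord1 oF.
have -> : tuple_pairing F (Omega G) = d * tuple_pairing F G.
  rewrite /tuple_pairing mulr_sumr; apply: eq_bigr => i _.
  rewrite oG (pairingC (subZ sM d (mG i)) (mF i)).
  have := pairing_sum (fun=> d) (p := fun _ : 'I_1 => G i) (fun=> mG i) (mF i).
  by rewrite !big_ord1 => ->; rewrite rmorphM /= dr (pairingC (mF i) (mG i)); congr (_ * _); exact: conjcK.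
move/eqP; rewrite -subr_eq0 -mulrBl mulf_eq0 subr_eq0 (negPf cd) /=.
by move/eqP.
Qed.

Lemma tuple_pairingD F F' G : (forall i, mo (F i)) -> (forall i, mo (F' i)) ->
  (forall i, mo (G i)) -> tuple_pairing (fun i => F i + F' i) G = tuple_pairing F G + tuple_pairing F' G.
Proof.
move=> mF mF' mG; rewrite /tuple_pairing -big_split; apply: eq_bigr => i _ /=.
by rewrite -[F i]scale1r pairingP // mul1r scale1r.
Qed.

Lemma mid_orth F p : (forall i, mo (F i)) -> mo p ->
  tuple_pairing (fun i => F i - iota1 k (comp1 k F) i) (iota1 k p) = 0.
Proof.
move=> mF mp; have [n0 n2 m2 c2] := dim_neq0 R k m3.
have DF i : Dir (F i) = 0 by case: (mF i).
have EF i : Eul (F i) = k.+1%:R *: F i by exact: (mono_Eul (mF i)).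
have [_ _ Dp] := mp; have Ep := mono_Eul mp.
have m1 i : mo (iota1 k p i) by exact: mono_iota1.
have mc2 : mono S k (comp2 k F) by exact: mono_comp2.
have mc3 : mono S k.+2 (comp3 k F) by exact: mono_comp3.
have ma i : mo (iota2 k (comp2 k F) i) by exact: mono_iota2.
have mb i : mo (dop i (comp3 k F)) by exact: mono_d.
have mc i : mo (comp4 k F i) by exact: mono_comp4.
have dr : (- ((M - 1) / 2 : C))^*%C = - ((M - 1) / 2).
  by rewrite rmorphN fmorph_div rmorphB !rmorph_nat rmorph1.
have two0 : (2%:R : C) != 0 by exact: two_neq0.
pose l : C := - ((M - 1) / 2).
have za : tuple_pairing (iota2 k (comp2 k F)) (iota1 k p) = 0.
  apply: (tuple_pairing_eigen ma m1 (c := - (M + J - 2^-1)) (d := l)) => // [i|i|].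
  - by apply: Omega_iota2 => //; [exact: Dir_comp2|exact: Eul_comp2].
  - exact: Omega_iota1.
  rewrite -subr_eq0 /l.
  have -> : - (M + J - 2^-1) - - ((M - 1) / 2) = - (M + 2%:R * J) / 2 by field.
  by rewrite mulf_neq0 ?oppr_eq0 ?invr_neq0.
have zb : tuple_pairing (fun i => dop i (comp3 k F)) (iota1 k p) = 0.
  apply: (tuple_pairing_eigen mb m1 (c := J + 3%:R / 2%:R) (d := l)) => // [i|i|].
  - by apply: Omega_grad => //; [exact: Dir_comp3|exact: Eul_comp3].
  - exact: Omega_iota1.
  rewrite -subr_eq0 /l.
  have -> : J + 3%:R / 2%:R - - ((M - 1) / 2) = (M + 2%:R * J + 2) / 2 by field.
  by rewrite mulf_neq0 ?invr_neq0.
have zc : tuple_pairing (comp4 k F) (iota1 k p) = 0.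
  apply: (tuple_pairing_eigen mc m1 (c := - 2^-1) (d := l)) => // [i|i|].
  - apply: Omega_simplicial; [exact: cone_comp4|exact: cond_comp4|exact: conx_comp4].
  - exact: Omega_iota1.
  rewrite -subr_eq0 /l.
  have -> : (- 2^-1 : C) - - ((M - 1) / 2) = (M - 2) / 2 by field.
  by rewrite mulf_neq0 ?invr_neq0.
transitivity (tuple_pairing (fun i => iota2 k (comp2 k F) i +
    (dop i (comp3 k F) + comp4 k F i)) (iota1 k p)).
  apply: eq_bigr => i _; congr (pairing _ _).
  by rewrite {1}(decompE k F i); lin_solve (R[i]) ltac:(ring).
have mbc i : mo (dop i (comp3 k F) + comp4 k F i) by exact: (subD sM).
by rewrite (tuple_pairingD ma mbc m1) (tuple_pairingD mb mc m1) za zb zc !addr0.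
Qed.

Lemma orth_proj_mid H : MkR S k.+1 H ->
  exists2 q, orth_proj (tensor_inner h (n := m)) (mid_comp S k) H q &
             mid_proj k q = mid_proj k H.
Proof.
move=> hH; pose F := tpoly H; have hF i : mo (F i) by exact: (tpoly_mono hH).
have HF : H = tval F by rewrite (tpolyK hH).
have m1 : mo (comp1 k F) by exact: mono_comp1.
exists (tval (iota1 k (comp1 k F))).
  split; first by exists (comp1 k F).
  move=> _ [p mp ->]; apply: etrans (mid_orth hF mp); rewrite HF.
  by apply: eq_bigr => i _.
rewrite HF !mid_proj_tval (monoT_iota1 m3 m1) /comp1 scalerA mulfV ?scale1r //.
exact: c1_neq0.
Qed.

End Orthogonality.
End Gradient.

(** * Spinor spaces and the even subalgebra *)
Section Spinors.
Variables (R : realType) (m : nat).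
Local Notation C := R[i].
Local Notation Cl := (clifford C m).
Local Notation V := (cl_poly R m).
Implicit Types (p q : V) (a b c : Cl) (i j : 'I_m) (S L : set Cl).

Definition even_minimal L : Prop := [/\ even_stable L, L <> [set 0] &
  forall L', even_stable L' -> L' `<=` L -> L' = [set 0] \/ L' = L].

Lemma even_stable_basis L (A : {set 'I_m}) c : even_stable L -> ~~ odd #|A| ->
  L c -> L (cl_basis C A * c).
Proof.
move=> [sL eL]; rewrite cl_basis_prod cardE; move: (enum A) => r.
have [n] := ubnP (size r); elim: n r => // n IH [|y [|z r]] //=.
  by rewrite big_nil mul1r.
rewrite ltnS negbK => rn er Lc; rewrite !big_cons -!mulrA mulrA.
by apply: eL; apply: IH => //; exact: ltnW.
Qed.

Lemma gen_left_ideal L : @Defs.subspace R Cl L ->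
  (forall i c, L c -> L (gen i * c)) -> left_ideal L.
Proof.
move=> sL gL; split; [exact: sub0 sL|by move=> a b; exact: (subD sL)|].
move=> a b Lb; elim/(@cl_ind C m): a => [|k x y|i x]; first by rewrite mul1r.
  by rewrite mulrDl -scalerAl; exact: (subP sL).
by rewrite -mulrA; exact: gL.
Qed.

Lemma big_addb_odd (f : 'I_m -> bool) :
  \big[addb/false]_j f j = odd (\sum_j f j)%N.
Proof.
rewrite (big_morph odd oddD (erefl _)).
by apply: eq_bigr => j _; rewrite oddb.
Qed.

Lemma cl_sign_full i :
  cl_sign [set i]%SET [set: 'I_m]%SET (+) cl_sign [set: 'I_m]%SET [set i]%SET =
  odd m.+1.
Proof.
have -> : cl_sign [set i]%SET [set: 'I_m]%SET = odd (\sum_(j < m) (j <= i))%N.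
  rewrite /cl_sign big_set1 -big_addb_odd; by apply: eq_bigl => j; rewrite inE.
have -> : cl_sign [set: 'I_m]%SET [set i]%SET = odd (\sum_(j < m) (i <= j))%N.
  rewrite /cl_sign -big_addb_odd; apply: eq_big => j; first by rewrite inE.
  by rewrite big_set1.
rewrite -oddD -big_split /=.
rewrite (eq_bigr (fun j => 1 + (i == j))%N); last first.
  by move=> j _; rewrite -(inj_eq val_inj) /=; case: ltngtP.
rewrite big_split /= sum1_card card_ord (bigD1 i) //= eqxx big1.
  by rewrite addn0 addn1.
by move=> j /negPf; rewrite eq_sym => ->.
Qed.

(** A multiple of e_1 ... e_m. It commutes or anticommutes with the generators
according to the parity of m; its product with a generator has degree m - 1,
which is even when m is odd. *)
Lemma pseudoscalar : exists w : Cl, [/\ w * w = 1,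
  forall i, gen i * w = (-1) ^+ odd m.+1 *: (w * gen i) &
  forall i, exists2 A : {set 'I_m}, #|A| = m.-1 &
    exists c : C, gen i * w = c *: cl_basis C A].
Proof.
pose om : Cl := cl_basis C [set: 'I_m]%SET.
have [w [z [wE ww]]] : exists w (z : C), w = z *: om /\ w * w = 1.
  have := cl_basisM C [set: 'I_m]%SET [set: 'I_m]%SET; rewrite -/om.
  have -> : symdiff [set: 'I_m]%SET [set: 'I_m]%SET = finset.set0.
    by apply/setP => i; rewrite !inE.
  rewrite cl_basis0; case: (cl_sign _ _) => oo; last first.
    by exists om, 1; rewrite scale1r; split => //; rewrite oo scale1r.
  exists ('i%C *: om), 'i%C; split => //.
  by rewrite -scalerAl -scalerAr scalerA oo expr1 scalerA -expr2 sqr_i mulrNN mulr1 scale1r.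
exists w; split => // i.
  have sC : symdiff [set i]%SET [set: 'I_m]%SET = symdiff [set: 'I_m]%SET [set i]%SET.
    exact: symdiffC.
  have e : gen i * om = (-1) ^+ odd m.+1 *: (om * gen i).
    rewrite /om gen_basis !cl_basisM sC -(cl_sign_full i) scalerA.
    by rewrite -signr_addb -addbA addbb addbF.
  by rewrite wE -scalerAr -scalerAl e !scalerA mulrC.
exists (symdiff [set i]%SET [set: 'I_m]%SET).
  have -> : symdiff [set i]%SET [set: 'I_m]%SET = (~: [set i])%SET.
    by apply/setP => j; rewrite !inE addbT.
  by rewrite cardsC1 card_ord.
by rewrite wE -scalerAr gen_basis cl_basisM scalerA; eexists.
Qed.

Lemma lmul_w_mono S k w (z : C) p : left_ideal S ->
  (forall i, gen i * w = z *: (w * gen i)) -> mono S k p -> mono S k (lmul w p).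
Proof.
move=> [S0 SD SM] gw [hp vp Dp]; split; first exact: homo_lmul.
  by move=> u; rewrite lmulE; apply: SM.
have -> : Dir (lmul w p) = z *: lmul w (Dir p).
  rewrite /Dir /cone linear_sum scaler_sumr; apply: eq_bigr => i _ /=.
  rewrite dop_lmul /eop !lmulA; apply: cl_poly_eq => u.
  by rewrite cl_polyZE !lmulE gw -scalerAl.
by rewrite Dp linear0 scaler0.
Qed.

(** The pseudoscalar is central, so it acts on S by a scalar; an odd element then
acts on S as an even one, and spaces stable under the even subalgebra are left
ideals. *)
Lemma minimal_odd S : odd m -> minimal_left_ideal S -> even_minimal S.
Proof.
move=> om [lS S0 minS]; have [w [ww gw wA]] := pseudoscalar.
have [_ SD SM] := lS; have sS := left_ideal_subspace lS.
have wc i : gen i * w = w * gen i by rewrite gw /= om scale1r.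
split => // [|L [sL eL] LS]; first exact: left_ideal_even.
have [eps ep] : exists eps : C, forall c, S c -> c = eps *: (w * c).
  pose P := [set c | S c /\ c = w * c].
  have lP : left_ideal P.
    apply: gen_left_ideal.
      split; first by split; [exact: sub0 sS|rewrite mulr0].
      move=> z x y [Sx wx] [Sy wy]; split; first exact: (subP sS).
      by rewrite mulrDr -scalerAr -wx -wy.
    by move=> i c [Sc wE]; split; [exact: SM|rewrite mulrA -wc -mulrA -wE].
  have [P0|PS] := minS P lP (fun c Pc => Pc.1); last first.
    by exists 1 => c; rewrite -PS => -[_ <-]; rewrite scale1r.
  exists (-1) => c Sc; have : P (c + w * c).
    split; first by apply: SD => //; exact: SM.
    by rewrite mulrDr mulrA ww mul1r addrC.
  by rewrite P0 => /eqP; rewrite addr_eq0 scaleN1r => /eqP.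
suff lL : left_ideal L by exact: minS.
apply: gen_left_ideal => // i c Lc; have [A cA [z gz]] := wA i.
rewrite {1}(ep c (LS c Lc)) -scalerAr mulrA gz -scalerAl.
apply: (subZ sL); apply: (subZ sL); apply: even_stable_basis => //.
by rewrite cA; case: (m) om.
Qed.

(** For even m these are the half-spinors. *)
Definition chiral_half S w (eps : C) : set Cl := [set c | S c /\ w * c = eps *: c].

(** For L stable under the even subalgebra, L + e_1 L is a left ideal, hence 0 or
S; as e_1 exchanges the two halves, L is 0 or the whole half. *)
Lemma minimal_half S w (eps : C) (i0 : 'I_m) : ~~ odd m -> minimal_left_ideal S ->
  w * w = 1 -> (forall i, gen i * w = - (w * gen i)) -> eps * eps = 1 ->
  even_minimal (chiral_half S w eps).
Proof.
move=> em [lS S0 minS] ww gw ee; have [_ SD SM] := lS.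
have sS := left_ideal_subspace lS.
have wg i : w * gen i = - (gen i * w) by rewrite gw opprK.
have sH z : @Defs.subspace R Cl (chiral_half S w z).
  split; first by split; [exact: sub0 sS|rewrite mulr0 scaler0].
  move=> d x y [Sx wx] [Sy wy]; split; first exact: (subP sS).
  by rewrite mulrDr -scalerAr wx wy scalerDr !scalerA mulrC.
have flip z i c : chiral_half S w z c -> chiral_half S w (- z) (gen i * c).
  move=> [Sc wc]; split; first exact: SM.
  by rewrite mulrA wg mulNr -mulrA wc -scalerAr scaleNr.
have two0 : (2%:R : C) != 0 := two_neq0 R.
have ne z : z * z = 1 -> chiral_half S w z <> [set 0] .
  move=> zz H0; have nz c : S c -> c + z *: (w * c) = 0.
    move=> Sc; suff : chiral_half S w z (c + z *: (w * c)) by rewrite H0.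
    split; first by apply: SD => //; apply: (subZ sS); exact: SM.
    by rewrite mulrDr -scalerAr mulrA ww mul1r scalerDr scalerA zz scale1r addrC.
  apply: S0; apply/seteqP; split => [c Sc|c ->]; last exact: sub0 sS.
  have h : chiral_half S w (- z) c.
    split => //; apply/eqP; rewrite scaleNr -subr_eq0 opprK addrC.
    rewrite -[w * c]scale1r -{1}zz -scalerA -scalerDr.
    by rewrite (nz c Sc) scaler0.
  have := flip _ i0 _ h; rewrite opprK H0 => g0.
  by rewrite /set1 /= -[c]mul1r -[1]opprK -(gen_sq _ i0) mulNr -mulrA g0 mulr0 oppr0.
have eH : even_stable (chiral_half S w eps).
  split; first exact: sH.
  move=> a b c Hc; rewrite -mulrA -[eps]opprK.
  by apply: (flip (- eps)); apply: flip.
split; [exact: eH|exact: ne|].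
move=> L [sL eL] LH; pose e : Cl := gen i0.
have eE (c : Cl) : e * (e * c) = - c by rewrite mulrA gen_sq mulN1r.
pose J := [set c : Cl | exists2 l, L l & exists2 l', L l' & c = l + e * l'].
have lJ : left_ideal J.
  apply: gen_left_ideal.
    split; first by exists 0; [exact: sub0 sL|exists 0; [exact: sub0 sL|rewrite mulr0 addr0]].
    move=> d _ _ [x Lx [x' Lx' ->]] [y Ly [y' Ly' ->]].
    exists (d *: x + y); first exact: (subP sL).
    exists (d *: x' + y'); first exact: (subP sL).
    by rewrite mulrDr -scalerAr scalerDr addrACA.
  move=> i _ [x Lx [x' Lx' ->]]; exists (gen i * e * x'); first exact: eL.
  exists (- (e * gen i * x)); first by apply: (subN sL); exact: eL.
  have -> : gen i * e * x' = gen i * (e * x') by rewrite mulrA.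
  have -> : e * - (e * gen i * x) = gen i * x by rewrite mulrN -(mulrA e) eE opprK.
  by rewrite mulrDr addrC.
have JS : J `<=` S.
  move=> _ [x /LH[Sx _] [x' /LH[Sx' _] ->]]; apply: SD => //; exact: SM.
have LJ : L `<=` J.
  by move=> x Lx; exists x => //; exists 0; [exact: sub0 sL|rewrite mulr0 addr0].
have [J0|JE] := minS J lJ JS.
  left; apply/seteqP; split=> [x /LJ|x ->]; last exact: sub0 sL.
  by rewrite J0.
right; apply/seteqP; split => // c Hc; have [Sc wc] := Hc.
have : J c by rewrite JE.
move=> [l Ll [l' Ll' cE]]; have [_ wl] := LH _ Ll.
have [_ wl'] := flip _ i0 _ (LH _ Ll').
have e0 : e * l' = 0.
  move: wc; rewrite cE mulrDr wl wl' scalerDr scaleNr => /addrI/eqP.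
  rewrite eq_sym -subr_eq0 opprK -mulr2n -scaler_nat scaler_eq0 (negPf two0) /=.
  rewrite scaler_eq0 => /orP[/eqP ez|/eqP //].
  by move: ee; rewrite ez mul0r => /eqP; rewrite eq_sym oner_eq0.
by rewrite cE e0 addr0.
Qed.

(** For even m the pseudoscalar anticommutes with the Dirac operator, so the
projections on the two halves preserve monogenicity. *)
Lemma minimal_split S k p : (0 < m)%N -> minimal_left_ideal S -> mono S k p ->
  exists p1 p2 L1 L2, [/\ p = p1 + p2, L1 `<=` S, L2 `<=` S,
    even_minimal L1 /\ mono L1 k p1 & even_minimal L2 /\ mono L2 k p2].
Proof.
move=> m0 mS hp; have [lS S0 minS] := mS; have sS := left_ideal_subspace lS.
case om: (odd m).
  have eS := minimal_odd om mS.
  exists p, 0, S, S; split; rewrite ?addr0 //; split => //.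
  exact: sub0 (mono_subspace sS k).
have [w [ww gw _]] := pseudoscalar.
have {}gw i : gen i * w = - (w * gen i) by rewrite gw /= om scaleN1r.
have hw : mono S k (lmul w p).
  by apply: (lmul_w_mono lS (z := -1)) => // i; rewrite gw scaleN1r.
pose q (e : C) : V := 2^-1 *: (p + e *: lmul w p).
have hq e : e * e = 1 -> mono (chiral_half S w e) k (q e).
  move=> ee; have sM := mono_subspace sS k.
  have [h1 h2 h3] : mono S k (q e).
    by apply: (subZ sM); apply: (subD sM) => //; apply: (subZ sM).
  split=> // u; split; first exact: h2.
  rewrite /q cl_polyZE cl_polyDE cl_polyZE lmulE -scalerAr mulrDr -scalerAr mulrA.
  by rewrite ww mul1r !scalerDr !scalerA mulrCA ee mulr1 addrC [e * _]mulrC.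
have i0 : 'I_m := Ordinal m0.
have e1 : (1 : C) * 1 = 1 by rewrite mulr1.
have e2 : (-1 : C) * -1 = 1 by rewrite mulrNN mulr1.
have nm : ~~ odd m by rewrite om.
exists (q 1), (q (-1)), (chiral_half S w 1), (chiral_half S w (-1)); split.
- by rewrite /q; lin_solve (R[i]) ltac:(field).
- by move=> c [].
- by move=> c [].
- by split; [exact: minimal_half|exact: hq].
- by split; [exact: minimal_half|exact: hq].
Qed.

End Spinors.

(** * Minimality of the ideal of Dirac spinors *)
Section TwoGenerators.
Variables (R : realType) (A : algType R[i]).
Implicit Types (x y t v : A) (z : R[i]).

Lemma lin_mul z z' x y t v : (x + z *: y) * (t + z' *: v) =
  x * t + z' *: (x * v) + z *: (y * t) + (z * z') *: (y * v).
Proof. by rewrite mulrDl !mulrDr -!scalerAl -!scalerAr !scalerA !addrA. Qed.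

Lemma mul_subE x y t : (x - y) * t = -1 *: (y * t) + x * t.
Proof. by rewrite mulrBl scaleN1r addrC. Qed.

Lemma mul_scale_addE z x y t :
  (z *: (x + y)) * t = z *: (x * t) + (z *: (y * t) + 0).
Proof. by rewrite -scalerAl mulrDl scalerDr addr0. Qed.

Let up x y : A := 2^-1 *: (x - 'i%C *: y).
Let down x y : A := - (2^-1 *: (x + 'i%C *: y)).

Let upE x y : up x y = 2^-1 *: x + (- (2^-1 * 'i%C)) *: y.
Proof. by rewrite /up; lin_solve (R[i]) ltac:(ring). Qed.
Let downE x y : down x y = - 2^-1 *: x + (- (2^-1 * 'i%C)) *: y.
Proof. by rewrite /down; lin_solve (R[i]) ltac:(ring). Qed.

Section FourAnticommuting.
Variables x y t v : A.
Hypotheses (xt : x * t = - (t * x)) (xv : x * v = - (v * x))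
  (yt : y * t = - (t * y)) (yv : y * v = - (v * y)).

Let lin_anti z0 z1 z2 z3 : (z0 *: x + z1 *: y) * (z2 *: t + z3 *: v) =
  - ((z2 *: t + z3 *: v) * (z0 *: x + z1 *: y)).
Proof.
rewrite !lin_mul -!scalerAl -!scalerAr xt xv yt yv.
by lin_solve (R[i]) ltac:(ring).
Qed.

Lemma up_anti : up x y * up t v = - (up t v * up x y).
Proof. by rewrite !upE lin_anti. Qed.
Lemma down_anti : down x y * down t v = - (down t v * down x y).
Proof. by rewrite !downE lin_anti. Qed.
Lemma up_down_anti : up x y * down t v = - (down t v * up x y).
Proof. by rewrite upE downE lin_anti. Qed.
End FourAnticommuting.

Lemma imag_sq : 'i%C * 'i%C = -1 :> R[i]. Proof. by rewrite -expr2 sqr_i. Qed.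

Section Pair.
Variables x y : A.
Hypotheses (xx : x * x = - 1) (yy : y * y = - 1) (xy : x * y = - (y * x)).

Let lin_sq z : z * z = -1 -> (x + z *: y) * (x + z *: y) = 0.
Proof.
by move=> zz; rewrite lin_mul xx yy zz xy; lin_solve (R[i]) ltac:(ring).
Qed.

Lemma up_sq : up x y * up x y = 0.
Proof.
rewrite /up -scaleNr -scalerAl -scalerAr lin_sq ?scaler0 //.
by rewrite mulrNN imag_sq.
Qed.

Lemma down_sq : down x y * down x y = 0.
Proof.
by rewrite /down mulrNN -scalerAl -scalerAr lin_sq ?scaler0 // imag_sq.
Qed.

Lemma up_down : up x y * down x y + down x y * up x y = 1.
Proof.
rewrite /up /down -scaleNr mulrN mulNr -!scalerAl -!scalerAr !lin_mul xx yy xy mulrN mulNr imag_sq.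
by lin_solve (R[i]) ltac:(field).
Qed.

Lemma up_down_first : x = up x y - down x y.
Proof. by rewrite /up /down; lin_solve (R[i]) ltac:(field). Qed.

Lemma up_down_second : y = 'i%C *: (up x y + down x y).
Proof.
transitivity (- ('i%C * 'i%C) *: y); first by rewrite imag_sq opprK scale1r.
by rewrite /up /down; lin_solve (R[i]) ltac:(field).
Qed.
End Pair.
End TwoGenerators.

Section Fermions.
Variables (R : realType) (A : algType R[i]) (n : nat) (f g : 'I_n -> A).
Local Notation C := R[i].
Implicit Types (j l : 'I_n) (r : seq 'I_n) (x y : A).
Hypotheses (ff_anti : forall j l, j != l -> f j * f l = - (f l * f j))
  (gg_anti : forall j l, j != l -> g j * g l = - (g l * g j))
  (fg_anti : forall j l, j != l -> f j * g l = - (g l * f j))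
  (ff0 : forall j, f j * f j = 0) (gg0 : forall j, g j * g j = 0)
  (fg1 : forall j, f j * g j + g j * f j = 1).
Local Notation P j := (f j * g j).

Let comm_P (x : A) j : x * f j = - (f j * x) -> x * g j = - (g j * x) ->
  x * P j = P j * x.
Proof. by move=> xf xg; rewrite mulrA xf mulNr -(mulrA (f j) x) xg mulrN opprK mulrA. Qed.

Let f_P j l : j != l -> f j * P l = P l * f j.
Proof. by move=> jl; apply: comm_P; [exact: ff_anti|exact: fg_anti]. Qed.
Let g_P j l : j != l -> g j * P l = P l * g j.
Proof.
move=> jl; apply: comm_P; last exact: gg_anti.
by rewrite fg_anti ?opprK // eq_sym.
Qed.

Lemma f_prod j r : j \in r -> f j * \prod_(l <- r) P l = 0.
Proof.
elim: r => // l r IH; rewrite big_cons mulrA.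
have [<-|jl] := eqVneq j l; first by rewrite mulrA ff0 !mul0r.
by rewrite inE (negPf jl) /= => /IH h; rewrite f_P // -mulrA h mulr0.
Qed.

Lemma prod_comm (x : A) r : (forall l, l \in r -> x * P l = P l * x) ->
  x * \prod_(l <- r) P l = \prod_(l <- r) P l * x.
Proof.
elim: r => [|l r IH] h; first by rewrite big_nil mulr1 mul1r.
rewrite big_cons mulrA h ?mem_head // -!mulrA IH // => l' lr.
by apply: h; rewrite inE lr orbT.
Qed.

Lemma prod_g j r : j \in r -> \prod_(l <- r) P l * g j = 0.
Proof.
elim: r => // l r IH; rewrite big_cons -mulrA.
have [jr _|jr] := boolP (j \in r); first by rewrite IH // mulr0.
rewrite inE (negPf jr) orbF => /eqP <-; rewrite -prod_comm => [|l' lr].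
  by rewrite mulrA -(mulrA (f j)) gg0 mulr0 mul0r.
by apply: g_P; apply: contraNneq jr => ->.
Qed.

Lemma prod_fix y r : (forall j, f j * y = 0) -> \prod_(l <- r) P l * y = y.
Proof.
move=> h; elim: r => [|l r IH]; first by rewrite big_nil mul1r.
rewrite big_cons -mulrA IH; have := fg1 l => /(congr1 (fun x => x * y)).
by rewrite mulrDl mul1r -[g l * f l * y]mulrA h mulr0 addr0.
Qed.

(** If f g Q = 0 with f, g commuting with Q, then multiplying by g on the left and
f on the right gives g f Q = 0, so that Q = (f g + g f) Q = 0. *)
Lemma prod_neq0 r : uniq r -> \prod_(l <- r) P l != 0.
Proof.
elim: r => [|j r IH]; first by rewrite big_nil oner_eq0.
rewrite /= big_cons => /andP[jr ur]; apply/eqP => h0.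
move/eqP: (IH ur); apply; pose Q := \prod_(l <- r) P l.
have cQ x : (forall l, l != j -> x * P l = P l * x) -> x * Q = Q * x.
  by move=> h; apply: prod_comm => l lr; apply: h; apply: contraNneq jr => <-.
have fQ : f j * Q = Q * f j by apply: cQ => l lj; apply: f_P; rewrite eq_sym.
have gQ : g j * Q = Q * g j by apply: cQ => l lj; apply: g_P; rewrite eq_sym.
have gf0 : g j * f j * Q = 0.
  have gfg : g j * f j * g j = g j.
    have := congr1 (fun x => x * g j) (fg1 j).
    by rewrite mulrDl mul1r -[f j * g j * g j]mulrA gg0 mulr0 add0r.
  have : g j * (P j * Q) * f j = 0 by rewrite h0 mulr0 mul0r.
  by rewrite !mulrA gfg -mulrA -fQ mulrA.
by rewrite -/Q -[Q]mul1r -(fg1 j) mulrDl gf0 addr0; exact: h0.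
Qed.

Let I : A := \prod_j P j.

Lemma f_I j : f j * I = 0.
Proof. by apply: f_prod; rewrite mem_index_enum. Qed.
Lemma I_g j : I * g j = 0.
Proof. by apply: prod_g; rewrite mem_index_enum. Qed.
Lemma I_fix y : (forall j, f j * y = 0) -> I * y = y.
Proof. exact: prod_fix. Qed.
Lemma I_neq0 : I != 0.
Proof. by apply: prod_neq0; exact: index_enum_uniq. Qed.

(** The span of the words g_j ... g_l I. It is a left ideal, hence all of A I,
and I g_j = 0 makes I A I a line. *)
Inductive creation : A -> Prop :=
| CreZ (c : C) : creation (c *: I)
| CreD x y : creation x -> creation y -> creation (x + y)
| CreG j x : creation x -> creation (g j * x).

Lemma creationZ c x : creation x -> creation (c *: x).
Proof.
elim=> {x} [d|x y _ hx _ hy|j x _ hx]; first by rewrite scalerA; exact: CreZ.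
  by rewrite scalerDr; exact: CreD.
by rewrite scalerAr; exact: CreG.
Qed.

Lemma creation_f j x : creation x -> creation (f j * x).
Proof.
elim=> {x} [d|x y _ hx _ hy|l x cx hx].
- by rewrite -scalerAr f_I scaler0 -(scale0r I); exact: CreZ.
- by rewrite mulrDr; exact: CreD.
have [<-|jl] := eqVneq j l.
  have -> : f j * (g j * x) = x + -1 *: (g j * (f j * x)).
    by rewrite !mulrA -[X in X + _]mul1r -(fg1 j) mulrDl scaleN1r addrK.
  by apply: CreD => //; apply: creationZ; exact: CreG.
have -> : f j * (g l * x) = -1 *: (g l * (f j * x)).
  by rewrite !mulrA fg_anti // mulNr scaleN1r.
by apply: creationZ; exact: CreG.
Qed.

Lemma creation_I x : creation x -> exists c : C, I * x = c *: I.
Proof.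
elim=> {x} [d|x y _ [c hx] _ [d hy]|j x _ [c hx]].
- by exists d; rewrite -scalerAr I_fix // => j; exact: f_I.
- by exists (c + d); rewrite mulrDr hx hy scalerDl.
- by exists 0; rewrite mulrA I_g mul0r scale0r.
Qed.

Hypothesis words : forall Q : A -> Prop, Q 1 ->
  (forall (c : C) a b, Q a -> Q b -> Q (c *: a + b)) ->
  (forall j a, Q a -> Q (f j * a)) -> (forall j a, Q a -> Q (g j * a)) ->
  forall a, Q a.

Lemma creation_all a : creation (a * I).
Proof.
apply: (words (Q := fun a => creation (a * I))) => [|c x y hx hy|j x hx|j x hx].
- by rewrite mul1r -[I]scale1r; exact: CreZ.
- by rewrite mulrDl -scalerAl; apply: CreD => //; exact: creationZ.
- by rewrite -mulrA; exact: creation_f.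
- by rewrite -mulrA; exact: CreG.
Qed.

(** Applying the annihilation operators as long as they do not give zero ends on a
nonzero vector that all of them kill; I fixes that vector, which is therefore a
multiple of I. *)
Lemma vacuum b : b * I != 0 -> exists a, a * (b * I) = I.
Proof.
move=> b0; have [y [a yE] [y0 fy]] : exists2 y, exists a, y = a * (b * I) &
    y != 0 /\ forall j, j \in enum 'I_n -> f j * y = 0.
  elim: (enum _) => [|j r [y [a yE] [y0 fy]]].
    by exists (b * I); [exists 1; rewrite mul1r|split].
  have [e|e] := eqVneq (f j * y) 0.
    exists y; first by exists a.
    by split => // l; rewrite inE => /predU1P[->|/fy].
  exists (f j * y); first by exists (f j * a); rewrite yE mulrA.
  split=> // l; rewrite inE mulrA; have [-> _|lj /= lr] := eqVneq l j.
    by rewrite ff0 mul0r.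
  by rewrite ff_anti // mulNr -mulrA fy // mulr0 oppr0.
have {}fy j : f j * y = 0 by apply: fy; rewrite mem_enum.
have [c cE] := creation_I (creation_all (a * b)).
have yI : y = c *: I by rewrite -[LHS](I_fix fy) yE (mulrA a) cE.
have c0 : c != 0 by apply: contraNneq y0 => c0; rewrite yI c0 scale0r.
by exists (c^-1 *: a); rewrite -scalerAl -yE yI scalerA mulVf // scale1r.
Qed.

End Fermions.

Section Dirac.
Variables (R : realType) (m : nat).
Local Notation C := R[i].
Local Notation Cl := (clifford C m).
Local Notation n := m./2.
Implicit Types (a b c y : Cl) (j l : 'I_n) (r : seq 'I_n).
Local Notation f := (@witt R m).
Local Notation g := (@witt_dag R m).

Local Notation I := (@primitive_idempotent R m).

Lemma fst_idx_inj j l : (fst_idx j == fst_idx l) = (j == l).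
Proof. by rewrite -(inj_eq val_inj). Qed.
Lemma snd_idx_inj j l : (snd_idx j == snd_idx l) = (j == l).
Proof. by rewrite -(inj_eq val_inj) /= eqn_add2r. Qed.
Lemma fst_snd_idx j l : (fst_idx j == snd_idx l) = false.
Proof.
apply/negbTE; rewrite -(inj_eq val_inj) /= neq_ltn.
by rewrite (leq_trans (ltn_ord j)) // leq_addl.
Qed.

Let anti11 j l : j != l -> gen (fst_idx j) * gen (fst_idx l) =
  - (gen (fst_idx l) * gen (fst_idx j)) :> Cl.
Proof. by move=> jl; apply: gen_anti; rewrite fst_idx_inj. Qed.
Let anti22 j l : j != l -> gen (snd_idx j) * gen (snd_idx l) =
  - (gen (snd_idx l) * gen (snd_idx j)) :> Cl.
Proof. by move=> jl; apply: gen_anti; rewrite snd_idx_inj. Qed.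
Let anti12 j l : gen (fst_idx j) * gen (snd_idx l) =
  - (gen (snd_idx l) * gen (fst_idx j)) :> Cl.
Proof. by apply: gen_anti; rewrite fst_snd_idx. Qed.
Let anti21 j l : gen (snd_idx j) * gen (fst_idx l) =
  - (gen (fst_idx l) * gen (snd_idx j)) :> Cl.
Proof. by apply: gen_anti; rewrite eq_sym fst_snd_idx. Qed.

Lemma ff_anti j l : j != l -> f j * f l = - (f l * f j).
Proof.
move=> jl.
exact: (up_anti (anti11 jl) (anti12 j l) (anti21 j l) (anti22 jl)).
Qed.

Lemma gg_anti j l : j != l -> g j * g l = - (g l * g j).
Proof.
move=> jl.
exact: (down_anti (anti11 jl) (anti12 j l) (anti21 j l) (anti22 jl)).
Qed.

Lemma fg_anti j l : j != l -> f j * g l = - (g l * f j).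
Proof.
move=> jl.
exact: (up_down_anti (anti11 jl) (anti12 j l) (anti21 j l) (anti22 jl)).
Qed.

Lemma ff0 j : f j * f j = 0.
Proof. exact: (up_sq (gen_sq _ _) (gen_sq _ _) (anti12 j j)). Qed.

Lemma gg0 j : g j * g j = 0.
Proof. exact: (down_sq (gen_sq _ _) (gen_sq _ _) (anti12 j j)). Qed.

Lemma fg1 j : f j * g j + g j * f j = 1.
Proof. exact: (up_down (gen_sq _ _) (gen_sq _ _) (anti12 j j)). Qed.

Lemma e1E j : gen (fst_idx j) = f j - g j.
Proof. exact: up_down_first. Qed.
Lemma e2E j : gen (snd_idx j) = 'i%C *: (f j + g j).
Proof. exact: up_down_second. Qed.

Lemma idx_cases (i : 'I_m) : ~~ odd m ->
  exists j, i = fst_idx j \/ i = snd_idx j.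
Proof.
move=> em; have mE : m = (n + n)%N by rewrite addnn -[LHS]odd_double_half (negPf em).
have [lt|ge] := ltnP i n.
  by exists (Ordinal lt); left; apply: val_inj.
have lt : (i - n < n)%N by rewrite ltn_subLR // -mE.
by exists (Ordinal lt); right; apply: val_inj; rewrite /= subnK.
Qed.

Lemma dirac_minimal : ~~ odd m -> minimal_left_ideal (@dirac_spinors R m).
Proof.
move=> em; have lS : left_ideal (@dirac_spinors R m).
  split; first by exists 0; rewrite ?mul0r.
  - by move=> _ _ [a _ <-] [b _ <-]; exists (a + b); rewrite ?mulrDl.
  - by move=> a _ [b _ <-]; exists (a * b); rewrite ?mulrA.
have ind (Q : Cl -> Prop) : Q 1 -> (forall (c : C) a b, Q a -> Q b -> Q (c *: a + b)) ->
    (forall j a, Q a -> Q (f j * a)) -> (forall j a, Q a -> Q (g j * a)) -> forall a, Q a.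
  move=> Q1 QP Qf Qg; have Q0 : Q 0 by rewrite -[0](addNr 1) -scaleN1r; apply: QP.
  apply: (@cl_ind C m Q Q1 QP) => i a Qa; have [j [->|->]] := idx_cases i em.
    rewrite (_ : _ * a = -1 *: (g j * a) + f j * a).
      by apply: QP; [exact: Qg|exact: Qf].
    by rewrite e1E; exact: mul_subE.
  rewrite (_ : _ * a = 'i%C *: (f j * a) + ('i%C *: (g j * a) + 0)).
    by apply: (QP); [exact: Qf|apply: (QP); [exact: Qg|exact: Q0]].
  by rewrite e2E; exact: mul_scale_addE.
have I0 := I_neq0 ff_anti gg_anti fg_anti gg0 fg1.
have vac := vacuum ff_anti gg_anti fg_anti ff0 gg0 fg1 ind.
split => //.
  move=> h; have : dirac_spinors I by exists 1; rewrite ?mul1r.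
  by rewrite h => /eqP; rewrite (negPf I0).
move=> L lL LS; have [L0 LD LM] := lL.
have [Lz|] := pselect (forall x, L x -> x = 0).
  by left; apply/seteqP; split => [x /Lz|x ->].
move=> /existsNP[x /not_implyP[Lx /eqP x0]]; right.
have [b _ bI] := LS _ Lx.
have [a aI] : exists a, a * x = I by rewrite -bI; apply: vac; rewrite bI.
apply/seteqP; split => // _ [c _ <-]; rewrite -aI; apply: (LM); exact: LM.
Qed.

Lemma spinor_minimal (S : set Cl) : spinor_space S -> minimal_left_ideal S.
Proof.
rewrite /spinor_space; case om: (odd m) => // ->.
by apply: dirac_minimal; rewrite om.
Qed.

End Dirac.

(** * Torus weights *)
Section Characters.
Variable R : realType.
Local Notation C := R[i].

Definition cis (t : R) : C := cos t +i* sin t.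

Lemma cisD a b : cis (a + b) = cis a * cis b.
Proof. by rewrite /cis cosD sinD; simpc; congr (_ +i* _); rewrite addrC mulrC. Qed.

Lemma cis0 : cis 0 = 1.
Proof. by rewrite /cis cos0 sin0. Qed.

Lemma cisNK a : cis (- a) * cis a = 1.
Proof. by rewrite -cisD addNr cis0. Qed.

(** For a and b distinct, the ratio of the characters is -1 at pi / (a - b). *)
Lemma char_inj (E : lmodType C) (x : E) a b : x <> 0 ->
  (forall t, cis (a * t) *: x = cis (b * t) *: x) -> a = b.
Proof.
move=> x0 h; apply/eqP; rewrite -subr_eq0; apply/negP => /negP ab.
have := h (pi / (a - b)) => /(congr1 (fun y => cis (- (b * (pi / (a - b)))) *: y)).
rewrite !scalerA cisNK scale1r -cisD addrC -mulrBl mulrCA mulfV // mulr1.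
rewrite /cis cospi sinpi => /eqP; rewrite -subr_eq0 -{2}[x]scale1r -scalerBl.
rewrite scaler_eq0 => /orP[/eqP/(congr1 (@complex.Re R))/=|/eqP //].
by move=> /eqP; rewrite -opprD oppr_eq0 -[1 + 1]/2%:R pnatr_eq0.
Qed.

End Characters.

Section Lexicographic.
Variables (R : realType) (n : nat).
Implicit Types (x y z : 'rV[R]_n).

Lemma lex_refl x : lex_le x x. Proof. by left. Qed.

Lemma lex_trans y x z : lex_le x y -> lex_le y z -> lex_le x z.
Proof.
move=> [->//|[i [ei li]]] [<-|[j [ej lj]]]; first by right; exists i.
right; have [ij|ji|/val_inj ij] := ltngtP i j.
- by exists i; rewrite -ej //; split => // l li'; rewrite ei // ej // (ltn_trans li').
- by exists j; rewrite ei //; split => // l lj'; rewrite ei ?ej // (ltn_trans lj').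
- by exists i; split => [l lli|]; [rewrite ei // ej // -ij|rewrite (lt_trans li) // ij].
Qed.

Lemma lex_anti x y : lex_le x y -> lex_le y x -> x = y.
Proof.
move=> [//|[i [ei li]]] [//|[j [ej lj]]].
have [ij|ji|/val_inj ij] := ltngtP i j.
- by move: li; rewrite ej // ltxx.
- by move: lj; rewrite ei // ltxx.
- by move: lj; rewrite -ij => /(lt_trans li); rewrite ltxx.
Qed.

Lemma lexD z x y : lex_le x y -> lex_le (x + z) (y + z).
Proof.
move=> [->|[j [ej lj]]]; first by left.
right; exists j; split => [i ij|]; first by rewrite !mxE ej.
by rewrite !mxE ltrD2r.
Qed.

Variable l0 : 'I_n.
Hypothesis l0E : l0 = 0%N :> nat.

Lemma lex_first x y : x 0 l0 < y 0 l0 -> lex_le x y.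
Proof. by move=> xy; right; exists l0; split => // i; rewrite l0E. Qed.

Lemma lex_unit_gt0 : lex_le 0 ('e_l0 : 'rV[R]_n).
Proof. by apply: lex_first; rewrite !mxE !eqxx. Qed.

Lemma lex_unit l (b : bool) : lex_le ((-1) ^+ b *: 'e_l) ('e_l0 : 'rV[R]_n).
Proof.
have [->|ll] := eqVneq l l0.
  case: b; last by rewrite scale1r; exact: lex_refl.
  by apply: lex_first; rewrite !mxE !eqxx /= mulr1 expr1 (@lt_trans _ _ 0) ?oppr_lt0.
by apply: lex_first; rewrite !mxE !eqxx /= [l0 == l]eq_sym (negPf ll) mulr0.
Qed.

End Lexicographic.

Section Rotations.
Variables (R : realType) (m : nat).
Local Notation C := R[i].
Local Notation n := m./2.
Implicit Types (l : 'I_n) (t : R) (b : bool) (i j : 'I_m).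

Lemma fst_neq_snd l l' : fst_idx l != snd_idx l'.
Proof. by rewrite fst_snd_idx. Qed.

Lemma torusE l t :
  torus l t = rotor (fst_idx l) (snd_idx l) (cos (t / 2)) (sin (t / 2)).
Proof. by []. Qed.

Lemma torus_spin l t : spin (@torus R m l t).
Proof. by rewrite torusE; apply: rotor_spin; [exact: fst_neq_snd|exact: cos2Dsin2]. Qed.

Lemma rho1_torus l t i j : rho1 (torus l t) i j =
  if j == fst_idx l then cos t * (i == fst_idx l)%:R + sin t * (i == snd_idx l)%:R
  else if j == snd_idx l then
    cos t * (i == snd_idx l)%:R - sin t * (i == fst_idx l)%:R
  else (i == j)%:R.
Proof.
rewrite torusE (rho1_rotor _ _ _ _ (fst_neq_snd l l)) cos2Dsin2 mul1r.
have ct : cos t = cos (t / 2) ^+ 2 - sin (t / 2) ^+ 2.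
  by rewrite {1}(splitr t) cosD !expr2.
have st : sin t = 2 * cos (t / 2) * sin (t / 2).
  by rewrite {1}(splitr t) sinD; move: (sin _) (cos _) => x y; ring.
by rewrite ct st.
Qed.

Section Family.
Variable E : lmodType C.
Implicit Types H : 'I_m -> E.

Definition rot l t H i : E := \sum_j (rho1 (torus l t) i j)%:C *: H j.

Lemma rotE l t H i : rot l t H i =
  (if i == fst_idx l then (cos t)%:C *: H (fst_idx l) - (sin t)%:C *: H (snd_idx l)
   else if i == snd_idx l then
     (sin t)%:C *: H (fst_idx l) + (cos t)%:C *: H (snd_idx l)
   else H i).
Proof.
have fs := fst_neq_snd l l; have sf : snd_idx l != fst_idx l by rewrite eq_sym.
rewrite /rot (bigD1 (fst_idx l)) //= (bigD1 (snd_idx l)) //=.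
rewrite !rho1_torus !eqxx (negPf sf).
have rest : \sum_(j | (j != fst_idx l) && (j != snd_idx l))
    (rho1 (torus l t) i j)%:C *: H j =
    (if (i == fst_idx l) || (i == snd_idx l) then 0 else H i).
  case: ifP => [il|/negbT].
    rewrite big1 // => j /andP[/negPf j1 /negPf j2]; rewrite rho1_torus j1 j2.
    by case/orP: il => /eqP ->; rewrite eq_sym ?j1 ?j2 scale0r.
  rewrite negb_or => /andP[i1 i2]; rewrite (bigD1 i) ?i1 ?i2 //= big1.
    by rewrite addr0 rho1_torus (negPf i1) (negPf i2) eqxx scale1r.
  move=> j /andP[/andP[/negPf j1 /negPf j2] /negPf ji].
  by rewrite rho1_torus j1 j2 eq_sym ji scale0r.
rewrite rest; have [->|i1] := eqVneq i (fst_idx l) => /=.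
  by rewrite (negPf fs) !(mulr1, mulr0, addr0, sub0r) rmorphN scaleNr.
have [_|i2] := eqVneq i (snd_idx l) => /=; first by rewrite !(mulr1, mulr0, add0r, subr0, addr0).
by rewrite !mulr0 subr0 addr0 !scale0r !add0r.
Qed.

(** The combinations of the two coordinates of a plane that its rotations multiply
by a character. *)
Definition wpair b l H : E := H (fst_idx l) + ((-1) ^+ b * 'i%C) *: H (snd_idx l).

Lemma rot_pair b l t H : wpair b l (rot l t H) = cis ((-1) ^+ b * t) *: wpair b l H.
Proof.
have sf : snd_idx l == fst_idx l = false by rewrite eq_sym (negPf (fst_neq_snd l l)).
rewrite /wpair !rotE !eqxx sf.
have -> : cis ((-1) ^+ b * t) = (cos t)%:C + (-1) ^+ b * 'i%C * (sin t)%:C.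
  by case: b; rewrite /cis ?expr1 ?expr0 ?mulN1r ?mul1r ?cosN ?sinN; simpc.
have i2 : ((-1) ^+ b * 'i%C) * ((-1) ^+ b * 'i%C) = -1 :> C.
  by rewrite mulrACA imag_sq -signr_addb addbb mul1r.
move: ((-1) ^+ b * 'i%C) i2 => z zz.
move: (cos t)%:C (sin t)%:C (H _) (H _) => c s y x.
transitivity (c *: x + (z * s) *: x + (z * c) *: y + ((z * z) * s) *: y).
  by rewrite zz; lin_solve (R[i]) ltac:(ring).
by lin_solve (R[i]) ltac:(ring).
Qed.

Lemma rot_pair_other b l l' t H : l' != l -> wpair b l' (rot l t H) = wpair b l' H.
Proof.
move=> ll; rewrite /wpair !rotE fst_idx_inj snd_idx_inj (negPf ll).
by rewrite (negPf (fst_neq_snd _ _)) [snd_idx l' == _]eq_sym (negPf (fst_neq_snd _ _)).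
Qed.

Lemma rot_fixed l t H i : i != fst_idx l -> i != snd_idx l -> rot l t H i = H i.
Proof. by move=> /negPf i1 /negPf i2; rewrite rotE i1 i2. Qed.

Lemma pair_inj l H : wpair false l H = 0 -> wpair true l H = 0 ->
  H (fst_idx l) = 0 /\ H (snd_idx l) = 0.
Proof.
rewrite /wpair; move: (H _) (H _) => y x; rewrite expr0 expr1 mul1r mulN1r => e1 e2.
split.
  transitivity (2^-1 *: ((x + 'i%C *: y) + (x + - 'i%C *: y))).
    by lin_solve (R[i]) ltac:(field).
  by rewrite e1 e2 addr0 scaler0.
transitivity (- ('i%C * 'i%C) *: y); first by rewrite imag_sq opprK scale1r.
transitivity ((2^-1 * - 'i%C) *: ((x + 'i%C *: y) - (x + - 'i%C *: y))).
  by lin_solve (R[i]) ltac:(field).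
by rewrite e1 e2 subr0 scaler0.
Qed.

Lemma plane_cases i : (exists l, i = fst_idx l \/ i = snd_idx l) \/
  (forall l, i != fst_idx l /\ i != snd_idx l).
Proof.
have [h|h] := pselect (exists l, i = fst_idx l \/ i = snd_idx l); first by left.
right=> l; split; apply/eqP => e; apply: h; exists l; [by left|by right].
Qed.

End Family.
End Rotations.

(** * Weights of the monogenics *)
Section Weights.
Variables (R : realType) (m : nat).
Local Notation C := R[i].
Local Notation Cl := (clifford C m).
Local Notation V := (cl_poly R m).
Local Notation n := m./2.
Implicit Types (p q : V) (c : Cl) (l : 'I_n) (b : bool) (D : pred 'I_n)
  (lam mu : 'rV[R]_n) (i j : 'I_m) (S L : set Cl).

(** Restricting the condition to a set D of planes covers both the case of all planes and
that of a single one. *)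
Definition torus_weight D p lam : Prop := forall l, D l -> forall t,
  actV (torus l t) p = cis (lam 0 l * t) *: p.

Section Shift.
Variable op : 'I_m -> {linear V -> V}.
Hypothesis vop : vector_op (fun i => op i).

Let rotated l t p lam i : actV (torus l t) p = cis (lam 0 l * t) *: p ->
  cis (lam 0 l * t) *: op i p = rot l t (fun j => actV (torus l t) (op j p)) i.
Proof.
by move=> h; rewrite -linearZ /= -h vop //; exact: torus_spin.
Qed.

Let actV_wpair b l (s : clifford R m) (H : 'I_m -> V) : actV s (wpair b l H) = wpair b l (fun i => actV s (H i)).
Proof. by rewrite /wpair actVD actVZ. Qed.

Let wpairZ b l (z : C) (H : 'I_m -> V) :
  wpair b l (fun i => z *: H i) = z *: wpair b l H.
Proof. by rewrite /wpair scalerDr !scalerA mulrC. Qed.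

Let eq_wpair b l (H H' : 'I_m -> V) : H =1 H' -> wpair b l H = wpair b l H'.
Proof. by move=> HH; rewrite /wpair !HH. Qed.

Lemma wt_pair D b l p lam : torus_weight D p lam ->
  torus_weight D (wpair b l (fun i => op i p)) (lam - (-1) ^+ b *: 'e_l).
Proof.
move=> h l' Dl t; rewrite actV_wpair !mxE eqxx /=.
have e := eq_wpair b l (fun i => rotated i (h _ Dl t)); rewrite wpairZ in e.
have [ll|ll] := eqVneq l l'; last first.
  by move: e; rewrite rot_pair_other // mulr0 subr0 => <-.
move: e; rewrite -ll rot_pair mulr1 => e.
by rewrite mulrBl addrC cisD -scalerA e scalerA cisNK scale1r.
Qed.

Lemma wt_fixed D i p lam : (forall l, D l -> i != fst_idx l /\ i != snd_idx l) ->
  torus_weight D p lam -> torus_weight D (op i p) lam.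
Proof.
move=> il h l Dl t; rewrite (rotated i (h _ Dl t)).
by have [i1 i2] := il l Dl; rewrite rot_fixed.
Qed.
End Shift.

Lemma vop_d : vector_op (fun i => @dop R m i : {linear V -> V}).
Proof. exact: vector_dop. Qed.
Lemma vop_x : vector_op (fun i => @xop R m i : {linear V -> V}).
Proof. exact: vector_xop. Qed.
Lemma vop_e : vector_op (fun i => @eop R m i : {linear V -> V}).
Proof. exact: vector_eop. Qed.

Lemma sub_wpair (U : set V) b l (H : 'I_m -> V) : Defs.subspace U ->
  (forall i, U (H i)) -> U (wpair b l H).
Proof. by move=> sU hU; apply: (subD sU) => //; exact: (subZ sU). Qed.

(** If all derivatives along the isotropic directions vanish, then so do all
partial derivatives. *)
Lemma wt_lower D S k p lam : @Defs.subspace R Cl S -> mono S k.+1 p -> p <> 0 ->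
  torus_weight D p lam -> exists q lam', [/\ mono S k q, q <> 0, torus_weight D q lam' &
    lam' = lam \/ exists b l, lam' = lam - (-1) ^+ b *: 'e_l].
Proof.
move=> sS hp p0 wp; have sM := mono_subspace sS k.
have hd i : mono S k (dop i p) by exact: mono_d.
have [i di] : exists i, dop i p <> 0.
  apply: contrapT => /forallNP h; apply: p0; case: hp => hp _ _.
  by apply: (homo_inj_d hp) => i; exact: contrapT (h i).
have [[l il]|il] := plane_cases i; last first.
  by exists (dop i p), lam; split => //; [exact: (wt_fixed vop_d (fun l _ => il l))|left].
have [b pb] : exists b, wpair b l (fun i => dop i p) <> 0.
  apply: contrapT => /forallNP h; apply: di.
  have e0 := contrapT (h false); have e1 := contrapT (h true).
  have [] := pair_inj e0 e1; by case: il => ->.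
exists (wpair b l (fun i => dop i p)), (lam - (-1) ^+ b *: 'e_l); split => //.
- exact: (sub_wpair _ _ sM hd).
- exact: (wt_pair vop_d).
- by right; exists b, l.
Qed.

Definition bivector l : Cl := gen (fst_idx l) * gen (snd_idx l).
Definition eig b l c : Prop := bivector l * c = ((-1) ^+ b * 'i%C) *: c.

Lemma eig_unit b : ((-1) ^+ b * 'i%C) * ((-1) ^+ b * 'i%C) = -1 :> C.
Proof. by rewrite mulrACA imag_sq -signr_addb addbb mul1r. Qed.

Lemma bivector_sq l : bivector l * bivector l = -1.
Proof.
rewrite /bivector mulrA -(mulrA (gen (fst_idx l))) (gen_anti _ (i := snd_idx l)).
  by rewrite mulrN mulNr mulrA gen_sq mulN1r mulNr opprK gen_sq.
by rewrite eq_sym fst_neq_snd.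
Qed.

Lemma torus_cst l t c : actV (torus l t) (cpol c) =
  cpol ((cos (t / 2))%:C *: c + (sin (t / 2))%:C *: (bivector l * c)).
Proof.
apply: cl_poly_eq => u; rewrite /actV lmulE rotpE /=.
rewrite torusE complexifyD !complexifyZ complexify1 complexifyM !complexify_gen.
by rewrite mulrDl -!(scalerAl _ _ c) mul1r.
Qed.

Lemma cpolZ (z : C) c : cpol (z *: c) = z *: cpol c :> V.
Proof. exact: cl_poly_eq. Qed.

Lemma cpol_inj c c' : cpol c = cpol c' :> V -> c = c'.
Proof. by move=> /(congr1 (fun p : V => p 0)). Qed.

Lemma eig_wt b l c t : eig b l c ->
  actV (torus l t) (cpol c) = cis ((-1) ^+ b / 2 * t) *: cpol c.
Proof.
move=> e; rewrite torus_cst e -cpolZ scalerA -scalerDl; congr (cpol (_ *: _)).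
rewrite -mulrA [2^-1 * t]mulrC /cis.
by case: b {e}; rewrite ?expr1 ?expr0 ?mulN1r ?mul1r ?cosN ?sinN; simpc.
Qed.

Lemma wt_eig l c (x : R) : c <> 0 ->
  (forall t, actV (torus l t) (cpol c) = cis (x * t) *: cpol c) ->
  exists2 b, eig b l c & x = (-1) ^+ b / 2.
Proof.
move=> c0 h; have [b e] : exists b, eig b l c.
  have := h pi; rewrite torus_cst cos_pihalf sin_pihalf scale0r add0r scale1r -cpolZ.
  move=> /cpol_inj e; have := congr1 (fun y => bivector l * y) e.
  rewrite mulrA bivector_sq mulN1r -scalerAr e scalerA => /eqP.
  rewrite eq_sym -subr_eq0 opprK -[X in _ + X]scale1r -scalerDl scaler_eq0.
  case/orP=> [|/eqP //]; rewrite -[1]opprK -imag_sq subr_eq0 -expr2 -expr2 eqf_sqr.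
  by case/orP=> /eqP z; [exists false|exists true]; rewrite /eig e z ?mul1r ?mulN1r.
exists b => //; apply: (char_inj c0) => t.
by apply: cpol_inj; rewrite !cpolZ -h -(eig_wt t e).
Qed.

Lemma homo0P p : homo 0 p -> exists c, p = cpol c.
Proof. by []. Qed.

(** Each derivative changes the weight by at most one, and constants have
weight 1/2 or -1/2. *)
Lemma plane_bound k p lam l : mono setT k p -> p <> 0 -> torus_weight (pred1 l) p lam ->
  lam 0 l <= k%:R + 2^-1.
Proof.
elim: k p lam => [|k IH] p lam hp p0 wp.
  have [c pc] : exists c, p = cpol c by apply: homo0P; case: hp.
  have c0 : c <> 0 by move=> c0; apply: p0; rewrite pc c0; exact: cl_poly_eq.
  rewrite pc in wp; have [b _ ->] := wt_eig c0 (wp l (eqxx _)).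
  by rewrite add0r; case: b; rewrite ?expr1 ?expr0; lra.
have sT := left_ideal_subspace (left_idealT R m).
have [q [lam' [hq q0 wq ll]]] := wt_lower sT hp p0 wp.
have := IH _ _ hq q0 wq; rewrite -natr1.
case: ll => [->|[b [l' ->]]]; first by lra.
rewrite !mxE eqxx /=; have [_|_] := eqVneq l l'; rewrite ?mulr0 ?mulr1; last by lra.
by case: b; rewrite ?expr1 ?expr0; lra.
Qed.

Variable l0 : 'I_n.
Hypothesis l0E : l0 = 0%N :> nat.
Hypothesis m3 : (3 <= m)%N.

(** A derivative shifts the weight by 0 or by plus or minus a unit vector, which is
at most the first unit vector. *)
Lemma lex_bound L sg k p lam : even_stable L ->
  (forall c mu, L c -> c <> 0 -> torus_weight predT (cpol c) mu -> lex_le mu sg) ->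
  mono L k p -> p <> 0 -> torus_weight predT p lam -> lex_le lam (sg + k%:R *: 'e_l0).
Proof.
move=> eL top; elim: k p lam => [|k IH] p lam hp p0 wp.
  rewrite scale0r addr0; have [c pc] : exists c, p = cpol c by apply: homo0P; case: hp.
  have c0 : c <> 0 by move=> c0; apply: p0; rewrite pc c0; exact: cl_poly_eq.
  apply: (top c) => //; last by rewrite -pc.
  by case: hp => _ /(_ 0); rewrite pc.
have [q [lam' [hq q0 wq ll]]] := wt_lower eL.1 hp p0 wp.
have := IH _ _ hq q0 wq; rewrite -natr1 scalerDl scale1r addrA.
case: ll => [->|[b [l ->]]] h.
  apply: (lex_trans h); rewrite -[X in lex_le X _]addr0 -[X in lex_le X _]addrC.
  by rewrite [X in lex_le _ X]addrC; apply: lexD; exact: lex_unit_gt0.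
have := lexD ((-1) ^+ b *: 'e_l) h; rewrite subrK => {}h.
apply: (lex_trans h); rewrite ![sg + _ + _]addrC; apply: lexD.
exact: lex_unit.
Qed.

(** Multiplication by u_a - i u_b, for the first plane. *)
Definition zop p : V := wpair true l0 (fun i => xop i p).

Lemma zopE p u :
  zop p u = ((u 0 (fst_idx l0))%:C - 'i%C * (u 0 (snd_idx l0))%:C) *: p u.
Proof.
rewrite /zop /wpair cl_polyDE cl_polyZE !xopE scalerA -scalerDl expr1 mulN1r.
by rewrite mulNr.
Qed.

Definition zpow k c : V := iter k zop (cpol c).

Lemma zpow_neq0 k c : c <> 0 -> zpow k c <> 0.
Proof.
move=> c0 /(congr1 (fun p : V => p 'e_(fst_idx l0))); suff -> : zpow k c 'e_(fst_idx l0) = c by [].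
elim: k => // k IH; rewrite /zpow iterS zopE IH !mxE !eqxx /=.
by rewrite eq_sym fst_snd_idx mulr0 subr0 scale1r.
Qed.

Lemma zpow_wt k c sg : torus_weight predT (cpol c) sg ->
  torus_weight predT (zpow k c) (sg + k%:R *: 'e_l0).
Proof.
move=> h; elim: k => [|k IH]; first by rewrite scale0r addr0.
have := wt_pair vop_x true l0 IH; rewrite -natr1 scalerDl scale1r addrA.
by rewrite expr1 scaleN1r opprK.
Qed.

Lemma eig_wpair c : eig false l0 c ->
  gen (fst_idx l0) * c + ((-1) ^+ true * 'i%C) *: (gen (snd_idx l0) * c) = 0.
Proof.
rewrite /eig /bivector mul1r => e; have := congr1 (fun y => gen (fst_idx l0) * y) e.
rewrite !mulrA gen_sq mulN1r -scalerAr mulNr => h.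
have -> : gen (snd_idx l0) * c = - ('i%C *: (gen (fst_idx l0) * c)).
  by rewrite -h opprK.
by rewrite scalerN scalerA expr1 mulN1r mulNr imag_sq opprK scale1r subrr.
Qed.

Lemma zpow_mono L k c : even_stable L -> L c -> eig false l0 c -> mono L k (zpow k c).
Proof.
move=> eL Lc ec; have sv := valued_subspace eL.1.
have e0 (d : nat) : wpair true l0 (fun i => eop i (zpow d c)) = 0.
  elim: d => [|d IH]; first by apply: cl_poly_eq => u; exact: eig_wpair.
  rewrite /wpair /zpow iterS -/(zpow d c) /zop /wpair.
  transitivity (xop (fst_idx l0) (wpair true l0 (fun i => eop i (zpow d c))) +
    ((-1) ^+ true * 'i%C) *: xop (snd_idx l0) (wpair true l0 (fun i => eop i (zpow d c)))).
    by rewrite /wpair !opE !ex; lin_solve (R[i]) ltac:(ring).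
  by rewrite IH !opE scaler0 addr0.
elim: k => [|k [hp vp Dp]].
  split=> //; first by exists c.
  by rewrite /Dir /cone big1 // => i _; rewrite dcst opE.
split.
- by apply: homoD; [|apply: homoZ]; exact: homo_x.
- by apply: (sub_wpair _ _ sv) => i; apply: valued_x => //; exact: eL.1.
rewrite /zpow iterS -/(zpow k c) /zop /wpair DirD DirZ !Dir_x Dp !opE !addr0.
exact: e0.
Qed.

End Weights.

(** * Highest weights of spinors *)
Section Commutation.
Variable A : pzRingType.
Implicit Types x y t v : A.

Lemma anti_comm4 x y t v : x * t = - (t * x) -> x * v = - (v * x) ->
  y * t = - (t * y) -> y * v = - (v * y) -> (x * y) * (t * v) = (t * v) * (x * y).
Proof.
move=> xt xv yt yv.
rewrite -mulrA (mulrA y) yt mulNr mulrN -(mulrA t) mulrA xt mulNr opprK.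
by rewrite -mulrA yv mulrN mulrN (mulrA x) xv mulNr mulrN opprK !mulrA.
Qed.

Lemma anti_flip x y t : x * x = -1 -> x * y = - (y * x) -> x * t = - (t * x) ->
  y * t = - (t * y) -> (x * y) * (x * t) = - ((x * t) * (x * y)).
Proof.
move=> xx xy xt yt; have e y' t' : x * y' = - (y' * x) -> (x * y') * (x * t') = y' * t'.
  by move=> h; rewrite h mulNr -mulrA (mulrA x x) xx mulN1r mulrN opprK.
by rewrite !e // opprK yt ?opprK.
Qed.
End Commutation.

Section SpinorWeights.
Variables (R : realType) (m : nat).
Local Notation C := R[i].
Local Notation Cl := (clifford C m).
Local Notation V := (cl_poly R m).
Local Notation n := m./2.
Implicit Types (c : Cl) (l : 'I_n) (b : bool) (lam mu : 'rV[R]_n) (L : set Cl).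
Variable l0 : 'I_n.
Hypothesis l0E : l0 = 0%N :> nat.
Hypothesis m3 : (3 <= m)%N.

Lemma bivector_comm l l' : l != l' -> bivector R l * bivector R l' = bivector R l' * bivector R l.
Proof.
move=> ll; apply: anti_comm4; apply: gen_anti; rewrite ?fst_idx_inj ?snd_idx_inj //.
  exact: fst_neq_snd.
by rewrite eq_sym fst_neq_snd.
Qed.

Definition eig_proj b l c : Cl := c - ((-1) ^+ b * 'i%C) *: (bivector R l * c).

Lemma eig_projP b l c : eig b l (eig_proj b l c).
Proof.
rewrite /eig /eig_proj; have := eig_unit R b; move: (_ * 'i%C) => z zz.
rewrite mulrBr -scalerAr mulrA bivector_sq mulN1r.
move: (bivector R l * c) => y; transitivity (z *: c - (z * z) *: y); last first.
  by lin_solve (R[i]) ltac:(ring).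
by rewrite zz; lin_solve (R[i]) ltac:(ring).
Qed.

Lemma eig_proj_other b b' l l' c : l != l' -> eig b' l' c -> eig b' l' (eig_proj b l c).
Proof.
rewrite /eig => ll e.
have h : bivector R l' * (bivector R l * c) = ((-1) ^+ b' * 'i%C) *: (bivector R l * c).
  by rewrite (mulrA (bivector R l')) -(bivector_comm ll) -(mulrA (bivector R l)) e -scalerAr.
rewrite /eig_proj mulrBr -scalerAr h e.
by move: (bivector R l * c) => y; lin_solve (R[i]) ltac:(ring).
Qed.

Lemma eig_proj0 b l c : eig_proj b l c = 0 -> eig (~~ b) l c.
Proof.
move=> /eqP; rewrite subr_eq0 => /eqP e; rewrite /eig.
have -> : (-1) ^+ (~~ b) * 'i%C = - ((-1) ^+ b * 'i%C) :> C.
  by case: b {e}; rewrite ?expr1 ?expr0 ?mulN1r ?mul1r ?opprK.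
rewrite {2}e scalerA; have := eig_unit R b; move: (_ * 'i%C) => z zz.
by rewrite mulNr zz opprK scale1r.
Qed.

Lemma eig_proj_stable L b l c : even_stable L -> L c -> L (eig_proj b l c).
Proof.
move=> [sL eL] Lc; apply: (subB sL) => //; apply: (subZ sL); exact: eL.
Qed.

(** Multiplication by e_a e_x, for x outside the plane, anticommutes with e_a e_b
and so exchanges the two eigenvalues. *)
Lemma eig_flip L c : even_stable L -> L c -> c <> 0 -> eig true l0 c ->
  exists c', [/\ L c', c' <> 0 & eig false l0 c'].
Proof.
move=> [sL eL] Lc c0 e; set a := fst_idx l0; set d := snd_idx l0.
have ad : a != d := fst_neq_snd l0 l0.
have [x xa] : exists x, x \notin [set a; d]%SET.
  have : (0 < #|~: [set a; d]%SET|)%N.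
    by rewrite cardsCs finset.setCK cards2 ad card_ord subn_gt0.
  by case/card_gt0P => x; rewrite inE => h; exists x.
move: xa; rewrite !inE negb_or => /andP[xa xd].
have h1 := gen_sq R[i] a; have h2 := gen_anti R[i] ad.
have h3 : gen a * gen x = - (gen x * gen a) :> Cl by apply: gen_anti; rewrite eq_sym.
have h4 : gen d * gen x = - (gen x * gen d) :> Cl by apply: gen_anti; rewrite eq_sym.
have fl : bivector R l0 * (gen a * gen x) = - (gen a * gen x * bivector R l0) :=
  anti_flip h1 h2 h3 h4.
exists (gen a * gen x * c); split; first exact: eL.
  move=> z; apply: c0; have z2 := congr1 (fun y => gen x * (gen a * y)) z.
  move: z2; rewrite /= !mulr0 -(mulrA (gen a)) (mulrA (gen a) (gen a)) h1 mulN1r mulrN mulrA.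
  by rewrite gen_sq mulN1r opprK.
have tE : bivector R l0 * (gen a * gen x * c) = - (gen a * gen x * (bivector R l0 * c)).
  by rewrite (mulrA (bivector R l0)) fl mulNr -(mulrA (gen a * gen x)).
rewrite /eig tE e -scalerAr -scaleNr.
by rewrite expr1 expr0 mulN1r mul1r opprK.
Qed.

(** The highest weight is built one plane after the other, taking the greater
eigenvalue whenever some common eigenvector has it. *)
Lemma spin_greedy L : even_stable L -> L <> [set 0] -> forall j, (j <= n)%N ->
  exists (s : 'I_n -> bool) c, [/\ L c /\ c <> 0,
    forall l, (l < j)%N -> eig (s l) l c, (0 < j)%N -> s l0 = false &
    forall c' s', L c' -> c' <> 0 -> (forall l, eig (s' l) l c') ->
      (forall l, (l < j)%N -> s' l = s l) \/
      exists l : 'I_n, [/\ (l < j)%N, forall l' : 'I_n, (l' < l)%N -> s' l' = s l',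
        s' l = true & s l = false]].
Proof.
move=> eL L0; elim=> [_|j IH jn].
  have [c [Lc c0]] : exists c, L c /\ c <> 0.
    apply: contrapT => /forallNP h; apply: L0; apply/seteqP; split => [c Lc|c ->].
      by apply: contrapT => c0; apply: (h c).
    exact: (sub0 eL.1).
  by exists (fun=> false), c; split => // c' s' _ _ _; left.
have [s [c [[Lc c0] ec s0 top]]] := IH (ltnW jn).
pose l := Ordinal jn.
pose upd b l' := if l' == l then b else s l'.
have updl b : upd b l = b by rewrite /upd eqxx.
have upd_lt b (l' : 'I_n) : (l' < j)%N -> upd b l' = s l'.
  by rewrite /upd; case: eqP => // ->; rewrite ltnn.
have cases (l' : 'I_n) : (l' < j.+1)%N -> l' = l \/ (l' < j)%N.
  by rewrite ltnS leq_eqVlt => /predU1P[e|]; [left; apply: val_inj|right].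
have l0j : (0 < j)%N -> (l0 < j)%N by rewrite l0E.
have [[c1 [Lc1 c10 ec1 el1]]|none] := pselect (exists c1, [/\ L c1, c1 <> 0,
    forall l' : 'I_n, (l' < j)%N -> eig (s l') l' c1 & eig false l c1]).
  exists (upd false), c1; split => //.
  - by move=> l' /cases[->|lj]; [rewrite updl|rewrite upd_lt //; exact: ec1].
  - move=> _; have [j0|jp] := posnP j; last by rewrite upd_lt ?s0 ?l0j.
    have -> : l0 = l by apply: val_inj; rewrite /= l0E j0.
    exact: updl.
  move=> c' s' Lc' c'0 es'; have [eq|[l' [l'j eq t f]]] := top c' s' Lc' c'0 es'.
    case sl: (s' l).
      right; exists l; split => //; rewrite ?updl // => l' lj.
      by rewrite upd_lt // eq.
    by left=> l' /cases[->|lj]; [rewrite updl|rewrite upd_lt // eq].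
  right; exists l'; split; rewrite ?upd_lt //; first exact: ltnW.
  by move=> l'' ll; rewrite upd_lt ?eq // (ltn_trans ll).
(* No common eigenvector for the earlier planes has the greater eigenvalue in the
new one, so the projection of c on that eigenspace vanishes. *)
have elc : eig true l c.
  apply: (eig_proj0 (b := false)); apply: contrapT => p0; apply: none.
  exists (eig_proj false l c); split => //.
  - exact: eig_proj_stable.
  - move=> l' lj; apply: eig_proj_other; last exact: ec.
    by apply: contraTneq lj => <-; rewrite ltnn.
  - exact: eig_projP.
exists (upd true), c; split => //.
- by move=> l' /cases[->|lj]; [rewrite updl|rewrite upd_lt //; exact: ec].
- move=> _; have [j0|jp] := posnP j; last by rewrite upd_lt ?s0 ?l0j.
  have ll : l = l0 by apply: val_inj; rewrite /= l0E j0.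
  rewrite ll in elc none *; have [c1 [Lc1 c10 ec1]] := eig_flip eL Lc c0 elc.
  by case: none; exists c1; split => // l'; rewrite j0.
move=> c' s' Lc' c'0 es'; have [eq|[l' [l'j eq t f]]] := top c' s' Lc' c'0 es'.
  left=> l' /cases[->|lj]; last by rewrite upd_lt // eq.
  rewrite updl; case sl: (s' l) => //; case: none; exists c'; split => //.
    by move=> l'' lj; rewrite -eq.
  by rewrite -sl.
right; exists l'; split; rewrite ?upd_lt //; first exact: ltnW.
by move=> l'' ll; rewrite upd_lt ?eq // (ltn_trans ll).
Qed.

Lemma spin_top L : even_stable L -> L <> [set 0] -> exists sg : 'rV[R]_n,
  [/\ exists c, [/\ L c, c <> 0, eig false l0 c & torus_weight predT (cpol c) sg],
   sg 0 l0 = 2^-1 &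
   forall c mu, L c -> c <> 0 -> torus_weight predT (cpol c) mu -> lex_le mu sg].
Proof.
move=> eL L0; have [s [c [[Lc c0] ec s0 top]]] := spin_greedy eL L0 (leqnn n).
have {}s0 : s l0 = false by apply: s0; exact: leq_ltn_trans (ltn_ord l0).
pose sg : 'rV[R]_n := \row_l ((-1) ^+ s l / 2).
exists sg; split; last 2 first.
- by rewrite mxE s0 expr0 mul1r.
- move=> c' mu Lc' c'0 wmu.
  have /choice[s' hs'] l : exists b, eig b l c' /\ mu 0 l = (-1) ^+ b / 2.
    by have [b e1 e2] := wt_eig c'0 (wmu l isT); exists b.
  have [eq|[l [_ eq t f]]] := top c' s' Lc' c'0 (fun l => (hs' l).1).
    left; apply/rowP => l; rewrite mxE (hs' l).2 eq //.
  right; exists l; split => [l' ll|]; rewrite !mxE !(hs' _).2; first by rewrite eq.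
  by rewrite t f expr1 expr0; lra.
exists c; split => //; first by rewrite -s0; exact: ec.
by move=> l _ t; rewrite mxE; apply: eig_wt; exact: ec.
Qed.

(** The weight sg is the highest weight of L; that of the monogenics of degree k
exceeds it by k times the first unit vector. *)
Definition top_weight L (sg : 'rV[R]_n) := [/\ sg 0 l0 = 2^-1,
  forall k, exists p, [/\ mono L k p, p <> 0 & torus_weight predT p (sg + k%:R *: 'e_l0)] &
  forall k p lam, mono L k p -> p <> 0 -> torus_weight predT p lam ->
    lex_le lam (sg + k%:R *: 'e_l0)].

Lemma hw_exists L : even_stable L -> L <> [set 0] -> exists sg, top_weight L sg.
Proof.
move=> eL L0; have [sg [[c [Lc c0 ec wc]] s0 top]] := spin_top eL L0.
exists sg; split => // k; last by move=> p lam hp p0 wp; exact: (lex_bound l0E eL top hp).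
exists (zpow l0 k c); split; [exact: zpow_mono|exact: zpow_neq0|exact: zpow_wt].
Qed.

End SpinorWeights.

(** * The Cartan product *)
Section Cartan.
Variables (R : realType) (m : nat).
Local Notation C := R[i].
Local Notation Cl := (clifford C m).
Local Notation V := (cl_poly R m).
Local Notation E := ('rV[R]_m -> Cl).
Local Notation n := m./2.
Implicit Types (p q : V) (c : Cl) (l : 'I_n) (lam mu : 'rV[R]_n) (S L : set Cl)
  (F : 'I_m -> V).
Local Notation MkR S k := (@tensor_space R E (monogenic S k) m).
Local Notation act := (@act_mono R m).
Local Notation actR := (act_tensor act (@rho1 R m)).

Lemma smallest_subspace (W : lmodType C) (U : set W) :
  Defs.subspace (smallest (@Defs.subspace R W) U).
Proof.
split=> [B [sB _]|a x y hx hy B [sB UB]]; first exact: (sub0 sB).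
by apply: (subP sB); [exact: hx|exact: hy].
Qed.

Definition grad p : 'I_m -> E := tval (fun i => dop i p).

Definition gradients S k : set ('I_m -> E) :=
  [set H | exists2 p, mono S k.+1 p & H = grad p].

Lemma gradP a p q : grad (a *: p + q) = a *: grad p + grad q.
Proof. by rewrite -tvalP; apply: eq_tval => i; rewrite dopD dopZ. Qed.

Lemma grad_act s p : spin s -> actR s (grad p) = grad (actV s p).
Proof.
move=> sS; rewrite /grad (act_tensor_tval _ sS); apply: eq_tval => i.
by rewrite d_act.
Qed.

Lemma grad0 : grad 0 = (0 : ('I_m -> E : lmodType C)).
Proof. by apply/funext => i; rewrite /grad /tval dop0. Qed.

Lemma grad_inj0 S k p : mono S k.+1 p ->
  grad p = (0 : ('I_m -> E : lmodType C)) -> p = 0.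
Proof.
move=> [hp _ _] g0; apply: (homo_inj_d hp) => i; apply: cl_fun_inj.
exact: (congr1 (fun H => H i) g0).
Qed.

Lemma subrep_gradients S L k : Defs.subspace S -> even_stable L -> L `<=` S ->
  subrep actR (MkR S k) (gradients L k).
Proof.
move=> sS eL LS; have sL := mono_subspace eL.1 k.+1; split.
- split; first by exists 0; [exact: (sub0 sL)|rewrite grad0].
  move=> a _ _ [p hp ->] [q hq ->]; exists (a *: p + q); first exact: (subP sL).
  by rewrite gradP.
- move=> _ [p hp ->]; apply/tensorE => i; apply: mono_d => //.
  exact: (mono_sub LS).
- move=> s _ sS' [p hp ->]; exists (actV s p); first exact: mono_act.
  exact: grad_act.
Qed.

Lemma subrep_monogenic S k (U : set E) : (3 <= m)%N ->
  subrep act (monogenic S k) U -> exists2 L, even_stable L & U = monogenic L k.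
Proof.
move=> m3 hU; have [_ UM _] := hU.
have [p Up|L eL UE] := lie_stable_mono (k := k) m3 (subrep_lie hU).
  by apply: (@mono_sub _ _ S setT); [|apply/monogenicE; exact: UM].
exists L => //; apply/seteqP; split => f hf.
  rewrite -(to_polyK (monogenic_pol (UM _ hf))); apply/monogenicE; rewrite -UE /=.
  by rewrite to_polyK //; exact: monogenic_pol (UM _ hf).
have := monogenic_to_poly hf; rewrite -UE /= to_polyK //; exact: monogenic_pol hf.
Qed.

Lemma subrep_mono L S k : even_stable L -> L `<=` S ->
  subrep act (monogenic S k) (monogenic L k).
Proof.
move=> eL LS; split; first exact: (monogenic_subspace k eL.1).
  by move=> f [hf vf Df]; split=> // u; apply: LS.
move=> s f sS hf; rewrite -(to_polyK (monogenic_pol hf)) (act_mono_poly _ sS).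
by apply/monogenicE; apply: mono_act => //; exact: monogenic_to_poly.
Qed.

Lemma mono_set0 L k p : L = [set 0] -> mono L k p -> p = 0.
Proof. by move=> -> [_ vp _]; apply: cl_poly_eq => u; exact: vp. Qed.

(** A subrepresentation consists of the monogenics with values in some L', and
these take their values in the intersection of L and L'. *)
Lemma mono_irreducible L k : (3 <= m)%N -> even_minimal L ->
  (exists2 p, mono L k p & p <> 0) -> irreducible act (monogenic L k).
Proof.
move=> m3 [eL L0 minL] [p0 hp0 p00].
have sL := monogenic_subspace k eL.1; split.
- exact: subrep_mono.
- move=> M0; apply: p00; apply: cl_fun_inj.
  have : monogenic L k (cl_fun p0) by exact/monogenicE.
  by rewrite M0.
move=> U hU; have [L' eL' UE] := subrep_monogenic m3 hU.
have [sU UM _] := hU.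
pose I := L `&` L'; have eI : even_stable I.
  split; first split.
  - by split; [exact: (sub0 eL.1)|exact: (sub0 eL'.1)].
  - by move=> a x y [Lx L'x] [Ly L'y]; split; [exact: (subP eL.1)|exact: (subP eL'.1)].
  by move=> a b c [Lc L'c]; split; [exact: eL.2|exact: eL'.2].
have [I0|IL] := minL I eI (fun c Ic => Ic.1).
  left; apply/seteqP; split => [f Uf|_ ->]; last exact: (sub0 sU).
  have [_ v _] := UM _ Uf; have [_ v' _] : monogenic L' k f by rewrite -UE.
  apply/funext => u; suff : I (f u) by rewrite I0.
  by split; [exact: v|exact: v'].
right; apply/seteqP; split => // f [hf vf Df]; rewrite UE; split => // u.
have : I (f u) by rewrite IL; exact: vf.
by case.
Qed.

Lemma gradients_irreducible L S k : (3 <= m)%N -> even_minimal L -> L `<=` S ->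
  (exists2 p, mono L k.+1 p & p <> 0) -> irreducible actR (gradients L k).
Proof.
move=> m3 mL LS hp; have [eL _ _] := mL.
have irr := mono_irreducible m3 mL hp; have [p0 hp0 p00] := hp.
have [sG _ aG] := subrep_gradients k eL.1 eL (@subset_refl _ L).
split; first by split; [exact: sG|exact: subset_refl|exact: aG].
  move=> G0; apply: p00; apply: (grad_inj0 hp0).
  have h : gradients L k (grad p0) by exists p0.
  rewrite G0 in h; exact: h.
move=> U [sU UG aU]; pose U' := [set f | monogenic L k.+1 f /\ U (grad (to_poly f))].
have hU' : subrep act (monogenic L k.+1) U'.
  have sL := monogenic_subspace k.+1 eL.1; split; last 2 first.
  - by move=> f [].
  - move=> s f sS [hf Uf]; have [_ _ aL] := subrep_mono k.+1 eL (@subset_refl _ L).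
    split; first exact: aL.
    have <- : actR s (grad (to_poly f)) = grad (to_poly (act s f)).
      rewrite (grad_act _ sS) -{2}(to_polyK (monogenic_pol hf)) (act_mono_poly _ sS).
      by rewrite cl_funK.
    exact: aU.
  have e0 : grad (to_poly 0) = 0 := etrans (congr1 grad (cl_funK 0)) grad0.
  split; first split; [exact: (sub0 sL)|exact: (eq_ind_r U (sub0 sU) e0)|].
  move=> a f g [hf Uf] [hg Ug]; split; first exact: (subP sL).
  rewrite (to_polyP a (monogenic_pol hf) (monogenic_pol hg)) gradP.
  exact: (subP sU).
have [_ _ /(_ _ hU')[U0|UL]] := irr.
  left; apply/seteqP; split => [H UH|_ ->]; last exact: (sub0 sU).
  have [p hpp HE] := UG _ UH.
  have : U' (cl_fun p) by split; [exact/monogenicE|rewrite cl_funK -HE].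
  rewrite U0 => z; have p0E : p = 0 by exact: cl_fun_inj.
  by rewrite HE p0E grad0.
right; apply/seteqP; split => // _ [p hpp ->].
have : U' (cl_fun p) by rewrite UL; exact/monogenicE.
by case=> _; rewrite cl_funK.
Qed.

Lemma weight_monogenic L k lam : weight act (monogenic L k) lam <->
  exists p, [/\ mono L k p, p <> 0 & torus_weight predT p lam].
Proof.
split=> [[f [hf f0 wf]]|[p [hp p0 wp]]].
  exists (to_poly f); have fE := to_polyK (monogenic_pol hf); split.
  - exact: monogenic_to_poly.
  - by move=> z; apply: f0; rewrite -fE z.
  move=> l _ t; apply: cl_fun_inj.
  rewrite -(act_mono_poly _ (torus_spin _ _)) fE.
  by apply: (etrans (wf l t)); rewrite -[in LHS]fE.
exists (cl_fun p); split; first exact/monogenicE.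
  by move=> z; apply: p0; exact: cl_fun_inj.
move=> l t; rewrite (act_mono_poly _ (torus_spin _ _)).
exact: (congr1 (@cl_fun R m) (wp l isT t)).
Qed.

Lemma weight_gradients L k lam : weight actR (gradients L k) lam <->
  exists p, [/\ mono L k.+1 p, p <> 0 & torus_weight predT p lam].
Proof.
split=> [[H [[p hp ->] H0 wH]]|[p [hp p0 wp]]].
  exists p; split => //; first by move=> z; apply: H0; rewrite z grad0.
  move=> l _ t; apply/eqP; rewrite -subr_eq0; apply/eqP.
  have hd : homo k.+1 (actV (torus l t) p - cis (lam 0 l * t) *: p).
    by case: hp => hp _ _; apply: homoD; [exact: homo_act|exact/homoN/homoZ].
  apply: (homo_inj_d hd) => i; rewrite dopD dopN dopZ; apply/eqP.
  rewrite subr_eq0; apply/eqP; apply: cl_fun_inj.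
  have := wH l t; rewrite (grad_act _ (torus_spin l t)) => /(congr1 (fun H => H i)).
  exact.
exists (grad p); split; first by exists p.
  by move=> z; apply: p0; exact: (grad_inj0 hp).
move=> l t; rewrite (grad_act _ (torus_spin l t)) (wp l isT t).
by apply/funext => i; rewrite /grad /tval dopZ.
Qed.

Variable l0 : 'I_n.
Hypothesis l0E : l0 = 0%N :> nat.
Hypothesis m3 : (3 <= m)%N.

Lemma highest_monogenic L k sg : top_weight l0 L sg ->
  highest_weight act (monogenic L k) (sg + k%:R *: 'e_l0).
Proof.
move=> [_ ex top]; split; first exact/weight_monogenic.
by move=> mu /weight_monogenic[p [hp p0 wp]]; exact: (top k p).
Qed.

Lemma highest_gradients L k sg : top_weight l0 L sg ->
  highest_weight actR (gradients L k) (sg + k%:R *: 'e_l0 + 'e_l0).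
Proof.
move=> [_ ex top]; rewrite -addrA.
have -> : k%:R *: 'e_l0 + 'e_l0 = k.+1%:R *: 'e_l0 :> 'rV[R]_n.
  by rewrite -natr1 scalerDl scale1r.
split; first exact/weight_gradients.
by move=> mu /weight_gradients[p [hp p0 wp]]; exact: (top k.+1 p).
Qed.

Lemma highest_unique (W : lmodType C) (a : clifford R m -> W -> W) (U : set W) lam mu :
  highest_weight a U lam -> highest_weight a U mu -> lam = mu.
Proof. by move=> [wl tl] [wm tm]; apply: lex_anti; [exact: tm|exact: tl]. Qed.

Lemma highest_vector : highest_weight_real (@rho1 R m) ('e_l0 : 'rV[R]_n).
Proof.
have sf l l' : snd_idx l == fst_idx l' = false by rewrite eq_sym fst_snd_idx.
(* The vector e_a - i e_b, for the first plane. *)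
pose Fv (i : 'I_m) : C :=
  if i == fst_idx l0 then 1 else if i == snd_idx l0 then - 'i%C else 0.
have Ff l : Fv (fst_idx l) = (l == l0)%:R.
  by rewrite /Fv fst_idx_inj fst_snd_idx; case: (l == l0).
have Fs l : Fv (snd_idx l) = (l == l0)%:R * - 'i%C.
  by rewrite /Fv snd_idx_inj sf; case: (l == l0); rewrite ?mul1r ?mul0r.
split.
  exists Fv; split => //.
    move=> /(congr1 (fun H => H (fst_idx l0))); rewrite Ff eqxx => /eqP.
    by rewrite oner_eq0.
  move=> l t; apply/funext => i; rewrite -/(cis _).
  transitivity (rot l t Fv i); first by [].
  transitivity (cis ((l == l0)%:R * t) * Fv i); last first.
    by rewrite mxE eqxx [l == l0]eq_sym.
  rewrite rotE Ff Fs; have [->|il] := eqVneq i (fst_idx l).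
    rewrite Ff; case: (l == l0); last by rewrite !(mul0r, mulr0, scaler0) subr0.
    by rewrite !mul1r mulr1 /cis /GRing.scale /=; simpc.
  have [->|il'] := eqVneq i (snd_idx l).
    rewrite Fs; case: (l == l0); last by rewrite !(mul0r, mulr0, scaler0) addr0.
    by rewrite !mul1r /cis /GRing.scale /=; simpc.
  have [ll|_] := eqVneq l l0; last by rewrite mul0r cis0 mul1r.
  by rewrite /Fv -ll (negPf il) (negPf il') mulr0.
move=> mu [F [_ F0 wF]].
have [i Fi] : exists i, F i <> 0.
  by apply: contrapT => /forallNP h; apply: F0; apply/funext => i; exact: contrapT (h i).
have wr l t i' : rot l t F i' = cis (mu 0 l * t) *: F i'.
  exact: (congr1 (fun H => H i') (wF l t)).
have wp b l l' t : wpair b l (rot l' t F) = cis (mu 0 l' * t) *: wpair b l F.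
  rewrite /wpair !wr scalerDr; congr (_ + _).
  by rewrite /GRing.scale /=; ring.
have c0 (x : C) (y : R) : x <> 0 -> (forall t, x = cis (y * t) *: x) -> y = 0.
  by move=> x0 h; apply: (char_inj x0) => t; rewrite -h mul0r cis0 scale1r.
have [[l il]|il] := plane_cases i; last first.
  have -> : mu = 0.
    apply/rowP => l; rewrite mxE; apply: (c0 (F i) _ Fi) => t.
    by rewrite -wr rot_fixed //; case: (il l).
  exact: lex_unit_gt0.
have [b pb] : exists b, wpair b l F <> 0.
  apply: contrapT => /forallNP h; apply: Fi.
  have e0 := contrapT (h false); have e1 := contrapT (h true).
  have [] := pair_inj e0 e1; by case: il => ->.
have -> : mu = (-1) ^+ b *: 'e_l; last exact: lex_unit.
apply/rowP => l'; rewrite !mxE eqxx /=.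
have [->|ll] := eqVneq l' l.
  by rewrite mulr1; apply: (char_inj pb) => t; rewrite -wp rot_pair.
by rewrite mulr0; apply: (c0 _ _ pb) => t; rewrite -wp rot_pair_other // eq_sym.
Qed.

Lemma plane_kill k p (x : R) : mono setT k p -> k%:R + 2^-1 < x ->
  (forall t, actV (torus l0 t) p = cis (x * t) *: p) -> p = 0.
Proof.
move=> hp kx h; apply: contrapT => p0.
have w : torus_weight (pred1 l0) p (const_mx x) by move=> l /eqP -> t; rewrite mxE.
by have := plane_bound hp p0 w; rewrite mxE leNgt kx.
Qed.

Section HighestTuple.
Variables (L : set Cl) (k : nat) (P : 'I_m -> V).
Hypotheses (eL : even_stable L) (hP : forall i, mono L k (P i)).
Hypothesis wP : forall t i,
  actT (torus l0 t) P i = cis ((k%:R + 2^-1 + 1) * t) *: P i.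

Let sT := left_ideal_subspace (left_idealT R m).
Let hT p j : mono L j p -> mono setT j p.
Proof. by move=> h; apply: (mono_sub _ h). Qed.
Let a := fst_idx l0.
Let b := snd_idx l0.
Let q := P a.

Let rotP t i : rot l0 t (fun j => actV (torus l0 t) (P j)) i =
  cis ((k%:R + 2^-1 + 1) * t) *: P i.
Proof. exact: wP. Qed.

Let wpairP (s : bool) t : actV (torus l0 t) (wpair s l0 P) =
  cis ((k%:R + 2^-1 + 1 - (-1) ^+ s) * t) *: wpair s l0 P.
Proof.
have e : cis ((-1) ^+ s * t) *: actV (torus l0 t) (wpair s l0 P) =
    cis ((k%:R + 2^-1 + 1) * t) *: wpair s l0 P.
  transitivity (wpair s l0 (rot l0 t (fun j => actV (torus l0 t) (P j)))).
    by rewrite rot_pair /wpair actVD actVZ.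
  by rewrite /wpair !rotP; lin_solve (R[i]) ltac:(ring).
by rewrite mulrBl addrC cisD -scalerA -e scalerA cisNK scale1r.
Qed.

Lemma highest_tuple_other i : i != a -> i != b -> P i = 0.
Proof.
move=> ia ib; apply: (plane_kill (hT (hP i)) (x := k%:R + 2^-1 + 1)); first by rewrite ltrDl.
by move=> t; rewrite -rotP rot_fixed.
Qed.

Lemma highest_tuple_snd : P b = - ('i%C *: q).
Proof.
have sM := mono_subspace sT k.
have : wpair true l0 P = 0.
  have hw : mono setT k (wpair true l0 P) by apply: sub_wpair => // i; exact: hT.
  apply: (plane_kill hw) (wpairP true); rewrite expr1 opprK -addrA ltrDl; lra.
rewrite /wpair -/q -/b expr1 mulN1r scaleNr => /eqP; rewrite subr_eq0 => /eqP ->.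
by rewrite scalerA imag_sq scaleN1r opprK.
Qed.

Let wq t : actV (torus l0 t) q = cis ((k%:R + 2^-1) * t) *: q.
Proof.
have := wpairP false t; rewrite expr0 addrK.
have -> : wpair false l0 P = 2%:R *: q.
  rewrite /wpair -/q -/b highest_tuple_snd expr0 mul1r scalerN scalerA imag_sq scaleN1r opprK.
  by rewrite scaler_nat mulr2n.
rewrite actVZ scalerA [cis _ * _]mulrC -scalerA => h.
by apply: (scalerI (two_neq0 R)); exact: h.
Qed.

Let wtq : torus_weight (pred1 l0) q (const_mx (k%:R + 2^-1)).
Proof. by move=> l /eqP -> t; rewrite mxE wq. Qed.

Let hq : mono setT k q. Proof. exact: (hT (hP a)). Qed.

Let low_kill r (x : R) : (forall j : nat, k = j.+1 -> mono setT j r) ->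
  (k = 0%N -> r = 0) -> k%:R + 2^-1 <= x ->
  (forall t, actV (torus l0 t) r = cis (x * t) *: r) -> r = 0.
Proof.
case: k => [|j] hr h0 kx w; first exact: h0.
by apply: (plane_kill (hr j _) _ w) => //; rewrite -natr1 in kx; lra.
Qed.

Let dq i : (k = 0%N -> dop i q = 0) /\ (forall j, k = j.+1 -> mono setT j (dop i q)).
Proof.
split=> [k0|j kj]; first by case: hq; rewrite k0 => h _ _; exact: homo0_d.
by move: hq; rewrite kj; exact: mono_d.
Qed.

Let d_other i : i != a -> i != b -> dop i q = 0.
Proof.
move=> ia ib; apply: (low_kill (dq i).2 (dq i).1 (lexx _)) => t.
have il l : pred1 l0 l -> i != fst_idx l /\ i != snd_idx l by move=> /eqP ->.
by have := wt_fixed (@vop_d R m) il wtq (eqxx l0) t; rewrite mxE.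
Qed.

Let d_pair : wpair true l0 (fun i => dop i q) = 0.
Proof.
apply: (low_kill (x := k%:R + 2^-1 + 1)).
- by move=> j kj; apply: sub_wpair => [|i]; [exact: mono_subspace sT j|exact: (dq i).2].
- by move=> k0; rewrite /wpair !(dq _).1 // scaler0 addr0.
- by rewrite lerDl.
move=> t; have := wt_pair (@vop_d R m) true l0 wtq (eqxx l0) t.
by rewrite !mxE !eqxx /= mulr1 expr1 opprK.
Qed.

Let d_snd : dop b q = - ('i%C *: dop a q).
Proof.
move: d_pair; rewrite /wpair -/a -/b expr1 mulN1r scaleNr => /eqP.
rewrite subr_eq0 => /eqP ->.
by rewrite scalerA imag_sq scaleN1r opprK.
Qed.

Let e_pair : wpair true l0 (fun i => eop i q) = 0.
Proof.
have [h1 _ Dq] := hq.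
have hw : mono setT k (wpair true l0 (fun i => eop i q)).
  split => //; first by apply: homoD; [|apply: homoZ]; exact: homo_e.
  transitivity (- (wpair true l0 (fun i => dop i q)) *+ 2).
    by rewrite /wpair DirD DirZ !Dir_e Dq !opE; lin_solve (R[i]) ltac:(ring).
  by rewrite d_pair oppr0 mul0rn.
apply: (plane_kill hw (x := k%:R + 2^-1 + 1)); first by rewrite ltrDl.
move=> t; have := wt_pair (@vop_e R m) true l0 wtq (eqxx l0) t.
by rewrite !mxE !eqxx /= mulr1 expr1 opprK.
Qed.

Let z_d : zop l0 (dop a q) = k%:R *: q.
Proof.
have [h1 _ _] := hq; rewrite -(homo_Eul h1) /Eul /conx.
have ab : a != b := fst_neq_snd l0 l0.
rewrite (bigD1 a) //= (bigD1 b) 1?eq_sym //= big1 ?addr0 => [|i /andP[ia ib]]; last first.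
  by rewrite d_other // opE.
by rewrite d_snd /zop /wpair -/a -/b !opE expr1 mulN1r scaleNr.
Qed.

(** In the plane of e_a and e_b the weight of P exceeds by one the bound for its
components, so P is supported on that plane with P_b = - i P_a. By the same
bound q = P_a depends only on z = u_a - i u_b in the sense that its derivatives
vanish in all directions but one; hence z d_a q = k q, and P is the gradient of
z q / (k + 1). *)
Lemma highest_tuple_grad : exists2 p, mono L k.+1 p & P =1 (fun i => dop i p).
Proof.
have ab : a != b := fst_neq_snd l0 l0.
have ba : b == a = false by rewrite eq_sym (negPf ab).
have k0 : (k.+1%:R : C) != 0 by rewrite pnatr_eq0.
have dz i : dop i (zop l0 q) = (i == a)%:R *: q + (- 'i%C * (i == b)%:R) *: q +
    zop l0 (dop i q).
  rewrite /zop /wpair -/a -/b expr1 mulN1r !opE !dx.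
  by lin_solve (R[i]) ltac:(ring).
exists (k.+1%:R^-1 *: zop l0 q).
  apply: (subZ (mono_subspace eL.1 _)); have [h1 v1 D1] := hP a; split.
  - by apply: homoD; [|apply: homoZ]; exact: homo_x.
  - apply: (sub_wpair _ _ (valued_subspace eL.1)) => i; apply: valued_x => //.
    exact: eL.1.
  transitivity (wpair true l0 (fun i => eop i q)); last exact: e_pair.
  by rewrite /zop /wpair DirD DirZ !Dir_x D1 !opE !addr0.
move=> i; rewrite opE dz; apply: (scalerI k0).
rewrite [RHS]scalerA mulfV // scale1r -natr1.
have [->|ia] := eqVneq i a.
  rewrite (negPf ab) z_d -/q mulr0 scale0r addr0 /= ?mulr1n.
  by lin_solve (R[i]) ltac:(ring).
have [->|ib] := eqVneq i b.
  rewrite highest_tuple_snd d_snd.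
  transitivity (- 'i%C *: q + (- 'i%C) *: zop l0 (dop a q)).
    by rewrite z_d; lin_solve (R[i]) ltac:(ring).
  rewrite scale0r add0r /= ?mulr1n mulr1 /zop /wpair !opE.
  by lin_solve (R[i]) ltac:(ring).
rewrite highest_tuple_other // d_other // /zop /wpair !opE /= ?mulr0n mulr0.
by lin_solve (R[i]) ltac:(ring).
Qed.
End HighestTuple.

(** For an irreducible V' the first coordinate of the required highest weight makes
the highest weight vector of X a gradient, and X then lies in the gradients by
irreducibility. Conversely the gradients of the monogenics with values in an
irreducible module of the even subalgebra are such an X. *)
Lemma cartan_gradients S k : minimal_left_ideal S ->
  cartan_product act (monogenic S k) (@rho1 R m) = gradients S k.
Proof.
move=> mS; have [lS _ _] := mS; have sS := left_ideal_subspace lS.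
have eS := left_ideal_even lS.
have m0 : (0 < m)%N by rewrite (leq_trans _ m3).
have [sG _ _] := subrep_gradients k sS eS (@subset_refl _ S).
apply/seteqP; split.
  apply: smallest_sub => // H [X [V' [lam [mu [[hV' irrV'] hX irrX [hlam hmu] hX']]]]] XH.
  have [L eL VE] := subrep_monogenic m3 hV'; subst V'.
  have L0 : L <> [set 0].
    move=> L0; have [_ V0 _] := irrV'; apply: V0; apply/seteqP.
    split => [f hf|_ ->]; last exact: (sub0 (monogenic_subspace k eL.1)).
    have := mono_set0 L0 (monogenic_to_poly hf) => f0.
    by rewrite -(to_polyK (monogenic_pol hf)) f0.
  have [sg hsg] := hw_exists l0E m3 eL L0.
  have lamE := highest_unique hlam (highest_monogenic k hsg).
  have muE : mu = 'e_l0 by exact: (highest_unique hmu highest_vector).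
  have [[F [XF F0 wF]] _] := hX'; have [sX XM aX] := hX.
  have hF := XM _ XF; pose P := tpoly F.
  have FE : F = tval P by rewrite (tpolyK hF).
  have wP t i : actT (torus l0 t) P i = cis ((k%:R + 2^-1 + 1) * t) *: P i.
    apply: cl_fun_inj; have := wF l0 t; rewrite FE (act_tensor_tval _ (torus_spin l0 t)).
    move=> /(congr1 (fun H => H i)); have [s0 _ _] := hsg.
    by rewrite lamE muE !mxE s0 !eqxx /= mulr1 [2^-1 + _]addrC; exact.
  have [p hp PE] := highest_tuple_grad eL (tpoly_mono hF) wP.
  have GF : gradients L k F by exists p => //; rewrite FE; apply: eq_tval.
  have [sGL _ aGL] := subrep_gradients k eL.1 eL (@subset_refl _ L).
  pose Y := X `&` gradients L k.
  have hY : subrep actR X Y.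
    split.
    - split; first by split; [exact: (sub0 sX)|exact: (sub0 sGL)].
      move=> c x y [Xx Gx] [Xy Gy]; split; first exact: (subP sX).
      exact: (subP sGL).
    - by move=> x [].
    - by move=> s x sS' [Xx Gx]; split; [exact: aX|exact: aGL].
  have [_ _ /(_ _ hY)[Y0|YX]] := irrX.
    by have : Y F by []; rewrite Y0 => /F0.
  have [_ [p' hp' ->]] : Y H by rewrite YX.
  have LS : mono S k.+1 p'.
    have [h1 _ h3] := hp'; split => //.
    have sv := valued_subspace sS; have k0 : (k.+1%:R : C) != 0 by rewrite pnatr_eq0.
    apply: (sub_unZ sv k0); rewrite -(homo_Eul h1); apply: (sub_sum sv) => i _.
    apply: valued_x => // u; have [_ VS _] := hV'.
    have hd : monogenic L k (cl_fun (dop i p')) by apply/monogenicE; exact: (mono_d eL.1).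
    by have [_ v _] := VS _ hd; exact: v.
  by exists p'.
move=> _ [p hp ->].
have [p1 [p2 [L1 [L2 [pE L1S L2S [mL1 hp1] [mL2 hp2]]]]]] := minimal_split m0 mS hp.
have sC : Defs.subspace (cartan_product act (monogenic S k) (@rho1 R m)).
  exact: smallest_subspace.
suff sub L q : even_minimal L -> L `<=` S -> mono L k.+1 q ->
    cartan_product act (monogenic S k) (@rho1 R m) (grad q).
  rewrite pE -[p1]scale1r gradP; apply: (subP sC).
    exact: (sub _ _ mL1 L1S hp1).
  exact: (sub _ _ mL2 L2S hp2).
move=> mL LS hq; have [eL L0 _] := mL.
have [sg hsg] := hw_exists l0E m3 eL L0; have [_ ex _] := hsg.
have nz j : exists2 q, mono L j q & q <> 0.
  by have [q' [? ? _]] := ex j; exists q'.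
move=> B [_ UB]; apply: UB; exists (gradients L k); last by exists q.
exists (monogenic L k), (sg + k%:R *: 'e_l0), 'e_l0; split.
- by split; [exact: subrep_mono|exact: mono_irreducible].
- exact: (subrep_gradients k eL.1 eL (@subset_refl _ L)).
- exact: gradients_irreducible (@subset_refl _ L) _.
- by split; [exact: highest_monogenic|exact: highest_vector].
- exact: highest_gradients.
Qed.

End Cartan.

(** * Simplicial monogenics as tuples *)
Section Simplicial.
Variables (R : realType) (m : nat).
Local Notation C := R[i].
Local Notation Cl := (clifford C m).
Local Notation V := (cl_poly R m).
Local Notation E := ('rV[R]_m -> Cl).
Implicit Types (p q : V) (c : Cl) (S : set Cl) (F G T : 'I_m -> V)
  (s : clifford R m) (u v : 'rV[R]_m).

Definition bilin T u v : Cl := \sum_i (v 0 i)%:C *: T i u.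

Definition lin_poly (c : 'I_m -> Cl) : V := \sum_i xop i (cpol (c i)).

Lemma lin_polyE (c : 'I_m -> Cl) v : lin_poly c v = \sum_i (v 0 i)%:C *: c i.
Proof. by rewrite /lin_poly sumVE. Qed.

Lemma d_lin_poly (c : 'I_m -> Cl) i : dop i (lin_poly c) = cpol (c i).
Proof.
rewrite /lin_poly linear_sum -(sum_delta i (fun j => cpol (c j))).
by apply: eq_bigr => j _ /=; rewrite dx dcst opE addr0.
Qed.

Lemma bilin_lin T u : bilin T u = lin_poly (fun i => T i u).
Proof. by apply/funext => v; rewrite lin_polyE. Qed.

Lemma bilin_fst T v : (fun u => bilin T u v) = \sum_i (v 0 i)%:C *: T i.
Proof. by apply/funext => u; rewrite sumVE. Qed.

Lemma bilinP (a : C) F G : bilin (fun i => a *: F i + G i) = a *: bilin F + bilin G.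
Proof.
apply/funext => u; apply/funext => v; rewrite /bilin.
transitivity (a *: (\sum_i (v 0 i)%:C *: F i u) + \sum_i (v 0 i)%:C *: G i u); last by [].
rewrite scaler_sumr -big_sumD; apply: eq_bigr => i _.
by rewrite cl_polyDE cl_polyZE scalerDr !scalerA mulrC.
Qed.

Lemma bilin_delta T u i : bilin T u 'e_i = T i u.
Proof.
rewrite /bilin (bigD1 i) //= mxE !eqxx scale1r big1 ?addr0 // => j /negPf ji.
by rewrite mxE ji andbF scale0r.
Qed.

Lemma dirac_bilin T u v : Defs.dirac (bilin T u) v = cone T u.
Proof.
rewrite bilin_lin dirac_poly /Dir /cone !sumVE; apply: eq_bigr => i _.
by rewrite d_lin_poly !eopE.
Qed.

Lemma euler_bilin T u v :
  \sum_i (u 0 i)%:C *: partial i (bilin T u) v = conx T u.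
Proof.
rewrite /conx sumVE bilin_lin; apply: eq_bigr => i _.
by rewrite -dopE d_lin_poly.
Qed.

Lemma dirac_bilin_fst T u v :
  Defs.dirac (fun u => bilin T u v) u = \sum_i (v 0 i)%:C *: Dir (T i) u.
Proof.
rewrite bilin_fst dirac_poly linear_sum sumVE; apply: eq_bigr => i _.
by rewrite /= linearZ.
Qed.

Lemma homog_lin (c : 'I_m -> Cl) : homog_poly 1 (fun v => \sum_i (v 0 i)%:C *: c i).
Proof.
have -> : (fun v => \sum_i (v 0 i)%:C *: c i) = lin_poly c.
  by apply/funext => v; rewrite lin_polyE.
apply: homo_homog_poly; exists (fun i => cpol (c i)) => //.
by move=> i; exists (c i).
Qed.

Lemma bilin_bihomog k T : (forall i, homo k (T i)) -> bihomog_poly k 1 (bilin T).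
Proof.
move=> hT; have /choice[c cE] i := homo_homog_poly (hT i).
have /choice[d dE] al := homog_lin (fun i => c i al).
exists d => u v; rewrite /bilin.
transitivity (\sum_(al | multideg al == k) (monomial al u)%:C *:
    \sum_i (v 0 i)%:C *: c i al).
  under eq_bigr do rewrite cE scaler_sumr.
  rewrite exchange_big; apply: eq_bigr => al _ /=; rewrite scaler_sumr.
  by apply: eq_bigr => i _; rewrite !scalerA mulrC.
apply: eq_bigr => al _; rewrite dE scaler_sumr; apply: eq_bigr => be _.
by rewrite scalerA -(rmorphM (real_complex R)).
Qed.

(** The Dirac derivative in v and the mixed Euler operator of bilin T are constant
in v, equal to the contractions cone T and conx T. *)
Lemma bilin_simplicial S k T : @Defs.subspace R Cl S ->
  (forall i, mono S k (T i)) -> cone T = 0 -> conx T = 0 ->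
  simplicial_monogenic S k (bilin T).
Proof.
move=> sS hT eT xT; split.
- by apply: bilin_bihomog => i; case: (hT i).
- move=> u v; apply: (sub_sum sS) => i _; apply: (subZ sS).
  by case: (hT i).
- move=> u v; rewrite dirac_bilin_fst big1 // => i _.
  by case: (hT i) => _ _ ->; rewrite scaler0.
- by move=> u v; rewrite dirac_bilin eT.
- by move=> u v; rewrite euler_bilin xT.
Qed.

Lemma simplicial_bilin S k f : simplicial_monogenic S k f ->
  exists T, [/\ f = bilin T, forall i, mono S k (T i), cone T = 0 & conx T = 0].
Proof.
move=> [[c fE] vf df1 df2 xf].
have hmono i : monogenic S k (f^~ 'e_i).
  split; [|by move=> u; exact: vf|by move=> u; exact: df1].
  exists (fun al => \sum_(be | multideg be == 1%N) (monomial be ('e_i : 'rV[R]_m))%:C *: c al be).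
  move=> u; rewrite fE; apply: eq_bigr => al _; rewrite scaler_sumr.
  by apply: eq_bigr => be _; rewrite scalerA -(rmorphM (real_complex R)).
pose T i := to_poly (f^~ 'e_i).
have TE i u : T i u = f u 'e_i by rewrite (to_polyK (monogenic_pol (hmono i))).
have fT : f = bilin T.
  apply/funext => u; have hu : homog_poly 1 (f u).
    exists (fun be => \sum_(al | multideg al == k) (monomial al u)%:C *: c al be) => v.
    rewrite fE exchange_big; apply: eq_bigr => be _ /=; rewrite scaler_sumr.
    by apply: eq_bigr => al _; rewrite scalerA mulrC -(rmorphM (real_complex R)).
  have [q [F hF qE] qf] := homog_poly_homo hu.
  have /choice[d dE] i : exists c, F i = cpol c by exact: hF.
  have fd : f u = lin_poly d.
    by rewrite -qf qE; congr (cl_fun _); apply: eq_bigr => i _; rewrite dE.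
  rewrite bilin_lin fd; congr (cl_fun _); apply: eq_bigr => i _.
  congr (xop i (cpol _)); rewrite TE fd lin_polyE (bigD1 i) //= mxE !eqxx scale1r.
  by rewrite big1 ?addr0 // => j /negPf ji; rewrite mxE ji andbF scale0r.
exists T; split => //.
- by move=> i; exact: monogenic_to_poly.
- by apply: cl_poly_eq => u; rewrite -(dirac_bilin T u 0) -fT df2.
- by apply: cl_poly_eq => u; rewrite -(euler_bilin T u 0) -fT xf.
Qed.

Lemma act_simp_bilin s T : spin s -> act_simp s (bilin T) = bilin (actT s T).
Proof.
move=> sS; apply/funext => u; apply/funext => v; rewrite /act_simp !sandwichE //.
rewrite /bilin mulr_sumr.
transitivity (\sum_j \sum_i ((v 0 i)%:C * (rho1 s i j)%:C) *: actV s (T j) u).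
  apply: eq_bigr => j _; rewrite mxE rmorph_sum scaler_suml mulr_sumr.
  apply: eq_bigr => i _; rewrite -(scalerAr _ _ (T j _)) -(rmorphM (real_complex R)).
  by rewrite /actV lmulE rotpE.
rewrite exchange_big; apply: eq_bigr => i _; rewrite /actT sumVE scaler_sumr.
by apply: eq_bigr => j _; rewrite cl_polyZE scalerA.
Qed.

End Simplicial.

(** * The decomposition as an isomorphism of representations *)
Section Decompose.
Variables (R : realType) (m k : nat) (S : set (clifford R[i] m)).
Local Notation C := R[i].
Local Notation Cl := (clifford C m).
Local Notation V := (cl_poly R m).
Local Notation E := ('rV[R]_m -> Cl).
Local Notation M := (m%:R : C).
Local Notation J := (k%:R : C).
Implicit Types (p q : V) (F G T : 'I_m -> V) (H : 'I_m -> E).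
Local Notation MkR := (@tensor_space R E (monogenic S k.+1) m).
Local Notation act := (@act_mono R m).
Local Notation actR := (act_tensor act (@rho1 R m)).
Hypotheses (m3 : (3 <= m)%N) (lS : left_ideal S).
Let sS := left_ideal_subspace lS.
Let eS := left_ideal_even lS.
Let sM j := mono_subspace sS j.

Section Sum.
Variables (p q r : V) (T : 'I_m -> V).
Hypotheses (hp : mono S k.+1 p) (hq : mono S k q) (hr : mono S k.+2 r)
  (hT : forall i, mono S k.+1 (T i)) (eT : cone T = 0) (xT : conx T = 0).

(** The contractions of the four summands are known, so the components of their
sum can be computed one after the other. *)
Definition assemble i : V := iota1 k p i + iota2 k q i + dop i r + T i.

Let dT : cond T = 0.
Proof.
have DT i : Dir (T i) = 0 by case: (hT i).
have := Dir_cone T; rewrite eT (eq_cone DT).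
rewrite cone0 opE oppr0 add0r => /esym/eqP; rewrite oppr_eq0 -scaler_nat scaler_eq0.
by rewrite (negPf (two_neq0 R)) => /eqP.
Qed.

Let assembleE i : assemble i =
  1 *: iota1 k p i + (1 *: iota2 k q i + (1 *: dop i r + T i)).
Proof. by rewrite !scale1r /assemble !addrA. Qed.

Let Dp : Dir p = 0. Proof. by case: hp. Qed.
Let Dq : Dir q = 0. Proof. by case: hq. Qed.
Let Dr : Dir r = 0. Proof. by case: hr. Qed.

Lemma comp2_assemble : comp2 k assemble = q.
Proof.
have [n0 n2 m2 c2] := dim_neq0 R k m3.
rewrite /comp2 (eq_cond assembleE) !condP (cond_iota1 _ Dp).
rewrite (cond_iota2 m3 Dq (mono_Eul hq)) cond_d Dr dT opE oppr0.
by rewrite !scaler0 !addr0 add0r scale1r scalerA mulVf // scale1r.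
Qed.

Lemma comp1_assemble : comp1 k assemble = p.
Proof.
have [n0 n2 m2 c2] := dim_neq0 R k m3.
have dE : cond assemble = (M + J - 1) *: q.
  rewrite -[X in _ *: X]comp2_assemble /comp2 scalerA mulfV // scale1r.
  by [].
rewrite /comp1 /monoT dE (eq_cone assembleE) !coneP (cone_iota1 m3 Dp (mono_Eul hp)).
rewrite (cone_iota2 k m3 Dq) -/(Dir r) Dr eT opE.
by lin_solve (R[i]) ltac:(field; rewrite ?n0 ?n2 ?m2 ?c2).
Qed.

Let rest_assemble i : rest k assemble i = 1 *: dop i r + T i.
Proof.
rewrite /rest comp1_assemble comp2_assemble /assemble.
by lin_solve (R[i]) ltac:(ring).
Qed.

Lemma comp3_assemble : comp3 k assemble = r.
Proof.
have k2 := k2_neq0 R k.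
rewrite /comp3 (eq_conx rest_assemble) conxP xT -/(Eul r) (mono_Eul hr) -2!natr1.
by lin_solve (R[i]) ltac:(field).
Qed.

Lemma comp4_assemble i : comp4 k assemble i = T i.
Proof.
by rewrite /comp4 rest_assemble comp3_assemble; lin_solve (R[i]) ltac:(ring).
Qed.

Lemma assemble_mono i : mono S k.+1 (assemble i).
Proof.
apply: (subD (sM _)) => //; apply: (subD (sM _)); last exact: mono_d.
by apply: (subD (sM _)); [exact: mono_iota1|exact: mono_iota2].
Qed.
End Sum.

Definition decomposition H :
    ('I_m -> E) * E * E * ('rV[R]_m -> 'rV[R]_m -> Cl) :=
  (grad (comp3 k (tpoly H)), cl_fun (comp1 k (tpoly H)), cl_fun (comp2 k (tpoly H)),
   bilin (comp4 k (tpoly H))).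

Lemma tpolyP a H H' : MkR H -> MkR H' ->
  tpoly (a *: H + H') = fun i => a *: tpoly H i + tpoly H' i.
Proof.
move=> hH hH'; apply/funext => i.
exact: (to_polyP a (monogenic_pol (hH i)) (monogenic_pol (hH' i))).
Qed.

Lemma decomposition_lin a H H' : MkR H -> MkR H' ->
  decomposition (a *: H + H') = a *: decomposition H + decomposition H'.
Proof.
move=> hH hH'; rewrite /decomposition (tpolyP a hH hH').
set F := tpoly H; set G := tpoly H'.
have e4 : comp4 k (fun i => a *: F i + G i) = fun i => a *: comp4 k F i + comp4 k G i.
  by apply/funext => i; exact: comp4P.
rewrite comp1P comp2P comp3P e4 gradP bilinP; reflexivity.
Qed.

Lemma decomposition_act s H : spin s -> MkR H ->
  decomposition (actR s H) =
  act_sum (act_sum (act_sum actR act) act) (@act_simp R m) s (decomposition H).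
Proof.
move=> sS' hH; set F := tpoly H.
have e : tpoly (actR s H) = actT s F.
  apply/funext => i; rewrite -[in LHS](tpolyK hH) (act_tensor_tval _ sS').
  exact: tvalK.
have e4 : comp4 k (actT s F) = actT s (comp4 k F).
  by apply/funext => i; exact: comp4_act.
rewrite /decomposition e (comp1_act _ _ sS') (comp2_act _ _ sS') (comp3_act _ _ sS') e4.
rewrite -(grad_act (comp3 k F) sS') -(act_mono_poly (comp1 k F) sS').
rewrite -(act_mono_poly (comp2 k F) sS') -(act_simp_bilin (comp4 k F) sS').
reflexivity.
Qed.

Lemma decomposition_ker H : MkR H ->
  decomposition H = 0 -> H = (0 : ('I_m -> E : lmodType C)).
Proof.
move=> hH z; set F := tpoly H; have hF i : mono S k.+1 (F i) by exact: (tpoly_mono hH).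
have z3 : comp3 k F = 0.
  have h3 : mono S k.+2 (comp3 k F) by exact: mono_comp3.
  exact: (grad_inj0 h3 (congr1 (fun x => x.1.1.1) z)).
have z1 : comp1 k F = 0 by apply: cl_fun_inj; exact: (congr1 (fun x => x.1.1.2) z).
have z2 : comp2 k F = 0 by apply: cl_fun_inj; exact: (congr1 (fun x => x.1.2) z).
have z4 i : comp4 k F i = 0.
  apply: cl_fun_inj; apply/funext => u; rewrite -bilin_delta.
  exact: (congr1 (fun x => x.2 u 'e_i) z).
have F0 i : F i = 0.
  rewrite (decompE k F i) z1 z2 z3 z4 /iota1 /iota2 !opE.
  by lin_solve (R[i]) ltac:(ring).
rewrite -(tpolyK hH); apply/funext => i.
exact: (congr1 (@cl_fun R m) (F0 i)).
Qed.

Lemma decomposition_iso :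
  rep_iso actR MkR (act_sum (act_sum (act_sum actR act) act) (@act_simp R m))
    (gradients S k.+1 `*` monogenic S k.+1 `*` monogenic S k `*`
     simplicial_monogenic S k.+1) decomposition.
Proof.
have [sT _ _] := subrep_MkR k lS.
split; [|exact: decomposition_lin|exact: decomposition_act].
apply: (set_bij_lin sT decomposition_lin); last 1 first.
- move=> [[[H0 f] g] b] [[[hH0 hf] hg] hb]; move: hH0 hf hg hb => /= [r hr ->] hf hg.
  move=> /simplicial_bilin[T [-> hT eT xT]].
  have hp := monogenic_to_poly hf; have hq := monogenic_to_poly hg.
  pose F := assemble (to_poly f) (to_poly g) r T.
  exists (tval F); first by apply/tensorE => i; exact: assemble_mono.
  rewrite /decomposition (_ : tpoly (tval F) = F); last by apply/funext => i; exact: tvalK.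
  have e4 : comp4 k F = T by apply/funext => i; exact: comp4_assemble.
  rewrite (comp1_assemble hp hq hr hT eT) (comp2_assemble hp hq hr hT eT).
  rewrite (comp3_assemble hp hq hr hT eT xT) e4.
  by rewrite (to_polyK (monogenic_pol hf)) (to_polyK (monogenic_pol hg)).
- move=> H hH; have hF i : mono S k.+1 (tpoly H i) by exact: (tpoly_mono hH).
  have DF i : Dir (tpoly H i) = 0 by case: (hF i).
  have EF i : Eul (tpoly H i) = k.+1%:R *: tpoly H i by exact: (mono_Eul (hF i)).
  split; first split; first split.
  + by exists (comp3 k (tpoly H)) => //; exact: mono_comp3.
  + by apply/monogenicE; exact: mono_comp1.
  + by apply/monogenicE; exact: mono_comp2.
  apply: bilin_simplicial => //; [|exact: cone_comp4|exact: conx_comp4].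
  by move=> i; exact: mono_comp4.
- exact: decomposition_ker.
Qed.

End Decompose.

Theorem theorem2 (R : realType) (m k : nat) (hm : (3 <= m)%N) (hk : (1 <= k)%N)
    (S : set (clifford R[i] m)) (hS : spinor_space S) :
  let Mk := monogenic S k in
  let MkR := @tensor_space R _ Mk m in
  let actMk := @act_mono R m in
  let actMkR := act_tensor actMk (@rho1 R m) in
  (exists Phi,
     rep_iso actMkR MkR
       (act_sum (act_sum (act_sum actMkR actMk) actMk) (@act_simp R m))
       (cartan_product actMk Mk (@rho1 R m) `*` Mk `*` monogenic S k.-1
          `*` simplicial_monogenic S k)
       Phi) /\
  (exists K phi,
     [/\ subrep actMkR MkR K,
         rep_iso actMkR K actMk Mk phi,
         forall K', subrep actMkR MkR K' ->
           (exists psi, rep_iso actMkR K' actMk Mk psi) -> K' = K,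
         forall f, smooth_family Mk f -> forall x, MkR (gradient f x) &
         forall h, invariant_inner_product actMk Mk h ->
           forall f, smooth_family Mk f -> forall x,
             exists2 q, orth_proj (tensor_inner h (n := m)) K (gradient f x) q &
                        phi q = rarita_schwinger k f x]).
Proof.
have mS := spinor_minimal hS; have [lS _ _] := mS.
have sS := left_ideal_subspace lS.
case: k hk => // k _ Mk MkR actMk actMkR; split.
  have n0 : (0 < m./2)%N by rewrite half_gt0 (leq_trans _ hm).
  exists (decomposition k); rewrite (cartan_gradients (l0 := Ordinal n0) erefl hm k.+1 mS).
  exact: decomposition_iso.
exists (mid_comp S k), (mid_proj k); split.
- exact: subrep_mid_comp.
- exact: mid_proj_iso.
- by move=> K'; exact: mid_comp_unique.
- by move=> f sf x; exact: gradient_mono.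
move=> h hh f sf x; have [q hq qE] := orth_proj_mid hm lS hh (gradient_mono x sS sf).
exists q; first exact: hq.
exact: (etrans qE (esym (rarita_schwingerE x hm sS sf))).
Qed.
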